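(* There is a procedure (called MakeTree) running in time $O(|\Gamma|^2)$ that, given a graph representation of a power circuit $\Pi=(\Gamma,\delta)$, computes a tree representation of a power circuit $\Pi'=(\Gamma',\delta')$ which is equivalent to $\Pi$ in the following sense: for every node $Q\in\Gamma$ there is a node $Q'\in\Gamma'$ with $\varepsilon(Q')=\varepsilon(Q)$, and for every marking $M$ in $\Pi$ there is a marking $M'$ in $\Pi'$ with $\varepsilon(M')=\varepsilon(M)$ and $|\sigma(M')|\le|\sigma(M)|$. The number of nodes at most triples, i.e. $|\Gamma'|\le3|\Gamma|$.
   Context: Time is measured on a random-access machine (RAM). Let $\Gamma$ be a finite set and $\delta:\Gamma\times\Gamma\to\{-1,0,+1\}$ a map such that the directed graph with vertex set $\Gamma$ and arc set $\{(P,Q):\delta(P,Q)\ne0\}$ is acyclic; the graph representation is this arc-labeled directed acyclic graph. A marking is a map $M:\Gamma\to\{-1,0,+1\}$; its support is $\sigma(M)=\{P\in\Gamma: M(P)\neq0\}$. Each node $P$ has the marking $\Lambda_P$ given by $\Lambda_P(Q)=\delta(P,Q)$. Evaluations are defined by induction along the dag: $\varepsilon(P)=2^{\varepsilon(\Lambda_P)}$ for a node $P$, and $\varepsilon(M)=\sum_P M(P)\varepsilon(P)$ for a marking $M$. The pair $(\Gamma,\delta)$ is a power circuit if $\varepsilon(M)\in\mathbb Z$ for all markings $M$. A marking $M$ is compact if $\varepsilon(P)\ne\varepsilon(Q)\ne2\varepsilon(P)$ for all $P,Q\in\sigma(M)$ with $P\ne Q$. A tree representation of a power circuit $(\Gamma,\delta)$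 consists of: (1) $\Gamma$ as a list $[P_1,\ldots,P_n]$ with $\varepsilon(P_i)<\varepsilon(P_{i+1})$ for $1\le i<n$; (2) a bit vector $b(1),\ldots,b(n-1)$ with $b(i)=1$ iff $2\varepsilon(P_i)=\varepsilon(P_{i+1})$; (3) a ternary tree of height $n$ in which each node has at most three outgoing edges, labeled $+1,0,-1$; all leaves are at level $n$, and each leaf represents the marking $M:\Gamma\to\{-1,0,+1\}$ given by the labels on the unique path between the leaf and the root (one level per node of $\Gamma$); the markings represented by leaves must be compact, and all markings $\Lambda_P$ ($P\in\Gamma$) must be represented by leaves; for each level a list of the tree nodes in that level is kept. *)

(* Defs.v *)
From HB Require Import structures.
From mathcomp Require Import all_boot all_order all_algebra.
From mathcomp Require Import reals exp.

Set Implicit Arguments.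
Unset Strict Implicit.
Unset Printing Implicit Defensive.

Import Order.TTheory GRing.Theory Num.Theory.
Local Open Scope ring_scope.

Inductive trit := Minus | Zero | Plus.

Definition int_of_trit (s : trit) : int :=
  match s with Minus => -1 | Zero => 0 | Plus => 1 end.

Definition trit_of_int (z : int) : trit :=
  if z == -1 then Minus else if z == 0 then Zero else Plus.

Lemma int_of_tritK : cancel int_of_trit trit_of_int.
Proof. by case. Qed.

HB.instance Definition _ := Countable.copy trit (can_type int_of_tritK).

Section Circuit.
Variables (R : realType) (G : finType) (delta : G -> G -> trit).

Definition darc : rel G := [rel P Q | delta P Q != Zero].

(* [cycle darc c] says that [c] is a closed walk; loops are the case of a
   one-element [c]. *)
Definition acyclic : Prop := forall c : seq G, cycle darc c -> c = [::].

Definition Lambda (P : G) : G -> trit := delta P.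

Definition supp (M : G -> trit) : {set G} := [set P | M P != Zero].

(* Recursion along the arcs, truncated at depth [k].  In an acyclic graph no
   path has more than #|G| nodes, so the truncation is never reached when
   [k = #|G|]: see [eval_nodeE]. *)
Fixpoint eval_depth (k : nat) (P : G) : R :=
  if k is k'.+1 then
    2 `^ (\sum_(Q : G) (int_of_trit (delta P Q))%:~R * eval_depth k' Q)
  else 0.

Definition eval_node (P : G) : R := eval_depth #|G| P.

Definition eval_marking (M : G -> trit) : R :=
  \sum_(P : G) (int_of_trit (M P))%:~R * eval_node P.

Definition compact_marking (M : G -> trit) : Prop :=
  forall P Q : G, P \in supp M -> Q \in supp M -> P <> Q ->
    eval_node P <> eval_node Q /\ eval_node Q <> 2 * eval_node P.

Lemma acyclic_back P Q : acyclic -> darc P Q -> ~~ connect darc Q P.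
Proof.
move=> acyc PQ; apply/negP => /connectP [p pQ eP].
have : cycle darc (Q :: p) by rewrite /= rcons_path pQ -eP.
by move=> /acyc.
Qed.

Lemma eval_depth_stable : acyclic -> forall k P,
  (#|connect darc P| <= k)%N -> eval_depth k P = eval_depth k.+1 P.
Proof.
move=> acyc; elim=> [|k IHk] P.
  by rewrite leqn0 => /eqP /card0_eq /(_ P); rewrite /in_mem /= connect0.
move=> hP; rewrite /= -/(eval_depth k.+1); congr (_ `^ _).
apply: eq_bigr => Q _; case: (boolP (darc P Q)) => [PQ|].
  rewrite IHk //= -ltnS (leq_trans _ hP) //; apply/proper_card/properP; split.
    apply/subsetP => S; rewrite /in_mem /= => QS.
    exact: connect_trans (connect1 PQ) QS.
  exists P; rewrite /in_mem /= ?connect0 //; exact: acyclic_back.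
by rewrite negbK => /eqP ->; rewrite !mul0r.
Qed.

Lemma eval_nodeE (P : G) : acyclic ->
  eval_node P = 2 `^ (eval_marking (Lambda P)).
Proof.
move=> acyc; rewrite {1}/eval_node eval_depth_stable //.
exact: max_card.
Qed.

End Circuit.

Record power_circuit (R : realType) := PowerCircuit {
  node :> finType;
  delta : node -> node -> trit;
  delta_acyclic : acyclic delta;
  eval_int : forall M : node -> trit, eval_marking R delta M \is a Num.int
}.

Definition eps_node (R : realType) (Pi : power_circuit R) : Pi -> R :=
  eval_node R (@delta R Pi).

Definition eps (R : realType) (Pi : power_circuit R) : (Pi -> trit) -> R :=
  eval_marking R (@delta R Pi).

Definition equivalent (R : realType) (Pi Pi' : power_circuit R) : Prop :=
  (forall Q : Pi, exists Q' : Pi', eps_node Q' = eps_node Q) /\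
  (forall M : Pi -> trit, exists M' : Pi' -> trit,
     eps M' = eps M /\ (#|supp M'| <= #|supp M|)%N).

(* A node of a ternary tree is identified with the word of labels met on the
   way from the root to it; its level is the length of that word. *)
Record tree_data (G : finType) := TreeData {
  nodes : seq G;
  bits : seq bool;
  tree : pred (seq trit);
  level_list : nat -> seq (seq trit)
}.

(* The tree is nonempty and closed under taking parents, its height is at most
   [n], and every node above level [n] has a child, i.e. is not a leaf. *)
Definition is_ternary_tree (n : nat) (T : pred (seq trit)) : Prop :=
  [/\ T [::],
      forall w s, T (rcons w s) -> T w,
      forall w, T w -> (size w <= n)%N &
      forall w, T w -> (size w < n)%N -> exists s, T (rcons w s)].

Section TreeRepresentation.
Variables (R : realType) (Pi : power_circuit R) (D : tree_data Pi).

Definition is_leaf (w : seq trit) : bool :=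
  tree D w && (size w == size (nodes D)).

(* Read from the leaf up to the root, the labels are M(P_1), ..., M(P_n): the
   edges leaving the root decide P_n, the node of largest value. *)
Definition leaf_marking (w : seq trit) : Pi -> trit :=
  fun P => nth Zero (rev w) (index P (nodes D)).

Record is_tree_representation : Prop := IsTreeRepresentation {
  nodes_complete : forall P : Pi, P \in nodes D;
  nodes_increasing :
    sorted (fun P Q => eps_node P < eps_node Q) (nodes D);
  bits_spec :
    bits D = [seq 2 * eps_node PQ.1 == eps_node PQ.2
             | PQ <- zip (nodes D) (behead (nodes D))];
  tree_ternary : is_ternary_tree (size (nodes D)) (tree D);
  leaf_compact : forall w, is_leaf w ->
    compact_marking R (@delta _ Pi) (leaf_marking w);
  Lambda_leaf : forall P : Pi, exists2 w, is_leaf w &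
    leaf_marking w =1 Lambda (@delta _ Pi) P;
  level_uniq : forall i, uniq (level_list D i);
  level_spec : forall i w, (w \in level_list D i) = tree D w && (size w == i)
}.

End TreeRepresentation.

(* Unit-cost machine whose registers and memory cells hold integers.  A program
   mentions finitely many registers; the memory is reached by indirect
   addressing only.  The only arithmetic is addition and subtraction. *)
Inductive instr :=
  | IConst (r : nat) (z : int)
  | IAdd (r r1 r2 : nat)
  | ISub (r r1 r2 : nat)
  | ILoad (r a : nat)
  | IStore (a r : nat)
  | IJpos (r : nat) (l : nat).

Definition program := seq instr.

Record config := Config { cpc : nat; creg : nat -> int; cmem : nat -> int }.

Definition upd (f : nat -> int) (i : nat) (z : int) : nat -> int :=
  fun j => if j == i then z else f j.

(* No step is possible from a halted configuration; access to a negative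
   address is a crash: there is no step although the machine has not halted. *)
Definition halted (p : program) (c : config) : bool := (size p <= cpc c)%N.

Definition ram_step (p : program) (c : config) : option config :=
  let: Config k rg m := c in
  match onth p k with
  | Some (IConst r z) => Some (Config k.+1 (upd rg r z) m)
  | Some (IAdd r r1 r2) => Some (Config k.+1 (upd rg r (rg r1 + rg r2)) m)
  | Some (ISub r r1 r2) => Some (Config k.+1 (upd rg r (rg r1 - rg r2)) m)
  | Some (ILoad r a) =>
      if rg a is Posz i then Some (Config k.+1 (upd rg r (m i)) m) else None
  | Some (IStore a r) =>
      if rg a is Posz i then Some (Config k.+1 rg (upd m i (rg r))) else None
  | Some (IJpos r l) => Some (Config (if 0 < rg r then l else k.+1) rg m)
  | None => None
  end.

Definition halts_in (p : program) (c : config) (t : nat) (c' : config) : Prop :=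
  iter t (obind (ram_step p)) (Some c) = Some c' /\ halted p c'.

(* Graph representation as input, the nodes being numbered as in [s]: register
   0 holds |Gamma|, and the memory holds the matrix of delta, row by row, from
   address 0 on.  Everything else is 0. *)
Definition graph_input (R : realType) (Pi : power_circuit R) (s : seq Pi) :
    config :=
  Config 0
    (fun r => if r == 0%N then (size s)%:Z else 0)
    (nth 0 [seq int_of_trit (delta P Q) | P <- s, Q <- s]).

(* [p] points to the first record of a linked list of tree nodes listing [l];
   -1 is the null pointer, and the cell at offset 3 of a record is its link. *)
Fixpoint linked_list (m : nat -> int) (addr : seq trit -> nat)
    (p : int) (l : seq (seq trit)) : Prop :=
  if l is w :: l' then
    p = (addr w)%:Z /\ linked_list m addr (m (addr w + 3)%N) l'
  else p = -1.

Definition child_offset (s : trit) : nat :=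
  match s with Minus => 0 | Zero => 1 | Plus => 2 end.

(* Tree representation as output.
   register 0: the number n of nodes;
   register 1: array for [P_1, ..., P_n], the entry of P_i being a pointer to
     the leaf that represents the marking Lambda_(P_i);
   register 2: array of the n - 1 bits;
   register 3: pointer to the root of the tree;
   register 4: array of n + 1 pointers to the lists of the levels 0, ..., n.
   A tree node is a record of four cells: the pointers to its children along
   -1, 0 and +1 (null if absent) and the link of the list of its level.
   All these blocks are pairwise disjoint; in particular no two tree nodes
   share a record, so that the structure is a tree and not a dag. *)
Definition tree_output (R : realType) (Pi : power_circuit R)
    (D : tree_data Pi) (c : config) : Prop :=
  let n := size (nodes D) in
  let m := cmem c in
  exists (anodes abits alevels : nat) (addr : seq trit -> nat),
  [/\ [/\ creg c 0 = n%:Z, creg c 1 = anodes%:Z, creg c 2 = abits%:Z,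
          creg c 3 = (addr [::])%:Z & creg c 4 = alevels%:Z],
      forall P : Pi, exists w,
        [/\ is_leaf D w, leaf_marking D w =1 Lambda (@delta _ Pi) P &
            m (anodes + index P (nodes D))%N = (addr w)%:Z],
      forall i, (i < n.-1)%N ->
        m (abits + i)%N = (nat_of_bool (nth false (bits D) i))%:Z,
      (forall w s, tree D w -> m (addr w + child_offset s)%N =
         if tree D (rcons w s) then (addr (rcons w s))%:Z else -1) /\
      (forall i, (i <= n)%N ->
         linked_list m addr (m (alevels + i)%N) (level_list D i)) &
      uniq (iota anodes n ++ iota abits n.-1 ++ iota alevels n.+1 ++
            flatten [seq iota (addr w) 4
                    | w <- flatten [seq level_list D i | i <- iota 0 n.+1]])].

(* Main.v *)
Require Import Defs.
From HB Require Import structures.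
From mathcomp Require Import all_boot all_order all_algebra.
From mathcomp Require Import reals exp.
From mathcomp Require Import zify ring.

(** Every node of a power circuit has value [2 ^+ e] for a natural number [e]:
its exponent is the value of a marking, hence an integer, and its own value is
an integer too, hence [e >= 0].  So a circuit is a matrix of signs [d] with
exponents [e], where row [p] is a signed binary expansion of [e p] over the
exponents of the other nodes.  The new circuit consists of a list [E] of
distinct exponents and, for each of them, of a row: the non-adjacent form of
the exponent over [E].  Rows are compact markings, no exponent has two of them,
and those of larger exponents are lexicographically larger when read from the
top digit ([naf_lt]); so comparing exponents, which may be astronomically
large, amounts to comparing rows.  The tree is the trie of the rows.

The list grows while the nodes [p] are processed in topological order.  At that
time row [p] of [d] refers to nodes whose exponents are already in [E]; adding
their signs yields a vector of small coefficients over [E] with value [e p],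
and one pass from low to high ([normalize]) turns it into the row of [e p].
A search that walks down the digits while it shrinks an interval of candidate
rows ([search_ok]) finds where [e p] belongs in at most [2 * size E] rounds,
and the row is inserted if it is new.  To insert a number near [e p], the
difference is put in as a carry at exponent 0.  Every step is linear in [n],
hence the quadratic total.

Non-adjacent forms over [E] need places for carries.  Therefore [E] is
[0, ..., n + 1] at the start, and a set [S] of exponents in [E] is maintained,
called parked, whose successors are in [E], at first [1, ..., n].  When [p] is
processed, [e p] is put into [E], the first exponent [e p + j] not in [S] is
parked and its successor is put into [E].  Each node adds at most two exponents, and the first one, which has
exponent 0, adds none; so [size E] is at most [n + 2 + 2 * (n - 1) = 3 * n].
Like cars that drive on until they find a free place, the nodes leave in [S]
enough room: a bound on carries ([roomy], [parking_park]) shows that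
normalization never carries out of [E], and a marking of the old circuit is
rewritten over [S] by letting each of its signs ripple to the place of its car,
which never increases the number of nonzero digits ([represents_park]).

The machine program is obtained from a small structured language whose loops
run a number of times that is fixed on entry.  Its compiler is proved correct
once and for all ([compile_ok]), together with a static bound on the running
time, a polynomial whose degree is the nesting depth of the loops
([cost_poly]).  The loops of the program run at most [6 * n] times and have
nesting depth 2; this is why the time bound needs no analysis of the algorithm.
Its arrays, indexed by all integers, are interleaved in the memory behind the
input and output area; records of the tree are the cells with the same index
of the first four arrays. *)

Set Implicit Arguments.
Unset Strict Implicit.
Unset Printing Implicit Defensive.

Import Order.TTheory GRing.Theory Num.Theory.
Local Open Scope ring_scope.

(** * A structured language and its compilation *)

Inductive expr :=
  | Lit of int | Var of nat | Sum of expr & expr | Diff of expr & expr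
  | Read of nat & expr.

Inductive cmd :=
  | Skip | Let of nat & expr | Sto of nat & expr & expr
  | Seq of cmd & cmd | If of expr & cmd & cmd | Rep of nat & cmd.

Record store := Store { rg : nat -> int; ar : nat -> int -> int }.

Definition updz (f : int -> int) (i v : int) : int -> int :=
  fun j => if j == i then v else f j.

Definition upd_array (f : nat -> int -> int) (j : nat) (i v : int) :=
  fun j' => if j' == j then updz (f j') i v else f j'.

Fixpoint ev (e : expr) (s : store) : int :=
  match e with
  | Lit z => z
  | Var r => rg s r
  | Sum e1 e2 => ev e1 s + ev e2 s
  | Diff e1 e2 => ev e1 s - ev e2 s
  | Read j e1 => ar s j (ev e1 s)
  end.

(** Loops run as often as the counter says on entry, so that the running time
does not depend on what happens inside. *)
Definition rounds (z : int) : nat := if z is Posz k then k else 0%N.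

Fixpoint den (c : cmd) (s : store) : store :=
  match c with
  | Skip => s
  | Let r e => Store (upd (rg s) r (ev e s)) (ar s)
  | Sto j e v => Store (rg s) (upd_array (ar s) j (ev e s) (ev v s))
  | Seq c1 c2 => den c2 (den c1 s)
  | If e c1 c2 => if 0 < ev e s then den c1 s else den c2 s
  | Rep r c1 => iter (rounds (rg s r)) (den c1) s
  end.

(* Register [base_reg] holds the address where the interleaved arrays begin;
   registers from [scratch] on hold intermediate values of expressions and the
   counters of running loops. *)
Notation base_reg := 6%N (only parsing).
Notation scratch := 60%N (only parsing).

(** Thirty-two arrays indexed by all integers are interleaved in the memory
beyond the address [B].  Array 15 covers the addresses below [B]: through it the
program reads the input and writes the output.  The factor 64 leaves 32 cells
for the nonpositive index and 32 for the positive one. *)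
Definition cell (B j : nat) (z : int) : nat :=
  if (j == 15%N) && (0 <= z < B%:Z) then `|z|%N
  else (B + 64 * `|z| + 32 * (0 < z)%R + j)%N.

Lemma cell_inj B j j' z z' : (j < 32)%N -> (j' < 32)%N ->
  cell B j z = cell B j' z' -> j = j' /\ z = z'.
Proof.
rewrite /cell => ? ?.
case: ifP => /andP; case: ifP => /andP; lia.
Qed.

(** Multiplication by 64 is six doublings. *)
Definition interleave (k d j : nat) : program :=
  [:: IConst d.+1 (j + 32)%N%:Z; IJpos d (k + 5);
      IConst d.+1 0; ISub d d.+1 d; IConst d.+1 j%:Z;
      IAdd d d d; IAdd d d d; IAdd d d d; IAdd d d d; IAdd d d d; IAdd d d d;
      IAdd d d d.+1; IAdd d d base_reg].

Definition locate_cell (k d j : nat) : program :=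
  if j == 15%N then
    [:: ISub d.+1 base_reg d; IJpos d.+1 (k + 4);
        IConst d.+1 1; IJpos d.+1 (k + 7);
        IConst d.+1 1; IAdd d.+1 d.+1 d; IJpos d.+1 (k + 20)]
    ++ interleave (k + 7) d j
  else interleave k d j.

(** [k] is the address of the first instruction, needed as jumps are absolute;
[d] is the register of the result, and registers from [d] on may be
overwritten. *)
Fixpoint compile_expr (k d : nat) (e : expr) : program :=
  match e with
  | Lit z => [:: IConst d z]
  | Var r => [:: IConst d 0; IAdd d d r]
  | Sum e1 e2 =>
      let a1 := compile_expr k d e1 in
      let a2 := compile_expr (k + size a1) d.+1 e2 in
      a1 ++ a2 ++ [:: IAdd d d d.+1]
  | Diff e1 e2 =>
      let a1 := compile_expr k d e1 in
      let a2 := compile_expr (k + size a1) d.+1 e2 in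
      a1 ++ a2 ++ [:: ISub d d d.+1]
  | Read j e1 =>
      let a1 := compile_expr k d e1 in
      a1 ++ locate_cell (k + size a1) d j ++ [:: ILoad d d]
  end.

Fixpoint compile (k d : nat) (c : cmd) : program :=
  match c with
  | Skip => [::]
  | Let r e =>
      compile_expr k d e ++ [:: IConst d.+1 0; IAdd r d d.+1]
  | Sto j e v =>
      let a1 := compile_expr k d v in
      let a2 := compile_expr (k + size a1) d.+1 e in
      a1 ++ a2 ++ locate_cell (k + size a1 + size a2) d.+1 j ++
      [:: IStore d.+1 d]
  | Seq c1 c2 =>
      let a1 := compile k d c1 in a1 ++ compile (k + size a1) d c2
  | If e c1 c2 =>
      let a := compile_expr k d e in
      let k2 := (k + size a + 1)%N in
      let a2 := compile k2 d c2 in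
      let k1 := (k2 + size a2 + 2)%N in
      let a1 := compile k1 d c1 in
      a ++ IJpos d k1 :: a2 ++ IConst d 1 :: IJpos d (k1 + size a1) :: a1
  | Rep r c1 =>
      let a := compile (k + 7) d.+1 c1 in
      IConst d 0 :: IAdd d d r ::
      IJpos d (k + 5) :: IConst d.+1 1 :: IJpos d.+1 (k + 7 + size a + 2) ::
      IConst d.+1 1 :: ISub d d d.+1 ::
      a ++ [:: IConst d.+1 1; IJpos d.+1 (k + 2)]
  end.

Definition code_at (p : program) (k : nat) (l : program) : Prop :=
  exists pre suf, p = pre ++ l ++ suf /\ size pre = k.

Lemma code_at_cat p k l1 l2 : code_at p k (l1 ++ l2) ->
  code_at p k l1 /\ code_at p (k + size l1) l2.
Proof.
move=> [pre [suf [-> <-]]]; split.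
  by exists pre, (l2 ++ suf); rewrite !catA.
by exists (pre ++ l1), suf; rewrite size_cat !catA.
Qed.

Lemma code_at_cons p k i l : code_at p k (i :: l) ->
  onth p k = Some i /\ code_at p k.+1 l.
Proof.
move=> [pre [suf [-> <-]]]; split.
  by rewrite onth_cat ltnn subnn.
by exists (rcons pre i), suf; rewrite size_rcons cat_rcons.
Qed.

(** The number of steps is an upper bound, which spares the comparison of the
branches of tests. *)
Definition reach (p : program) (c : config) (t : nat) (c' : config) : Prop :=
  exists2 t', (t' <= t)%N & iter t' (obind (ram_step p)) (Some c) = Some c'.

Lemma reach_here p k k' g m t : k = k' -> reach p (Config k g m) t (Config k' g m).
Proof. by move=> ->; exists 0%N. Qed.

Lemma reach_trans p c1 t1 c2 t2 c3 :
  reach p c1 t1 c2 -> reach p c2 t2 c3 -> reach p c1 (t1 + t2) c3.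
Proof.
move=> [t1' le1 h1] [t2' le2 h2]; exists (t2' + t1')%N; first by lia.
by rewrite iterD h1.
Qed.

Lemma reach_le p c1 t t' c2 : (t <= t')%N -> reach p c1 t c2 -> reach p c1 t' c2.
Proof. by move=> le [u leu h]; exists u => //; lia. Qed.

Lemma reach_step p c1 c2 t c3 :
  ram_step p c1 = Some c2 -> reach p c2 t c3 -> reach p c1 t.+1 c3.
Proof.
move=> h1 [t' le h]; exists t'.+1; first by [].
by rewrite iterSr /= h1.
Qed.

Ltac next_instr :=
  match goal with
  | H : code_at ?p _ (_ :: _) |- _ =>
      let h := fresh "fetch" in
      move: (code_at_cons H) => [h {}H]
  end.
Ltac fetch_all := repeat next_instr.

Ltac exec1 :=
  apply: reach_step;
  [ match goal with
    | h : onth ?p ?k = Some _ |- ram_step ?p (Config ?k' _ _) = _ =>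
        let E := fresh in
        (have E : k' = k by rewrite ?(addnS, addn0));
        rewrite /ram_step (eq_trans (congr1 (onth p) E) h); reflexivity
    end | ].

Lemma interleave_ok p k d j B g m :
  code_at p k (interleave k d j) -> (scratch <= d)%N -> g base_reg = B%:Z ->
  exists g', [/\ reach p (Config k g m) 13 (Config (k + 13) g' m),
     forall r, (r < d)%N -> g' r = g r &
     g' d = (B + 64 * `|g d| + 32 * (0 < g d)%R + j)%N%:Z].
Proof.
move=> hc hd hB; rewrite /interleave in hc; fetch_all.
have hb : (base_reg == d) = false by apply/eqP; lia.
have hb1 : (base_reg == d.+1) = false by apply/eqP; lia.
have hd1 : (d.+1 == d) = false by apply/eqP; lia.
have hd2 : (d == d.+1) = false by apply/eqP; lia.
case: (ltrP 0 (g d)) => [pos|neg].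
  eexists; split.
  - apply: (@reach_le _ _ 10); first by [].
    exec1; exec1; rewrite {1}/upd hd2 pos.
    exec1; exec1; exec1; exec1; exec1; exec1; exec1; exec1.
    by apply: reach_here; lia.
  - move=> r hr; rewrite /upd.
    have -> : (r == d) = false by apply/eqP; lia.
    by have -> : (r == d.+1) = false by apply/eqP; lia.
  rewrite /upd !eqxx !(hb, hb1, hd1, hd2) hB; lia.
eexists; split.
- exec1; exec1; rewrite {1}/upd hd2 ltNge neg /=.
  exec1; exec1; exec1; exec1; exec1; exec1; exec1; exec1; exec1; exec1; exec1.
  by apply: reach_here; lia.
- move=> r hr; rewrite /upd.
  have -> : (r == d) = false by apply/eqP; lia.
  by have -> : (r == d.+1) = false by apply/eqP; lia.
rewrite /upd !eqxx !(hb, hb1, hd1, hd2) hB; lia.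
Qed.

Lemma locate_cell_ok p k d j B z g m :
  code_at p k (locate_cell k d j) -> (scratch <= d)%N ->
  g base_reg = B%:Z -> g d = z ->
  exists g', [/\ reach p (Config k g m) 19
                  (Config (k + size (locate_cell k d j)) g' m),
     forall r, (r < d)%N -> g' r = g r &
     g' d = (cell B j z)%:Z].
Proof.
move=> hc hd hB hz; rewrite /locate_cell /cell in hc *.
case: (j =P 15%N) hc => [j15|_] hc; last first.
  case: (interleave_ok m hc hd hB) => g' [h1 h2 h3]; exists g'; split=> //.
    exact: reach_le h1.
  by rewrite h3 hz.
case: (code_at_cat hc) => {}hc hg; rewrite [size _]/= in hg.
have hdd : (d == d.+1) = false by apply/eqP; lia.
have hrd r : (r < d)%N -> (r == d.+1) = false by move=> ?; apply/eqP; lia.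
case/boolP: (0 <= z < B%:Z) => hz2.
  eexists; split.
  - apply: (@reach_le _ _ 7); first by [].
    fetch_all; exec1; exec1.
    rewrite (_ : (0 < _) = true); last by rewrite /upd eqxx hB hz; lia.
    exec1; exec1; exec1.
    rewrite (_ : (0 < _) = true); last by rewrite /upd !eqxx hdd hz; lia.
    by apply: reach_here; rewrite size_cat.
  - by move=> r hr; rewrite /upd !hrd.
  - by rewrite /upd hdd /= hz; lia.
have [g0 [hg0 hg0r hg0d]] : exists g0,
   [/\ reach p (Config k g m) 6 (Config (k + 7) g0 m),
     forall r, (r < d)%N -> g0 r = g r & g0 d = z].
  case: (ltrP z B%:Z) => hzB.
    eexists; split.
    - fetch_all; exec1; exec1.
      rewrite (_ : (0 < _) = true); last by rewrite /upd eqxx hB hz; lia.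
      exec1; exec1; exec1.
      rewrite (_ : (0 < _) = false); last by rewrite /upd !eqxx hdd hz; lia.
      by apply: reach_here; lia.
    - by move=> r hr; rewrite /upd !hrd.
    - by rewrite /upd hdd.
  eexists; split.
  - fetch_all; exec1; exec1.
    rewrite (_ : (0 < _) = false); last by rewrite /upd eqxx hB hz; lia.
    exec1; exec1; rewrite {1}/upd eqxx /=.
    exact: reach_here.
  - by move=> r hr; rewrite /upd !hrd.
  - by rewrite /upd hdd.
have hB0 : g0 base_reg = B%:Z by rewrite hg0r //; lia.
case: (interleave_ok m hg hd hB0) => g' [h1 h2 h3]; exists g'; split=> //.
- apply: reach_trans hg0 _; rewrite size_cat /= addnA; exact: h1.
- by move=> r hr; rewrite h2 ?hg0r.
- by rewrite h3 hg0d.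
Qed.

Fixpoint expr_cost (e : expr) : nat :=
  match e with
  | Lit _ => 1
  | Var _ => 2
  | Sum e1 e2 | Diff e1 e2 => expr_cost e1 + expr_cost e2 + 1
  | Read _ e1 => expr_cost e1 + 20
  end.

(** As long as the base register is not set, [arrays] is false, and arrays are
inaccessible. *)
Fixpoint expr_ok (arrays : bool) (e : expr) : bool :=
  match e with
  | Lit _ => true
  | Var r => (r < scratch)%N
  | Sum e1 e2 | Diff e1 e2 => expr_ok arrays e1 && expr_ok arrays e2
  | Read j e1 => [&& arrays, (j < 32)%N & expr_ok arrays e1]
  end.

Definition holds_arrays (B : nat) (s : store) (m : nat -> int) : Prop :=
  forall j z, (j < 32)%N -> m (cell B j z) = ar s j z.

Lemma compile_expr_ok p B s m arrays e : expr_ok arrays e ->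
  (arrays -> rg s base_reg = B%:Z) -> holds_arrays B s m ->
  forall k d g, (scratch <= d)%N ->
  code_at p k (compile_expr k d e) ->
  (forall r, (r < scratch)%N -> g r = rg s r) ->
  exists g', [/\ reach p (Config k g m) (expr_cost e)
                  (Config (k + size (compile_expr k d e)) g' m),
     forall r, (r < d)%N -> g' r = g r &
     g' d = ev e s].
Proof.
move=> + hB hm; elim: e => [z|r|e1 IH1 e2 IH2|e1 IH1 e2 IH2|j e1 IH1] /=.
- move=> _ k d g hd hc hg; eexists; split.
  + by fetch_all; exec1; apply: reach_here; lia.
  + by move=> r hr; rewrite /upd; case: eqP => //; lia.
  + by rewrite /upd eqxx.
- move=> hr k d g hd hc hg; eexists; split.
  + by fetch_all; exec1; exec1; apply: reach_here; lia.
  + move=> r' hr'; rewrite /upd.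
    by have -> : (r' == d) = false by apply/eqP; lia.
  + rewrite /upd eqxx; have -> : (r == d) = false by apply/eqP; lia.
    by rewrite add0r hg.
- move=> /andP[/IH1{}IH1 /IH2{}IH2] k d g hd hc hg.
  case: (code_at_cat hc) => hc1 /code_at_cat[hc2 hc3].
  have [g1 [r1 f1 v1]] := IH1 _ _ _ hd hc1 hg.
  have hg1 r : (r < scratch)%N -> g1 r = rg s r.
    by move=> hr; rewrite f1 ?hg //; lia.
  have [g2 [r2 f2 v2]] := IH2 _ _ _ (leqW hd) hc2 hg1.
  eexists; split.
  + apply: reach_trans; first by apply: reach_trans r1 r2.
    fetch_all; exec1; by apply: reach_here; rewrite !size_cat /=; lia.
  + move=> r hr; rewrite /upd.
    have -> : (r == d) = false by apply/eqP; lia.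
    by rewrite f2 ?f1 //; lia.
  + by rewrite /upd eqxx v2 f2 // v1.
- move=> /andP[/IH1{}IH1 /IH2{}IH2] k d g hd hc hg.
  case: (code_at_cat hc) => hc1 /code_at_cat[hc2 hc3].
  have [g1 [r1 f1 v1]] := IH1 _ _ _ hd hc1 hg.
  have hg1 r : (r < scratch)%N -> g1 r = rg s r.
    by move=> hr; rewrite f1 ?hg //; lia.
  have [g2 [r2 f2 v2]] := IH2 _ _ _ (leqW hd) hc2 hg1.
  eexists; split.
  + apply: reach_trans; first by apply: reach_trans r1 r2.
    fetch_all; exec1; by apply: reach_here; rewrite !size_cat /=; lia.
  + move=> r hr; rewrite /upd.
    have -> : (r == d) = false by apply/eqP; lia.
    by rewrite f2 ?f1 //; lia.
  + by rewrite /upd eqxx v2 f2 // v1.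
move=> /and3P[/hB{}hB hj /IH1{}IH1] k d g hd hc hg.
case: (code_at_cat hc) => hc1 /code_at_cat[hc2 hc3].
have [g1 [r1 f1 v1]] := IH1 _ _ _ hd hc1 hg.
have hB1 : g1 base_reg = B%:Z by rewrite f1 ?hg //; lia.
have [g2 [r2 f2 v2]] := locate_cell_ok m hc2 hd hB1 v1.
eexists; split.
- rewrite (_ : expr_cost e1 + 20 = expr_cost e1 + 19 + 1)%N; last by lia.
  apply: reach_trans; first by apply: reach_trans r1 r2.
  case: (code_at_cons hc3) => fetch _.
  apply: reach_step; first by rewrite /ram_step fetch v2; reflexivity.
  by apply: reach_here; rewrite !size_cat /=; lia.
- move=> r hr; rewrite /upd.
  have -> : (r == d) = false by apply/eqP; lia.
  by rewrite f2 ?f1 //; lia.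
- by rewrite /upd eqxx hm.
Qed.

(** * Correctness and cost of compiled programs *)

Fixpoint cost (D : nat) (c : cmd) : nat :=
  match c with
  | Skip => 0
  | Let _ e => expr_cost e + 2
  | Sto _ e v => expr_cost v + expr_cost e + 20
  | Seq c1 c2 => cost D c1 + cost D c2
  | If e c1 c2 => expr_cost e + cost D c1 + cost D c2 + 3
  | Rep _ c1 => D * (cost D c1 + 5) + 5
  end.

(** Commands whose cost is known in advance, as they loop over registers [ro]
that they do not assign to.  The base register is such a register, but is no
counter: its value is quadratic. *)
Fixpoint cmd_ok (ro : seq nat) (c : cmd) : bool :=
  let a := base_reg \in ro in
  match c with
  | Skip => true
  | Let r e => [&& r \notin ro, (r < scratch)%N & expr_ok a e]
  | Sto j e v => [&& a, (j < 32)%N, expr_ok a e & expr_ok a v]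
  | Seq c1 c2 => cmd_ok ro c1 && cmd_ok ro c2
  | If e c1 c2 => [&& expr_ok a e, cmd_ok ro c1 & cmd_ok ro c2]
  | Rep r c1 => [&& r \in ro, r != base_reg, (r < scratch)%N & cmd_ok ro c1]
  end.

Definition ro_inv (ro : seq nat) (B D : nat) (s : store) : Prop :=
  (base_reg \in ro -> rg s base_reg = B%:Z) /\
  forall r, r \in ro -> r != base_reg -> (rounds (rg s r) <= D)%N.

(** This is what makes loop bounds known in advance. *)
Lemma den_ro ro c s r : cmd_ok ro c -> r \in ro -> rg (den c s) r = rg s r.
Proof.
move=> + hr; elim: c s => [|r' e|j e v|c1 IH1 c2 IH2|e c1 IH1 c2 IH2|r' c1 IH1] s //=.
- case/and3P=> hr' _ _; rewrite /upd; case: eqP => // rr'.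
  by rewrite -rr' hr in hr'.
- by case/andP=> ok1 ok2; rewrite IH2 ?IH1.
- by case/and3P=> _ ok1 ok2; case: ifP => _; rewrite ?IH1 ?IH2.
case/and4P=> _ _ _ ok1; elim: (rounds _) => //= k IHk.
by rewrite IH1.
Qed.

Lemma ro_inv_den ro B D c s : cmd_ok ro c -> ro_inv ro B D s ->
  ro_inv ro B D (den c s).
Proof.
move=> ok [hB hD]; split=> [hb|r hr hb].
  by rewrite (den_ro _ ok) ?hB.
by rewrite (den_ro _ ok) ?hD.
Qed.

(** Simulation, with the store in the low registers and in the interleaved
arrays.  Loop counters are held in scratch registers below [d], which the
compiled body leaves alone; each loop makes at most [D] rounds as its counter
is read-only. *)
Lemma compile_ok p B D ro c : cmd_ok ro c ->
  forall s k d g m, ro_inv ro B D s -> holds_arrays B s m ->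
  (scratch <= d)%N -> code_at p k (compile k d c) ->
  (forall r, (r < scratch)%N -> g r = rg s r) ->
  exists g' m', [/\ reach p (Config k g m) (cost D c)
                    (Config (k + size (compile k d c)) g' m'),
     holds_arrays B (den c s) m',
     forall r, (r < scratch)%N -> g' r = rg (den c s) r &
     forall r, (scratch <= r < d)%N -> g' r = g r].
Proof.
elim: c => [|r e|j e v|c1 IH1 c2 IH2|e c1 IH1 c2 IH2|r c1 IH1] /=.
- move=> _ s k d g m inv hm hd hc hg; exists g, m; split=> //.
  by rewrite addn0; apply: reach_here; rewrite ?addnS ?addn0.
- case/and3P=> hr hr2 ok s k d g m [inv _] hm hd hc hg.
  case: (code_at_cat hc) => hc1 hc2.
  have [g1 [r1 f1 v1]] := compile_expr_ok ok inv hm hd hc1 hg.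
  pose g2 := upd g1 d.+1 0.
  exists (upd g2 r (g2 d + g2 d.+1)), m; split=> //.
  + apply: reach_trans r1 _; fetch_all; exec1; exec1.
    by apply: reach_here; rewrite size_cat /=; lia.
  + move=> r' hr'; rewrite /upd /=; case: eqP => _.
      rewrite /g2 /upd; have -> : (d == d.+1) = false by apply/eqP; lia.
      by rewrite eqxx addr0 v1.
    rewrite /g2 /upd.
    have -> : (r' == d.+1) = false by apply/eqP; lia.
    by rewrite f1 ?hg //; lia.
  + move=> r' hr'; rewrite /g2 /upd.
    have -> : (r' == r) = false by apply/eqP; lia.
    have -> : (r' == d.+1) = false by apply/eqP; lia.
    by rewrite f1 //; lia.
- case/and4P=> arrs hj oke okv s k d g m [inv _] hm hd hc hg.
  case: (code_at_cat hc) => hc1 /code_at_cat[hc2 /code_at_cat[hc3 hc4]].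
  have [g1 [r1 f1 v1]] := compile_expr_ok okv inv hm hd hc1 hg.
  have hg1 r : (r < scratch)%N -> g1 r = rg s r.
    by move=> hr; rewrite f1 ?hg //; lia.
  have [g2 [r2 f2 v2]] := compile_expr_ok oke inv hm (leqW hd) hc2 hg1.
  have hB2 : g2 base_reg = B%:Z by rewrite f2 ?hg1 ?inv //; lia.
  have [g3 [r3 f3 v3]] := locate_cell_ok m hc3 (leqW hd) hB2 v2.
  exists g3, (upd m (cell B j (ev e s)) (ev v s)); split.
  + rewrite (_ : expr_cost v + _ + 20 = expr_cost v + (expr_cost e + (19 + 1)))%N; last by lia.
    apply: reach_trans r1 _; apply: reach_trans r2 _; apply: reach_trans r3 _.
    case: (code_at_cons hc4) => fetch _.
    apply: reach_step.
      rewrite /ram_step fetch v3 (f3 _ (ltnSn d)) (f2 _ (ltnSn d)) v1; reflexivity.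
    by apply: reach_here; rewrite !size_cat /=; lia.
  + move=> j' z hj'; rewrite /upd /=; case: eqP => [/cell_inj[]//-> ->|ne].
      by rewrite /upd_array eqxx /updz eqxx.
    rewrite hm // /upd_array /updz; case: eqP => // ejj; case: eqP => // ez.
    by case: ne; rewrite ejj ez.
  + by move=> r hr; rewrite /= f3 ?f2 ?f1 ?hg //; lia.
  + by move=> r hr; rewrite /= f3 ?f2 ?f1 //; lia.
- case/andP=> ok1 ok2 s k d g m inv hm hd hc hg.
  case: (code_at_cat hc) => hc1 hc2.
  have [g1 [m1 [r1 hm1 hg1 f1]]] := IH1 ok1 _ _ _ _ _ inv hm hd hc1 hg.
  have inv1 := ro_inv_den ok1 inv.
  have [g2 [m2 [r2 hm2 hg2 f2]]] := IH2 ok2 _ _ _ _ _ inv1 hm1 hd hc2 hg1.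
  exists g2, m2; split=> //; last by move=> r hr; rewrite f2 ?f1.
  by apply: reach_trans r1 _; rewrite size_cat addnA.
- case/and3P=> oke ok1 ok2 s k d g m inv hm hd hc hg.
  case: (code_at_cat hc) => hc0 {}hc.
  have [g0 [r0 f0 v0]] := compile_expr_ok oke (proj1 inv) hm hd hc0 hg.
  have hg0 r : (r < scratch)%N -> g0 r = rg s r.
    by move=> hr; rewrite f0 ?hg //; lia.
  case: (code_at_cons hc) => fetch0 {}hc.
  case: (code_at_cat hc) => hc2 {}hc.
  case: (code_at_cons hc) => fetch1 {}hc.
  case: (code_at_cons hc) => fetch2 hc1.
  set a := compile_expr k d e in hc0 r0 hc2 hc1 fetch0 fetch1 fetch2 *.
  set a2 := compile (k + size a + 1) d c2 in hc2 hc1 fetch1 fetch2 *.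
  set k1 := (k + size a + 1 + size a2 + 2)%N in hc1 fetch0 fetch2 *.
  set a1 := compile k1 d c1 in hc1 fetch2 *.
  rewrite -addn1 in hc2.
  rewrite (_ : _.+2 = k1) in hc1; last by rewrite /k1; lia.
  case: ifP => hev.
    have [g1 [m1 [r1 hm1 hg1 f1]]] := IH1 ok1 _ _ _ _ _ inv hm hd hc1 hg0.
    exists g1, m1; split=> //; last by move=> r hr; rewrite f1 ?f0 //; lia.
    apply: (@reach_le _ _ (expr_cost e + (cost D c1).+1)); first by lia.
    apply: reach_trans r0 _.
    apply: reach_step; first by rewrite /ram_step fetch0 v0 hev; reflexivity.
    rewrite (_ : k + size _ = k1 + size a1)%N //.
    by rewrite !size_cat /= size_cat /= -/a1 /k1; lia.
  have [g1 [m1 [r1 hm1 hg1 f1]]] := IH2 ok2 _ _ _ _ _ inv hm hd hc2 hg0.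
  exists (upd g1 d 1), m1; split=> //.
  + apply: (@reach_le _ _ (expr_cost e + (cost D c2 + 2).+1)); first by lia.
    apply: reach_trans r0 _.
    apply: reach_step; first by rewrite /ram_step fetch0 v0 hev; reflexivity.
    rewrite -addn1; apply: reach_trans r1 _; rewrite -/a2.
    rewrite -[(k + size a).+1]addn1 in fetch1 fetch2.
    apply: reach_step; first by rewrite /ram_step fetch1; reflexivity.
    apply: reach_step.
      by rewrite /ram_step fetch2 /upd eqxx; reflexivity.
    apply: reach_here; rewrite !size_cat /= size_cat /= /k1; lia.
  + move=> r hr; rewrite -hg1 // /upd.
    by have -> : (r == d) = false by apply/eqP; lia.
  + move=> r hr; rewrite /upd.
    have -> : (r == d) = false by apply/eqP; lia.
    by rewrite f1 ?f0 //; lia.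
case/and4P=> hr hrb hrs ok1 s k d g m inv hm hd hc hg.
set a := compile (k + 7) d.+1 c1 in hc *.
case: (code_at_cons hc) => fetch0 {}hc.
case: (code_at_cons hc) => fetch1 {}hc.
case: (code_at_cons hc) => fetch2 {}hc.
case: (code_at_cons hc) => fetch3 {}hc.
case: (code_at_cons hc) => fetch4 {}hc.
case: (code_at_cons hc) => fetch5 {}hc.
case: (code_at_cons hc) => fetch6 {}hc.
rewrite (_ : k.+3.+4 = (k + 7)%N) in hc; last by lia.
case: (code_at_cat hc) => hca {}hc.
case: (code_at_cons hc) => fetch7 {}hc.
case: (code_at_cons hc) => fetch8 _.
have hrD : (rounds (rg s r) <= D)%N by case: inv => _; apply.
(* From the test of the loop on, with [i] rounds left. *)
have loop : forall i s' g0 m0, (i <= D)%N -> ro_inv ro B D s' ->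
    holds_arrays B s' m0 -> (forall r', (r' < scratch)%N -> g0 r' = rg s' r') ->
    rounds (g0 d) = i ->
  exists g' m', [/\ reach p (Config (k + 2) g0 m0) (i * (cost D c1 + 5) + 3)
                    (Config (k + 7 + size a + 2) g' m'),
     holds_arrays B (iter i (den c1) s') m',
     forall r', (r' < scratch)%N -> g' r' = rg (iter i (den c1) s') r' &
     forall r', (scratch <= r' < d)%N -> g' r' = g0 r'].
  elim=> [|i IHi] s' g0 m0 hi inv' hm0 hg0 hgd.
    exists (upd g0 d.+1 1), m0; split=> //.
    - have le0 : 0 < g0 d = false by move: hgd; case: (g0 d) => [[]|].
      exec1; rewrite le0; exec1; exec1; rewrite {1}/upd eqxx /=.
      by apply: reach_here; rewrite ?addnS ?addn0.
    - move=> r' hr'; rewrite /= -hg0 // /upd.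
      by have -> : (r' == d.+1) = false by apply/eqP; lia.
    - move=> r' hr'; rewrite /upd.
      by have -> : (r' == d.+1) = false by apply/eqP; lia.
  have gd : g0 d = i.+1%:Z by move: hgd; case: (g0 d) => // j /= ->.
  pose g1 := upd (upd g0 d.+1 1) d i%:Z.
  have hg1 r' : (r' < scratch)%N -> g1 r' = rg s' r'.
    move=> hr'; rewrite -hg0 // /g1 /upd.
    have -> : (r' == d) = false by apply/eqP; lia.
    by have -> : (r' == d.+1) = false by apply/eqP; lia.
  have [g2 [m2 [r2 hm2 hg2 f2]]] := IH1 ok1 _ _ _ _ _ inv' hm0 (leqW hd) hca hg1.
  pose g3 := upd g2 d.+1 1.
  have hg3 r' : (r' < scratch)%N -> g3 r' = rg (den c1 s') r'.
    move=> hr'; rewrite -hg2 // /g3 /upd.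
    by have -> : (r' == d.+1) = false by apply/eqP; lia.
  have hg3d : rounds (g3 d) = i.
    rewrite /g3 /upd; have -> : (d == d.+1) = false by apply/eqP; lia.
    by rewrite f2 /g1 /upd ?eqxx //; lia.
  have [g4 [m4 [r4 hm4 hg4 f4]]] :=
    IHi _ _ _ (ltnW hi) (ro_inv_den ok1 inv') hm2 hg3 hg3d.
  exists g4, m4; rewrite iterSr; split=> //.
  - rewrite (_ : i.+1 * _ + 3 = 3 + (cost D c1 + (2 + (i * (cost D c1 + 5) + 3))))%N;
      last by lia.
    apply: (@reach_trans _ _ _ (Config (k + 7) g1 m0)).
      exec1; rewrite gd /=; exec1; exec1.
      have -> : upd (upd g0 d.+1 1) d
         (upd g0 d.+1 1 d - upd g0 d.+1 1 d.+1) = g1.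
        rewrite /g1; congr upd; rewrite /upd eqxx.
        have -> : (d == d.+1) = false by apply/eqP; lia.
        by rewrite gd; lia.
      by apply: reach_here; lia.
    apply: reach_trans r2 _; apply: reach_trans r4.
    rewrite -/a; exec1; exec1; rewrite {1}/upd eqxx /=; by apply: reach_here; rewrite ?addnS ?addn0.
  - move=> r' hr'; rewrite f4 // /g3 /upd.
    have -> : (r' == d.+1) = false by apply/eqP; lia.
    rewrite f2; last by lia.
    rewrite /g1 /upd; have -> : (r' == d) = false by apply/eqP; lia.
    by have -> : (r' == d.+1) = false by apply/eqP; lia.
pose g0 := upd (upd g d 0) d (g r).
have hg0 r' : (r' < scratch)%N -> g0 r' = rg s r'.
  move=> hr'; rewrite -hg // /g0 /upd.
  by have -> : (r' == d) = false by apply/eqP; lia.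
have hg0d : rounds (g0 d) = rounds (rg s r) by rewrite /g0 /upd eqxx hg.
have [g1 [m1 [r1 hm1 hg1 f1]]] := loop _ _ _ _ hrD inv hm hg0 hg0d.
exists g1, m1; split=> //; last first.
  move=> r' hr'; rewrite f1 // /g0 /upd.
  by have -> : (r' == d) = false by apply/eqP; lia.
apply: (@reach_le _ _ (2 + (rounds (rg s r) * (cost D c1 + 5) + 3))).
  rewrite [X in (_ <= X)%N](_ : _ = 2 + (D * (cost D c1 + 5) + 3))%N; last by lia.
  by rewrite leq_add2l leq_add2r leq_mul2r hrD orbT.
rewrite (_ : k + _ = k + 7 + size a + 2)%N; last first.
  by rewrite /= size_cat /=; lia.
apply: reach_trans r1.
exec1; exec1.
have -> : upd (upd g d 0) d (upd g d 0 d + upd g d 0 r) = g0.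
  rewrite /g0; congr upd; rewrite /upd eqxx add0r.
  by have -> : (r == d) = false by apply/eqP; lia.
rewrite addn2; by apply: reach_here; rewrite ?addnS ?addn0.
Qed.

Fixpoint depth (c : cmd) : nat :=
  match c with
  | Skip | Let _ _ | Sto _ _ _ => 0
  | Seq c1 c2 | If _ c1 c2 => maxn (depth c1) (depth c2)
  | Rep _ c1 => (depth c1).+1
  end.

(** A loop multiplies the cost of its body by [D] up to constants, so each
nesting level raises the degree by one. *)
Lemma cost_poly c : exists K, forall D, (0 < D)%N -> (cost D c <= K * D ^ depth c)%N.
Proof.
have mono D K d d' : (0 < D)%N -> (d <= d')%N -> (K * D ^ d <= K * D ^ d')%N.
  by move=> D0 dd; rewrite leq_mul2l leq_pexp2l ?orbT.
elim: c => [|r e|j e v|c1 [K1 IH1] c2 [K2 IH2]|e c1 [K1 IH1] c2 [K2 IH2]|r c1 [K1 IH1]] /=.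
- by exists 0%N.
- by exists (expr_cost e + 2)%N => D _; rewrite muln1.
- by exists (expr_cost v + expr_cost e + 20)%N => D _; rewrite muln1.
- exists (K1 + K2)%N => D D0; rewrite mulnDl leq_add //.
    exact: leq_trans (IH1 _ D0) (mono _ _ _ _ D0 (leq_maxl _ _)).
  exact: leq_trans (IH2 _ D0) (mono _ _ _ _ D0 (leq_maxr _ _)).
- exists (expr_cost e + K1 + K2 + 3)%N => D D0.
  have h1 := leq_trans (IH1 _ D0) (mono _ _ _ _ D0 (leq_maxl _ (depth c2))).
  have h2 := leq_trans (IH2 _ D0) (mono _ _ _ _ D0 (leq_maxr (depth c1) _)).
  have : (0 < D ^ maxn (depth c1) (depth c2))%N by rewrite expn_gt0 D0.
  nia.
exists (K1 + 10)%N => D D0; have := IH1 _ D0; rewrite expnS.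
have : (0 < D ^ depth c1)%N by rewrite expn_gt0 D0.
nia.
Qed.

Fixpoint assigned (c : cmd) : seq nat :=
  match c with
  | Skip | Sto _ _ _ => [::]
  | Let r _ => [:: r]
  | Seq c1 c2 | If _ c1 c2 => assigned c1 ++ assigned c2
  | Rep _ c1 => assigned c1
  end.

Fixpoint stored (c : cmd) : seq nat :=
  match c with
  | Skip | Let _ _ => [::]
  | Sto j _ _ => [:: j]
  | Seq c1 c2 | If _ c1 c2 => stored c1 ++ stored c2
  | Rep _ c1 => stored c1
  end.

(** With the next lemma, the frame rule. *)
Lemma den_rg c s r : r \notin assigned c -> rg (den c s) r = rg s r.
Proof.
elim: c s => [|r' e|j e v|c1 IH1 c2 IH2|e c1 IH1 c2 IH2|r' c1 IH1] s //=.
- by rewrite inE /upd => /negbTE ->.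
- by rewrite mem_cat negb_or => /andP[h1 h2]; rewrite IH2 ?IH1.
- by rewrite mem_cat negb_or => /andP[h1 h2]; case: ifP; rewrite ?IH1 ?IH2.
by move=> h; elim: (rounds _) => //= k <-; rewrite IH1.
Qed.

Lemma den_ar c s j : j \notin stored c -> ar (den c s) j = ar s j.
Proof.
elim: c s => [|r' e|j' e v|c1 IH1 c2 IH2|e c1 IH1 c2 IH2|r' c1 IH1] s //=.
- by rewrite inE /upd_array => /negbTE ->.
- by rewrite mem_cat negb_or => /andP[h1 h2]; rewrite IH2 ?IH1.
- by rewrite mem_cat negb_or => /andP[h1 h2]; case: ifP; rewrite ?IH1 ?IH2.
by move=> h; elim: (rounds _) => //= k <-; rewrite IH1.
Qed.

(** The rule of loop invariants, with the frame built in. *)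
Lemma den_rep (P : nat -> store -> Prop) r c s k :
  rounds (rg s r) = k -> P 0%N s ->
  (forall i s', (i < k)%N -> (forall r', r' \notin assigned c -> rg s' r' = rg s r') ->
    (forall j, j \notin stored c -> ar s' j = ar s j) ->
    P i s' -> P i.+1 (den c s')) ->
  P k (den (Rep r c) s).
Proof.
move=> hk P0 PS; rewrite /= hk.
suff [_ []] : (forall r', r' \notin assigned c -> rg (iter k (den c) s) r' = rg s r') /\
   (forall j, j \notin stored c -> ar (iter k (den c) s) j = ar s j) /\ P k (iter k (den c) s) by [].
elim: k PS {hk} => [|k IH] PS //=.
have [|h1 [h2 h3]] := IH; first by move=> i s' ik; apply: PS; exact: ltnW.
split; first by move=> r' hr'; rewrite den_rg ?h1.
by split; [move=> j hj; rewrite den_ar ?h2|apply: PS].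
Qed.

Lemma den_seq c1 c2 s : den (Seq c1 c2) s = den c2 (den c1 s).
Proof. by []. Qed.
Lemma den_let r e s : den (Let r e) s = Store (upd (rg s) r (ev e s)) (ar s).
Proof. by []. Qed.
Lemma den_sto j e v s :
  den (Sto j e v) s = Store (rg s) (upd_array (ar s) j (ev e s) (ev v s)).
Proof. by []. Qed.
Lemma den_if e c1 c2 s :
  den (If e c1 c2) s = if 0 < ev e s then den c1 s else den c2 s.
Proof. by []. Qed.
Lemma den_skip s : den Skip s = s.
Proof. by []. Qed.
Definition denE := (den_seq, den_let, den_sto, den_if, den_skip).
Arguments den : simpl never.

(** * Non-adjacent forms *)

Definition is_trit (z : int) : Prop := -1 <= z <= 1.

Definition weigh (a : nat -> int) (T : nat) : int := \sum_(t < T) a t * 2 ^+ t.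

Definition naf (a : nat -> int) : Prop :=
  (forall t, is_trit (a t)) /\ forall t, a t != 0 -> a t.+1 = 0.

Lemma weighS a T : weigh a T.+1 = weigh a T + a T * 2 ^+ T.
Proof. by rewrite /weigh big_ord_recr. Qed.

(** The extreme digits alternate with zeros, hence the sum is below
[2 ^+ T * (1 + 1/4 + ...) / 2], and twice as small if the top digit
vanishes. *)
Lemma naf_bound a T : naf a ->
  3 * `|weigh a T| < 2 * 2 ^+ T /\
  ((forall t, t.+1 = T -> a t = 0) -> 3 * `|weigh a T| < 2 ^+ T).
Proof.
move=> [ta na]; elim: T => [|T [IH1 IH2]].
  by rewrite /weigh big_ord0; split.
have zeroT : a T != 0 -> forall t, t.+1 = T -> a t = 0.
  move=> nz t eT; apply/eqP/negPn/negP => /na; rewrite eT => aT.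
  by rewrite aT in nz.
split; last first.
  move=> /(_ T erefl) aT; rewrite weighS aT mul0r addr0 exprS; exact: IH1.
have hT := ta T; rewrite weighS exprS; have [aT|/zeroT/IH2 h] := eqVneq (a T) 0.
  rewrite aT mul0r addr0; have : 0 < (2:int) ^+ T by rewrite exprn_gt0.
  lia.
have {}IH1 := IH1; rewrite /is_trit in hT; nia.
Qed.

(** One unit at place [i] outweighs all lower digits: if a top digit is
nonzero then the digit below it is zero, and [naf_bound] leaves less than a
third of [2 ^+ i] for the rest on that side and two thirds on the other. *)
Lemma naf_lt a b T i : naf a -> naf b -> (i < T)%N -> a i < b i ->
  (forall t, (i < t)%N -> a t = b t) -> weigh a T < weigh b T.
Proof.
move=> na nb iT lt_ab eq_ab.
have: weigh a i.+1 < weigh b i.+1.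
  rewrite !weighS.
  have [a1 a2] := naf_bound i na; have [b1 b2] := naf_bound i nb.
  have zero c : naf c -> c i != 0 -> forall t, t.+1 = i -> c t = 0.
    move=> [_ nc] nz t ei; apply/eqP/negPn/negP => /nc; rewrite ei => ci.
    by rewrite ci in nz.
  have ta : is_trit (a i) by apply: (proj1 na).
  have tb : is_trit (b i) by apply: (proj1 nb).
  rewrite /is_trit in ta tb.
  have pos : 0 < (2:int) ^+ i by rewrite exprn_gt0.
  have [ai|/(zero _ na)/a2 {}a2] := eqVneq (a i) 0.
    have bi : b i = 1 by lia.
    have := b2 (zero _ nb _); rewrite bi => /(_ isT); rewrite ai; lia.
  have [bi|/(zero _ nb)/b2 {}b2] := eqVneq (b i) 0; last by nia.
  have -> : a i = -1 by lia.
  rewrite bi; lia.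
rewrite -(subnKC iT).
elim: (T - i.+1)%N => [|k IHk] h; first by rewrite addn0.
rewrite addnS weighS (weighS b) (eq_ab (i.+1 + k)%N); last by lia.
by rewrite ltrD2r IHk.
Qed.

Lemma mul3_le_pow t : (3 * t <= 2 * 2 ^ t)%N.
Proof.
elim: t => // -[|t] IH //.
have : (0 < 2 ^ t)%N by rewrite expn_gt0.
move: IH; rewrite !expnS; lia.
Qed.

Lemma pow_int t : (2 ^ t)%N%:Z = 2 ^+ t.
Proof. by rewrite -natz natrX. Qed.

(** If [t] is the top place with a nonzero digit, the digits below it amount to
less than a third of [2 ^+ t]; as the value is nonnegative, the top digit is 1
and the value exceeds two thirds of [2 ^+ t], which are at least [t]. *)
Lemma naf_below a T i : naf a -> (i < T)%N -> a i != 0 -> 0 <= weigh a T ->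
  i%:Z < weigh a T.
Proof.
move=> na; elim: T => // T IHT; rewrite ltnS weighS => iT ai.
have [aT|aT] := eqVneq (a T) 0.
  rewrite aT mul0r addr0; apply: IHT => //.
  by move: iT; rewrite leq_eqVlt => /orP[/eqP eiT|//]; rewrite eiT aT in ai.
have [_ h] := naf_bound T na.
have {}h : 3 * `|weigh a T| < 2 ^+ T.
  apply: h => t eT; apply/eqP/negPn/negP => /(proj2 na); rewrite eT => z.
  by rewrite z in aT.
have tT := proj1 na T; rewrite /is_trit in tT.
have := mul3_le_pow T; have := pow_int T => <- h3 pos.
move: h; rewrite -pow_int => h.
have aT1 : a T = 1 by nia.
move: pos; rewrite aT1; lia.
Qed.

(** * Digits attached to a list of exponents *)

Definition value (E : seq nat) (w : nat -> int) : int :=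
  \sum_(k < size E) w k * 2 ^+ nth 0%N E k.

Definition spread (E : seq nat) (w : nat -> int) (t : nat) : int :=
  if t \in E then w (index t E) else 0.

Lemma spread_nth E w k : uniq E -> (k < size E)%N ->
  spread E w (nth 0%N E k) = w k.
Proof. by move=> uE kE; rewrite /spread mem_nth // index_uniq. Qed.

(** Sums over the positions of [E] become sums over all exponents, where the
theory of non-adjacent forms applies. *)
Lemma big_spread (A : nmodType) (F : nat -> A) E w T : uniq E ->
  (forall t, t \in E -> (t < T)%N) ->
  (forall t, t \notin E -> F t = 0) -> (forall k, (k < size E)%N ->
    F (nth 0%N E k) = w k) ->
  \sum_(t < T) F t = \sum_(k < size E) w k.
Proof.
move=> uE hT hF hw.
transitivity (\sum_(t <- E) F t); last first.
  by rewrite (big_nth 0%N) big_mkord; apply: eq_bigr => k _; rewrite hw.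
rewrite -(big_mkord predT F) (bigID (mem E)) /= addrC big1 ?add0r; last first.
  by move=> t; exact: hF.
rewrite -big_filter; apply: perm_big; apply: uniq_perm => //.
  by rewrite filter_uniq // iota_uniq.
move=> t; rewrite mem_filter mem_index_iota /=.
by case: (boolP (t \in E)) => //= /hT ->.
Qed.

Lemma value_spread E w T : uniq E -> (forall t, t \in E -> (t < T)%N) ->
  value E w = weigh (spread E w) T.
Proof.
move=> uE hT; rewrite /weigh.
rewrite (@big_spread _ (fun t => spread E w t * 2 ^+ t) E
  (fun k => w k * 2 ^+ nth 0%N E k)) //.
  by move=> t /negbTE tE; rewrite /spread tE mul0r.
by move=> k kE; rewrite spread_nth.
Qed.

Definition compact (E : seq nat) (w : nat -> int) : Prop :=
  (forall k, (k < size E)%N -> is_trit (w k)) /\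
  forall k k', (k < size E)%N -> (k' < size E)%N -> w k != 0 -> w k' != 0 ->
    nth 0%N E k' != (nth 0%N E k).+1.

Lemma compact_naf E w : uniq E -> compact E w -> naf (spread E w).
Proof.
move=> uE [tw cw]; split=> t.
  by rewrite /spread; case: ifP => // tE; apply: tw; rewrite index_mem.
rewrite /spread; case: ifP => // tE nz; case: ifP => // tE1.
apply/eqP/negPn/negP => nz1.
have := cw (index t E) (index t.+1 E); rewrite !index_mem => /(_ tE tE1 nz nz1).
by rewrite !nth_index // eqxx.
Qed.

Lemma ltn_bound (E : seq nat) : exists T, forall t, t \in E -> (t < T)%N.
Proof.
exists (\max_(t <- E) t).+1 => t tE; rewrite ltnS.
by rewrite (big_rem t) //= leq_maxl.
Qed.

Lemma compact_lt E w w' k : uniq E -> compact E w -> compact E w' ->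
  (k < size E)%N -> w k < w' k ->
  (forall k', (k' < size E)%N -> (nth 0%N E k < nth 0%N E k')%N -> w k' = w' k') ->
  value E w < value E w'.
Proof.
move=> uE cw cw' kE lt_w eq_w; have [T hT] := ltn_bound E.
rewrite !(value_spread _ uE hT).
apply: (@naf_lt _ _ _ (nth 0%N E k)); rewrite ?spread_nth //.
- exact: compact_naf.
- exact: compact_naf.
- exact/hT/mem_nth.
move=> t lt_t; rewrite /spread; case: ifP => // tE.
by rewrite eq_w ?index_mem ?nth_index.
Qed.

(** A node thus depends on nodes of smaller value only: the circuit built from
the rows is acyclic. *)
Lemma compact_below E w k : uniq E -> compact E w -> (k < size E)%N ->
  w k != 0 -> 0 <= value E w -> (nth 0%N E k)%:Z < value E w.
Proof.
move=> uE cw kE nz; have [T hT] := ltn_bound E.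
rewrite (value_spread _ uE hT) => pos; apply: naf_below => //.
- exact: compact_naf.
- exact/hT/mem_nth.
by rewrite spread_nth.
Qed.

(** * Normalization with bounded carries *)

(** [S] is the set of parked exponents, [m t] bounds the coefficient at
exponent [t] and [b t + 1] bounds the carry into [t].  Half of carry plus
coefficient goes on to [t.+1]; at a place outside [S] the coefficient is zero
and the carry is a single digit, which can stay there. *)
Record roomy (S : nat -> bool) (m b : nat -> nat) : Prop := Roomy {
  room_step : forall t, S t -> (b t + m t <= (b t.+1).*2.+1)%N;
  room_free : forall t, ~~ S t -> (b t + m t = 0)%N
}.

Definition halfz (y : int) : int := (y %/ 2)%Z.

(** From the carry plus coefficient [y] at a place and the coefficient [next]
at the following one, the digit and the outgoing carry.  An odd [y] whose
successor place exists gets the digit 1 or -1 that makes the next place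
even, hence zero; if there is no successor place, [y] itself has to be a
digit. *)
Definition naf_step (adjacent : bool) (y next : int) : int * int :=
  let h := halfz y in
  if 0 < y - h - h then
    if adjacent then
      let g := h + next in
      if 0 < g - halfz g - halfz g then (-1, h + 1) else (1, h)
    else (y, 0)
  else (0, h).

Lemma naf_step_carry a y next (k : nat) : `|y| <= k.*2.+1%:Z + 1 ->
  `|(naf_step a y next).2| <= k%:Z + 1.
Proof.
rewrite /naf_step /halfz; case: ifP => ?; last by move=> /=; lia.
by case: a => //=; case: ifP => ? /=; lia.
Qed.

Lemma naf_step_small y next : `|y| <= 1 -> naf_step false y next = (y, 0).
Proof. by rewrite /naf_step /halfz; case: ifP => ? ?; congr pair; lia. Qed.

Section Normalize.
Variables (N : nat) (f : nat -> nat) (x : nat -> int) (J : int).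

Definition adjacent (i : nat) : bool := (i.+1 < N)%N && (f i.+1 == (f i).+1).

Fixpoint carry (i : nat) : int :=
  if i is j.+1 then (naf_step (adjacent j) (x j + carry j) (x j.+1)).2 else J.

Definition digit (i : nat) : int :=
  (naf_step (adjacent i) (x i + carry i) (x i.+1)).1.

Lemma carry_small (K : int) i : (forall i, (i < N)%N -> `|x i| <= K) ->
  `|J| <= K + 1 -> (i <= N)%N -> `|carry i| <= K + 1.
Proof.
move=> hx hJ; elim: i => // i IH lt_i; have {}IH := IH (ltnW lt_i).
have {}hx := hx _ lt_i; rewrite /= /naf_step /halfz.
by case: ifP => /= ?; [case: ifP => ? /=; [case: ifP => ? /=|]|]; lia.
Qed.

Lemma digit_naf i : adjacent i -> digit i != 0 -> digit i.+1 = 0.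
Proof.
move=> adj; rewrite /digit /= adj /naf_step.
case: (ltrP 0) => // h1; case: ifP => /= h2 _; case: ifP => //; rewrite /halfz in h1 h2 *; lia.
Qed.

Variables (S : nat -> bool) (m b : nat -> nat).
Hypothesis room : roomy S m b.
Hypothesis f0 : (0 < N)%N -> f 0%N = 0%N.
Hypothesis S_adjacent : forall i, (i < N)%N -> S (f i) -> adjacent i.
Hypothesis x_le : forall i, (i < N)%N -> `|x i| <= (m (f i))%:Z.
Hypothesis J_le : `|J| <= (b 0%N)%:Z + 1.

(** A place without successor in the list is not parked, and then the carry
stops.  This is why it does no harm that the list has gaps. *)
Lemma carry_le i : (i < N)%N -> `|carry i| <= (b (f i))%:Z + 1.
Proof.
elim: i => [|i IH] lt_i; first by rewrite f0.
have {}IH := IH (ltnW lt_i); have hx := x_le (ltnW lt_i).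
rewrite /=; case: (boolP (adjacent i)) => [/andP[_ /eqP fi]|nadj].
  rewrite fi; apply: naf_step_carry.
  case: (boolP (S (f i))) => [/(room_step room)|/(room_free room)]; lia.
have nS : ~~ S (f i) by apply: contra nadj => /S_adjacent; apply; lia.
have free := room_free room nS.
by rewrite naf_step_small /=; lia.
Qed.

Lemma step_small i : (i < N)%N -> ~~ adjacent i -> `|x i + carry i| <= 1.
Proof.
rewrite /is_trit => lt_i nadj; have := carry_le lt_i; have := x_le lt_i.
have nS : ~~ S (f i) by apply: contra nadj => /S_adjacent; apply; lia.
have := room_free room nS; lia.
Qed.

Lemma digit_trit i : (i < N)%N -> is_trit (digit i).
Proof.
move=> lt_i; have := step_small lt_i; rewrite /digit /naf_step /is_trit.
by case: (adjacent i) => /= h; case: ifP => //= ?; [case: ifP|have := h isT; lia].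
Qed.

(** Partial sums of digits together with the pending carry reproduce the
partial sums of the input. *)
Lemma digit_value : (0 < N)%N ->
  \sum_(i < N) digit i * 2 ^+ f i = J + \sum_(i < N) x i * 2 ^+ f i.
Proof.
move=> N0; suff h i : (i <= N)%N ->
    \sum_(j < i) digit j * 2 ^+ f j + (if (i < N)%N then carry i * 2 ^+ f i else 0)
    = J + \sum_(j < i) x j * 2 ^+ f j.
  by have := h N (leqnn N); rewrite ltnn addr0.
elim: i => [|i IH] lt_i.
  by rewrite N0 !big_ord0 f0 //= expr0 mulr1 addr0 add0r.
have := IH (ltnW lt_i); rewrite !big_ord_recr /= lt_i addrA => <-.
rewrite -!addrA; congr (_ + _).
case: (boolP (adjacent i)) => [adj|nadj].
  have /andP[ltN /eqP fi] := adj; rewrite ltN fi exprS /digit /= adj.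
  set y := x i + carry i; set st := naf_step _ _ _.
  have split_y : st.1 + 2 * st.2 = y.
    by rewrite /st /naf_step /halfz; case: ifP => /= ?; [case: ifP => /= ?|]; lia.
  have -> : carry i = y - x i by rewrite /y; ring.
  rewrite -split_y; ring.
have st := naf_step_small (x i.+1) (step_small lt_i nadj).
by rewrite /digit /= (negbTE nadj) st /= mul0r; case: ifP => _; ring.
Qed.

End Normalize.

(** * Parking places: which markings can be rewritten *)

(** The processed nodes are thought of as cars: the car of [q] looks for a
place at [e q], then at [(e q).+1], and so on. *)
Definition cars (e : nat -> nat) (D : seq nat) (t : nat) : nat :=
  count (fun q => e q == t) D.

Definition park (S : nat -> bool) (t : nat) : nat -> bool :=
  fun t' => (t' == t) || S t'.

(** Room for shifts: at exponent 0, numbers up to [b 0 + 1] may be added to a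
marking before it is normalized.  The last two fields keep this room
exponentially large once 0 is parked, while the program only needs [n]. *)
Record parking (n : nat) (e : nat -> nat) (D : seq nat) (S : nat -> bool)
    (b : nat -> nat) : Prop := Parking {
  parking_room : roomy S (cars e D) b;
  parking_one : (2 ^ n <= (b 1).+1)%N;
  parking_zero : S 0%N -> (2 ^ n.+1 <= (b 0).+2)%N
}.

(** Parking [1, ..., n] in advance, without any coefficient there, leaves
room for carry bounds that double with every place downwards. *)
Lemma parking_start n e :
  parking n e [::] (fun t => 0 < t <= n)%N
    (fun t => if t == 0 then 0 else (2 ^ (n.+1 - t)).-1)%N.
Proof.
split=> //=; last by rewrite subSS subn0; lia.
split=> t; rewrite /cars /= addn0.
  case: t => //= t; move=> tn.
  rewrite !subSS -[(n - t)%N]prednK ?subn_gt0 // -subnS expnS.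
  have : (0 < 2 ^ (n - t.+1))%N by rewrite expn_gt0.
  lia.
case: t => //= t tn; rewrite subSS.
by have -> : (n - t = 0)%N by lia.
Qed.

Lemma roomy_start n : roomy (fun t => t <= n)%N (fun=> 0)%N
    (fun t => (2 ^ (n.+1 - t)).-1)%N.
Proof.
split=> t; rewrite addn0 => tn.
  rewrite subSS subSn // expnS.
  have : (0 < 2 ^ (n - t))%N by rewrite expn_gt0.
  lia.
by have -> : (n.+1 - t = 0)%N by lia.
Qed.

(** A car that comes to [e q] and parks at [e q + j] raises the coefficient
bound at [e q] by one, and it suffices to raise the carry bounds by one at the
places after it, up to [e q + j].  The carry bound at 0 cannot grow that way:
it is set when 0 is parked, from the room that is available at 1. *)
Lemma parking_park n e D S b q j : parking n e D S b ->
  (forall i, (i < j)%N -> S (e q + i)%N) -> ~~ S (e q + j)%N ->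
  exists b', parking n e (q :: D) (park S (e q + j)) b'.
Proof.
move=> [[rs rf] one zero] hS hj.
case: (posnP (e q + j)%N) => [/eqP|pos].
  rewrite addn_eq0 => /andP[/eqP e0 /eqP j0].
  rewrite e0 j0 addn0 in hj *.
  have pow_pos : (0 < 2 ^ n)%N by rewrite expn_gt0.
  exists (fun t => if t == 0%N then (2 ^ n.+1).-2 else b t); split => //.
    split=> t; rewrite /park /cars /= e0; case: t => [|t] /=.
    - move=> _; have := rf _ hj; rewrite /cars expnS; lia.
    - by rewrite add0n; exact: rs.
    - by [].
    - by rewrite add0n; exact: rf.
  by move=> _; rewrite eqxx; lia.
exists (fun t => b t + (e q < t <= e q + j))%N; split.
- split=> t; rewrite /park /cars /=.
    case: eqP => [->|ne] /=; first by move=> _; have := rf _ hj; rewrite /cars; lia.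
    by move/rs; rewrite /cars; lia.
  rewrite negb_or => /andP[ne nS].
  have := rf _ nS; rewrite /cars.
  case: (boolP (e q <= t <= e q + j)%N) => [/andP[h1 h2]|]; last by lia.
  have := hS (t - e q)%N; rewrite subnKC // (negbTE nS).
  suff lt : (t - e q < j)%N by move=> /(_ lt).
  lia.
- lia.
by rewrite /park; case: eqP => [|_ /= /zero]; lia.
Qed.

(** [weigh] needs an upper bound for the places, while [d] is an infinite
sequence; hence the quantifier over all large [T]. *)
Definition represents (S : nat -> bool) (v : int) (k : nat) (d : nat -> int) :=
  [/\ forall t, is_trit (d t), forall t, d t != 0 -> S t &
   exists T0, forall T, (T0 <= T)%N ->
     weigh d T = v /\ (\sum_(t < T) `|d t|%N <= k)%N].

Definition set_digit (d : nat -> int) (e : nat) (z : int) : nat -> int :=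
  fun t => if t == e then z else d t.

Lemma big_set_digit (A : nmodType) (F : int -> nat -> A) d e z T : (e < T)%N ->
  \sum_(t < T) F (set_digit d e z t) t + F (d e) e
  = \sum_(t < T) F (d t) t + F z e.
Proof.
move=> eT.
have split_e (c : nat -> int) : \sum_(t < T) F (c t) t
    = F (c e) e + \sum_(t < T | t != Ordinal eT) F (c t) t.
  by rewrite (bigD1 (Ordinal eT)).
rewrite !split_e {1}/set_digit eqxx.
rewrite (eq_bigr (fun t : 'I_T => F (d t) t)).
  by rewrite -addrA addrC; congr (_ + _); rewrite addrC.
by move=> t; rewrite -val_eqE /set_digit /= => /negbTE ->.
Qed.

Lemma represents_set (S S' : nat -> bool) v k d e z k' : represents S v k d ->
  is_trit z -> (forall t, t != e -> S t -> S' t) -> (z != 0 -> S' e) ->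
  (k + `|z| <= k' + `|d e|)%N ->
  represents S' (v + (z - d e) * 2 ^+ e) k' (set_digit d e z).
Proof.
move=> [td sd [T0 hT]] tz hS hz hk; split.
- by move=> t; rewrite /set_digit; case: ifP.
- by move=> t; rewrite /set_digit; case: (t =P e) => [->|/eqP ne /sd]; auto.
exists (maxn T0 e.+1) => T; rewrite geq_max => /andP[/hT[hv hc] eT].
split.
  apply: (addIr (d e * 2 ^+ e)); rewrite /weigh.
  rewrite (@big_set_digit _ (fun x t => x * 2 ^+ t)) // -/(weigh d T) hv; ring.
rewrite -(leq_add2r `|d e|%N).
have h := @big_set_digit _ (fun x _ => `|x|%N : nat) d e z T eT.
rewrite [X in (X <= _)%N](_ : _ = \sum_(t < T) `|d t| + `|z|)%N; last exact: h.
exact: leq_trans (leq_add hc (leqnn _)) hk.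
Qed.

(** Add [z] at [e].  If the digit there does not become 2 or -2, this is all;
otherwise it becomes zero, which frees a nonzero digit, and [z] moves on to
[e.+1].  At the latest it stays at [e + j], the place found by the car. *)
Lemma represents_park S v k d e j z : represents S v k d -> is_trit z ->
  (forall i, (i < j)%N -> S (e + i)%N) -> ~~ S (e + j)%N ->
  exists d', represents (park S (e + j)) (v + z * 2 ^+ e) (k + `|z|) d'.
Proof.
elim: j e v k d => [|j IH] e v k d rd tz hS hj.
  rewrite addn0 in hj *.
  have de : d e = 0.
    by apply/eqP/negPn/negP => /(let: And3 _ h _ := rd in h e); rewrite (negbTE hj).
  exists (set_digit d e z); have := @represents_set _ (park S e) _ _ _ e z (k + `|z|) rd tz.
  rewrite de subr0; apply.
  - by move=> t _; rewrite /park => ->; rewrite orbT.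
  - by rewrite /park eqxx.
  by rewrite addn0.
have Se : S e by have := hS 0%N; rewrite addn0; apply.
have td : is_trit (d e) by case: rd.
have sub t : S t -> park S (e + j.+1) t by rewrite /park => ->; rewrite orbT.
have [small|big] : is_trit (d e + z) \/ (d e = z /\ z != 0).
  rewrite /is_trit in td tz *; lia.
  exists (set_digit d e (d e + z)).
  have := @represents_set _ (park S (e + j.+1)) _ _ _ e (d e + z) (k + `|z|) rd small.
  rewrite [d e + z - d e]addrC addKr; apply; auto.
  lia.
case: big => dz nz.
have := @represents_set _ S _ _ _ e 0 k.-1 rd.
have kpos : (0 < k)%N.
  case: rd => _ _ [T0 /(_ (maxn T0 e.+1))[]]; first by rewrite leq_maxl.
  move=> _; apply: leq_trans.
  have eT : (e < maxn T0 e.+1)%N by rewrite leq_maxr.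
  by rewrite (bigD1 (Ordinal eT)) //= dz; lia.
have h0 : (k + `|0%:Z| <= k.-1 + `|d e|)%N by rewrite dz /is_trit in tz *; lia.
move=> /(_ isT (fun t _ h => h) (fun _ => Se) h0) rd1.
have [||d' rd'] := IH e.+1 _ _ _ rd1 tz.
- by move=> i ij; rewrite addSnnS; apply: hS.
- by rewrite addSnnS.
exists d'; move: rd'; rewrite addSnnS dz sub0r exprS.
have -> : v + - z * 2 ^+ e + z * (2 * 2 ^+ e) = v + z * 2 ^+ e by ring.
case=> h1 h2 [T0 h3]; split=> //; exists T0 => T /h3[-> h]; split=> //.
apply: leq_trans h _; lia.
Qed.

(** * The program *)

Declare Scope prog_scope.
Delimit Scope prog_scope with P.
Notation "a ;; b" := (Seq a b) (at level 60, right associativity) : prog_scope.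
Notation "r ::= e" := (Let r e) (at level 55) : prog_scope.
Notation "j :[ i ] ::= e" := (Sto j i e) (at level 55, i at level 50) : prog_scope.
Notation "j @[ i ]" := (Read j i) (at level 2, i at level 50, format "j @[ i ]") : prog_scope.
Notation "$ r" := (Var r) (at level 1, format "$ r") : prog_scope.
Notation "# z" := (Lit z) (at level 1, z at level 0, format "# z") : prog_scope.
Notation "a :+ b" := (Sum a b) (at level 50, left associativity) : prog_scope.
Notation "a :- b" := (Diff a b) (at level 50, left associativity) : prog_scope.
Notation When e c := (If e c Skip).
Bind Scope prog_scope with cmd expr.
Local Open Scope prog_scope.

(* The registers [r_n] to [r_nn], and [base_reg] among them, are assigned to by
   the first parts of the program only; three of them are the loop counters. *)
Notation r_n := 5%N (only parsing).
Notation r_3n := 7%N (only parsing).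
Notation r_6n := 8%N (only parsing).
Notation r_nn := 9%N (only parsing).
Notation r_size := 10%N (only parsing).
Notation r_J := 11%N (only parsing).
Notation r_i := 12%N (only parsing).
Notation r_carry := 13%N (only parsing).
Notation r_k := 14%N (only parsing).
Notation r_y := 15%N (only parsing).
Notation r_half := 16%N (only parsing).
Notation r_next := 17%N (only parsing).
Notation r_lo := 18%N (only parsing).
Notation r_hi := 19%N (only parsing).
Notation r_w := 20%N (only parsing).
Notation r_below := 21%N (only parsing).
Notation r_above := 22%N (only parsing).
Notation r_p := 23%N (only parsing).
Notation r_a := 24%N (only parsing).
Notation r_u := 25%N (only parsing).
Notation r_id := 26%N (only parsing).
Notation r_head := 27%N (only parsing).
Notation r_tail := 28%N (only parsing).
Notation r_row := 30%N (only parsing).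
Notation r_z := 31%N (only parsing).
Notation r_q := 32%N (only parsing).
Notation r_rank := 33%N (only parsing).
Notation r_x := 34%N (only parsing).
Notation r_ptr := 35%N (only parsing).
Notation r_last := 36%N (only parsing).
Notation r_lastptr := 37%N (only parsing).
Notation r_al := 38%N (only parsing).
(* Arrays 0 to 3 are the fields of the records of the tree. *)
Notation a_link := 3%N (only parsing).
Notation a_half := 7%N (only parsing).
Notation a_order := 8%N (only parsing).
Notation a_x := 9%N (only parsing).
Notation a_digits := 10%N (only parsing).
Notation a_row := 11%N (only parsing).
Notation a_bit := 12%N (only parsing).
Notation a_parked := 13%N (only parsing).
Notation a_cand := 14%N (only parsing).
Notation a_raw := 15%N (only parsing).
Notation a_image := 16%N (only parsing).
Notation a_deg := 17%N (only parsing).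
Notation a_queue := 18%N (only parsing).
Notation a_input := 19%N (only parsing).

Definition incr (r : nat) : cmd := r ::= $r :+ #1.

(** The machine cannot divide: halves, rounded down, are tabulated. *)
Definition halves : cmd :=
  r_k ::= #0 ;;
  Rep r_6n (
    a_half:[$r_k :+ $r_k] ::= $r_k ;;
    a_half:[$r_k :+ $r_k :+ #1] ::= $r_k ;;
    a_half:[#0 :- $r_k :- $r_k] ::= #0 :- $r_k ;;
    a_half:[#1 :- $r_k :- $r_k] ::= #0 :- $r_k ;;
    incr r_k).

Definition normalize_body : cmd :=
  r_k ::= a_order@[$r_i] ;;
  r_y ::= a_x@[$r_k] :+ $r_carry ;;
  r_half ::= a_half@[$r_y] ;;
  If ($r_y :- $r_half :- $r_half)
     (If a_bit@[$r_k]
         (r_next ::= $r_half :+ a_x@[a_order@[$r_i :+ #1]] ;;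
          If ($r_next :- a_half@[$r_next] :- a_half@[$r_next])
             (a_cand:[$r_k] ::= #(-1) ;; r_carry ::= $r_half :+ #1)
             (a_cand:[$r_k] ::= #1 ;; r_carry ::= $r_half))
         (a_cand:[$r_k] ::= $r_y ;; r_carry ::= #0))
     (a_cand:[$r_k] ::= #0 ;; r_carry ::= $r_half) ;;
  incr r_i.

Definition normalize : cmd :=
  r_carry ::= $r_J ;; r_i ::= #0 ;;
  Rep r_3n (When ($r_size :- $r_i) normalize_body).

(** The rows of rank [r_lo] to [r_hi] are those that agree with the candidate
on all digits above rank [r_i].  If the lowest has a smaller digit here, or
the highest a larger one, it is discarded; otherwise all of them agree with the
candidate here, since the digits increase with the rank. *)
Definition search_body : cmd :=
  r_k ::= a_order@[$r_i] ;;
  r_w ::= a_cand@[$r_k] ;;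
  If ($r_w :- a_digits@[a_row@[a_order@[$r_lo]] :+ $r_k])
     (incr r_lo)
     (If (a_digits@[a_row@[a_order@[$r_hi]] :+ $r_k] :- $r_w)
         (r_hi ::= $r_hi :- #1)
         (r_i ::= $r_i :- #1)).

Definition search : cmd :=
  r_i ::= $r_size :- #1 ;; r_lo ::= #0 ;; r_hi ::= $r_size :- #1 ;;
  Rep r_6n (When ($r_i :+ #1) (When ($r_hi :- $r_lo :+ #1) search_body)).

Definition found : expr := $r_hi :- $r_lo :+ #1.

Definition locate : cmd := normalize ;; search.

Definition copy_row : cmd :=
  r_i ::= #0 ;; r_a ::= a_row@[$r_row] ;;
  Rep r_3n (When ($r_size :- $r_i)
    (a_digits:[$r_a :+ $r_i] ::= a_cand@[$r_i] ;; incr r_i)).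

(** Only the list of ranks is shifted; rows are addressed by the time of
insertion, so a new exponent adds a column of zeros without moving any row. *)
Definition make_room : cmd :=
  r_i ::= $r_size ;;
  Rep r_3n (When ($r_i :- $r_lo)
    (a_order:[$r_i] ::= a_order@[$r_i :- #1] ;; r_i ::= $r_i :- #1)).

Definition insert : cmd :=
  make_room ;;
  a_order:[$r_lo] ::= $r_size ;;
  r_row ::= $r_size ;; copy_row ;;
  a_bit:[$r_size] ::= $r_above ;;
  a_parked:[$r_size] ::= #0 ;;
  When ($r_below :+ #1) (a_bit:[$r_below] ::= #1) ;;
  incr r_size.

(** The coefficients shifted by [r_J] are inserted.  The neighbours are located
too, by the same coefficients shifted by one less and one more, to maintain
the bits. *)
Definition ensure : cmd :=
  locate ;;
  If found Skip (
    r_J ::= $r_J :- #1 ;; locate ;;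
    If found (r_below ::= a_order@[$r_lo]) (r_below ::= #(-1)) ;;
    r_J ::= $r_J :+ #2 ;; locate ;;
    If found (r_above ::= #1) (r_above ::= #0) ;;
    r_J ::= $r_J :- #1 ;; locate ;;
    insert).

(** For [r_n = 0] the list stays empty, as the bound [3 * n] on its size
requires. *)
Definition chain : cmd :=
  If $r_n (r_size ::= $r_n :+ #2) (r_size ::= #0) ;;
  r_i ::= #0 ;; r_a ::= #0 ;;
  Rep r_3n (
    a_row:[$r_i] ::= $r_a ;; r_a ::= $r_a :+ $r_3n ;;
    a_order:[$r_i] ::= $r_i ;;
    If ($r_size :- $r_i :- #1)
       (a_bit:[$r_i] ::= #1 ;;
        If $r_i (a_parked:[$r_i] ::= #1) (a_parked:[$r_i] ::= #0))
       (a_bit:[$r_i] ::= #0 ;; a_parked:[$r_i] ::= #0) ;;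
    incr r_i) ;;
  r_J ::= #0 ;;
  Rep r_3n (When ($r_size :- $r_J)
    (normalize ;; r_row ::= $r_J ;; copy_row ;; incr r_J)).

Definition nonzero (e : expr) : cmd :=
  If e (r_z ::= #1) (If (#0 :- e) (r_z ::= #1) (r_z ::= #0)).

Definition push : cmd := a_queue:[$r_tail] ::= $r_i ;; incr r_tail.

(** Out-degrees, and the nodes without arcs as the initial queue. *)
Definition sinks : cmd :=
  r_i ::= #0 ;; r_a ::= #0 ;; r_head ::= #0 ;; r_tail ::= #0 ;;
  Rep r_n (
    a_input:[$r_i] ::= $r_a ;; r_q ::= #0 ;;
    Rep r_n (
      nonzero a_raw@[$r_a :+ $r_q] ;;
      a_deg:[$r_i] ::= a_deg@[$r_i] :+ $r_z ;; incr r_q) ;;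
    If a_deg@[$r_i] Skip push ;;
    r_a ::= $r_a :+ $r_n ;;
    incr r_i).

Definition gather : cmd :=
  r_i ::= #0 ;;
  Rep r_3n (a_x:[$r_i] ::= #0 ;; incr r_i) ;;
  r_i ::= #0 ;; r_a ::= a_input@[$r_p] ;;
  Rep r_n (
    a_x:[a_image@[$r_i]] ::= a_x@[a_image@[$r_i]] :+ a_raw@[$r_a :+ $r_i] ;;
    incr r_i).

Definition walk : cmd :=
  r_u ::= $r_lo ;;
  Rep r_3n (When a_parked@[a_order@[$r_u]] (incr r_u ;; incr r_J)).

(** First [e p] itself is inserted, then, from its rank, the first place that
is not parked is found; the places before it are consecutive exponents, so
that [r_J] counts them, and the successor of the place is inserted. *)
Definition place : cmd :=
  r_J ::= #0 ;; ensure ;; locate ;;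
  a_image:[$r_p] ::= a_order@[$r_lo] ;;
  walk ;;
  r_id ::= a_order@[$r_u] ;; incr r_J ;; ensure ;;
  a_parked:[$r_id] ::= #1.

(** The column of [p] is scanned for nodes that have an arc to [p]. *)
Definition release : cmd :=
  r_i ::= #0 ;;
  Rep r_n (
    nonzero a_raw@[a_input@[$r_i] :+ $r_p] ;;
    When $r_z (
      a_deg:[$r_i] ::= a_deg@[$r_i] :- #1 ;;
      If a_deg@[$r_i] Skip push) ;;
    incr r_i) ;;
  incr r_head.

Definition process : cmd :=
  r_p ::= a_queue@[$r_head] ;; gather ;; place ;; release.

(** Arrays 0 to 3 are the cells of the records as prescribed; pointers cannot be
decoded by the machine, so arrays 4 to 6 hold the indices of the children. *)
Definition new_record : cmd :=
  0%N:[$r_last] ::= #(-1) ;; 1%N:[$r_last] ::= #(-1) ;; 2%N:[$r_last] ::= #(-1).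

(** A missing child is allocated and put in front of the list of its level;
with [r_i] letters to go, its level is [r_size - r_i]. *)
Definition descend (j : nat) : cmd :=
  If ((4 + j)%N @[$r_x])
     (r_ptr ::= j@[$r_x] ;; r_x ::= (4 + j)%N @[$r_x])
     (incr r_last ;; r_lastptr ::= $r_lastptr :+ #64 ;;
      (4 + j)%N:[$r_x] ::= $r_last ;;
      j:[$r_x] ::= $r_lastptr ;;
      new_record ;;
      a_link:[$r_last] ::= a_raw@[$r_al :+ $r_size :- $r_i] ;;
      a_raw:[$r_al :+ $r_size :- $r_i] ::= $r_lastptr ;;
      r_x ::= $r_last ;; r_ptr ::= $r_lastptr).

Definition add_word : cmd :=
  r_x ::= #1 ;; r_ptr ::= $3 ;; r_i ::= $r_size :- #1 ;;
  r_a ::= a_row@[a_order@[$r_rank]] ;;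
  Rep r_3n (When ($r_i :+ #1) (
    r_w ::= a_digits@[$r_a :+ a_order@[$r_i]] ;;
    If $r_w (descend 2) (If (#0 :- $r_w) (descend 0) (descend 1)) ;;
    r_i ::= $r_i :- #1)).

(** The output area follows the input matrix; the record of index 1 is the
root, and its first cell has offset 64 + 32. *)
Definition root : cmd :=
  1%N ::= $r_nn ;; 2%N ::= $r_nn :+ $r_3n ;; r_al ::= $r_nn :+ $r_6n ;;
  3%N ::= $base_reg :+ #96 ;;
  r_last ::= #1 ;; r_lastptr ::= $3 ;; new_record ;;
  a_link:[#1] ::= #(-1) ;;
  a_raw:[$r_al] ::= $3 ;;
  r_i ::= #0 ;;
  Rep r_3n (incr r_i ;; a_raw:[$r_al :+ $r_i] ::= #(-1)).

Definition write_tree : cmd :=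
  root ;; r_rank ::= #0 ;;
  Rep r_3n (When ($r_size :- $r_rank)
    (add_word ;; a_raw:[$1 :+ $r_rank] ::= $r_ptr ;; incr r_rank)).

Definition write_bits : cmd :=
  r_i ::= #0 ;;
  Rep r_3n (a_raw:[$2 :+ $r_i] ::= a_bit@[a_order@[$r_i]] ;; incr r_i).

Definition prelude : cmd :=
  r_n ::= $0 ;; r_3n ::= $r_n :+ $r_n :+ $r_n ;; r_6n ::= $r_3n :+ $r_3n.
Definition square : cmd := r_nn ::= #0 ;; Rep r_n (r_nn ::= $r_nn :+ $r_n).
Definition base : cmd := base_reg ::= $r_nn :+ $r_6n :+ $r_3n :+ #1.
Definition main : cmd :=
  halves ;; chain ;; sinks ;; Rep r_n process ;;
  write_tree ;; write_bits ;; 0%N ::= $r_size ;; 4%N ::= $r_al.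

Lemma prelude_ok : cmd_ok [::] prelude. Proof. by []. Qed.
Lemma square_ok : cmd_ok [:: r_n; r_3n; r_6n] square. Proof. by []. Qed.
Lemma base_ok : cmd_ok [:: r_n; r_3n; r_6n] base. Proof. by []. Qed.
Lemma main_cmd_ok : cmd_ok [:: base_reg; r_n; r_3n; r_6n] main. Proof. by []. Qed.

Local Close Scope prog_scope.

(** * Sorted lists of exponents *)

(** [E] lists the exponents in the order of insertion and [L] their positions
in increasing order. *)
Record sorting (E L : seq nat) : Prop := Sorting {
  sorting_uniq : uniq E;
  sorting_perm : perm_eq L (iota 0 (size E));
  sorting_sorted : sorted ltn [seq nth 0%N E k | k <- L]
}.

Definition nth_exp (E L : seq nat) (i : nat) : nat := nth 0%N E (nth 0%N L i).

Section Sorting.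
Variables (E L : seq nat).
Hypothesis srt : sorting E L.

Lemma sorting_size : size L = size E.
Proof. by rewrite (perm_size (sorting_perm srt)) size_iota. Qed.

Lemma sorting_mem k : (k \in L) = (k < size E)%N.
Proof. by rewrite (perm_mem (sorting_perm srt)) mem_iota. Qed.

Lemma sorting_nth i : (i < size E)%N -> (nth 0%N L i < size E)%N.
Proof. by move=> iE; rewrite -sorting_mem mem_nth // sorting_size. Qed.

Lemma sorting_index k : (k < size E)%N ->
  exists2 i, (i < size E)%N & nth 0%N L i = k.
Proof.
rewrite -sorting_mem => kL; exists (index k L); last exact: nth_index.
by rewrite -sorting_size index_mem.
Qed.

Lemma nth_exp_map i : (i < size E)%N ->
  nth 0%N [seq nth 0%N E k | k <- L] i = nth_exp E L i.
Proof. by move=> iE; rewrite (nth_map 0%N) // sorting_size. Qed.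

Lemma nth_exp_lt i j : (i < size E)%N -> (j < size E)%N ->
  (nth_exp E L i < nth_exp E L j)%N = (i < j)%N.
Proof.
have lt i' j' : (j' < size E)%N -> (i' < j')%N ->
    (nth_exp E L i' < nth_exp E L j')%N.
  move=> jE ij; rewrite -!nth_exp_map //; last by lia.
  apply: (sorted_ltn_nth ltn_trans) => //; first exact: sorting_sorted srt.
    by rewrite inE size_map sorting_size; lia.
  by rewrite inE size_map sorting_size.
move=> iE jE; case: (ltngtP i j) => [ij|ji|->]; last by rewrite ltnn.
  exact: lt.
by apply/negbTE; rewrite -leqNgt ltnW // lt.
Qed.

Lemma nth_exp_inj i j : (i < size E)%N -> (j < size E)%N ->
  nth_exp E L i = nth_exp E L j -> i = j.
Proof.
move=> iE jE eq_ij; have := nth_exp_lt iE jE; have := nth_exp_lt jE iE.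
by rewrite eq_ij ltnn; case: (ltngtP i j).
Qed.

Lemma nth_exp_mem i : (i < size E)%N -> nth_exp E L i \in E.
Proof. by move=> iE; rewrite mem_nth // sorting_nth. Qed.

Lemma mem_nth_exp t : t \in E -> exists2 i, (i < size E)%N & nth_exp E L i = t.
Proof.
move=> tE; have := tE; rewrite -index_mem => /sorting_index[i iE eq_i].
by exists i => //; rewrite /nth_exp eq_i nth_index.
Qed.

Lemma nth_exp0 : 0%N \in E -> nth_exp E L 0 = 0%N.
Proof.
move=> /mem_nth_exp [i iE ei]; case: i => [//|i] in iE ei *.
have := nth_exp_lt (ltn_trans (ltn0Sn i) iE) iE.
by rewrite ei ltn0.
Qed.

(** Nothing lies between an exponent and its successor; so a bit of the tree
representation, which looks at the next rank only, tells whether the successor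
is present at all. *)
Lemma adjacent_mem i : (i < size E)%N ->
  adjacent (size E) (nth_exp E L) i = ((nth_exp E L i).+1 \in E).
Proof.
move=> iE; rewrite /adjacent; apply/andP/idP => [[i1E /eqP <-]|].
  exact: nth_exp_mem.
move=> /mem_nth_exp[j jE ej].
have ij : (i < j)%N by rewrite -nth_exp_lt // ej.
have i1E : (i.+1 < size E)%N by lia.
split=> //; apply/eqP.
have l1 : (nth_exp E L i < nth_exp E L i.+1)%N by rewrite nth_exp_lt.
have l2 : ~~ (nth_exp E L j < nth_exp E L i.+1)%N by rewrite nth_exp_lt // -leqNgt.
lia.
Qed.

Lemma big_sorting (A : nmodType) (F : nat -> A) :
  \sum_(i < size E) F (nth 0%N L i) = \sum_(k < size E) F k.
Proof.
rewrite -[RHS](big_mkord predT F) /index_iota subn0.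
rewrite -(perm_big _ (sorting_perm srt)) (big_nth 0%N) big_mkord sorting_size.
exact: eq_bigr.
Qed.

Lemma value_sorting w :
  value E w = \sum_(i < size E) w (nth 0%N L i) * 2 ^+ nth_exp E L i.
Proof. by rewrite (big_sorting (fun k => w k * 2 ^+ nth 0%N E k)). Qed.

Lemma sorting_lt w w' i : compact E w -> compact E w' ->
  (i < size E)%N -> w (nth 0%N L i) < w' (nth 0%N L i) ->
  (forall i', (i < i')%N -> (i' < size E)%N -> w (nth 0%N L i') = w' (nth 0%N L i')) ->
  value E w < value E w'.
Proof.
move=> cw cw' iE lt_w eq_w; apply: (@compact_lt E w w' (nth 0%N L i)) => //.
- exact: sorting_uniq srt.
- exact: sorting_nth.
move=> k /sorting_index[j jE <-]; rewrite -!/(nth_exp E L _) nth_exp_lt // => ij.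
exact: eq_w.
Qed.

Lemma compact_sorting w :
  (forall i, (i < size E)%N -> is_trit (w (nth 0%N L i))) ->
  (forall i, adjacent (size E) (nth_exp E L) i -> w (nth 0%N L i) != 0 ->
     w (nth 0%N L i.+1) = 0) -> compact E w.
Proof.
move=> tw nw; split=> [k /sorting_index[i iE <-]|k k']; first exact: tw.
move=> /sorting_index[i iE <-] /sorting_index[j jE <-] nzi nzj.
apply/eqP; rewrite -!/(nth_exp E L _) => ej.
have ij : (i < j)%N by rewrite -nth_exp_lt // ej.
have adj : adjacent (size E) (nth_exp E L) i.
  by rewrite adjacent_mem // -ej nth_exp_mem.
have := nw _ adj nzi; case/andP: adj => i1E /eqP e1.
have -> : i.+1 = j by apply: nth_exp_inj => //; rewrite e1 ej.
by move=> z; rewrite z in nzj.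
Qed.

Lemma count_below v pos : (pos <= size E)%N ->
  (forall i, (i < pos)%N -> (nth_exp E L i)%:Z < v) ->
  (forall i, (pos <= i < size E)%N -> v <= (nth_exp E L i)%:Z) ->
  count (fun t : nat => t%:Z < v) E = pos.
Proof.
move=> pE lo hi.
have -> : count (fun t : nat => t%:Z < v) E =
    count (fun t : nat => t%:Z < v) (mkseq (nth_exp E L) (size E)).
  apply/permP; apply: uniq_perm.
  - exact: sorting_uniq srt.
  - rewrite map_inj_in_uniq ?iota_uniq // => i j; rewrite !mem_iota /= !add0n.
    exact: nth_exp_inj.
  move=> t; apply/idP/mapP => [/mem_nth_exp[i iE <-]|[i]].
    by exists i => //; rewrite mem_iota.
  by rewrite mem_iota => iE ->; exact: nth_exp_mem.
rewrite /mkseq -[in iota _ _](subnKC pE) iotaD map_cat count_cat !count_map.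
rewrite (@eq_in_count _ _ predT) ?count_predT ?size_iota; last first.
  by move=> i; rewrite mem_iota /= add0n => /lo.
rewrite (@eq_in_count _ _ pred0) ?count_pred0 ?addn0 //.
by move=> i; rewrite mem_iota add0n subnKC //= => /hi; rewrite leNgt => /negbTE.
Qed.

End Sorting.

(** * The contents of the store *)

Record consts (n : nat) (s : store) : Prop := Consts {
  consts_n : rg s r_n = n%:Z;
  consts_3n : rg s r_3n = (3 * n)%N%:Z;
  consts_6n : rg s r_6n = (6 * n)%N%:Z;
  consts_half : forall y, `|y| <= (8 * n)%N%:Z -> ar s a_half y = halfz y;
  consts_row : forall k, (k < 3 * n)%N -> ar s a_row k%:Z = (k * (3 * n))%N%:Z
}.

Record listing (n : nat) (E L : seq nat) (s : store) : Prop := Listing {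
  listing_size : rg s r_size = (size E)%:Z;
  listing_max : (size E <= 3 * n)%N;
  listing_sorting : sorting E L;
  listing_zero : 0%N \in E;
  listing_order : forall i, (i < size E)%N -> ar s a_order i%:Z = (nth 0%N L i)%:Z;
  listing_bit : forall k, (k < size E)%N ->
    ar s a_bit k%:Z = ((nth 0%N E k).+1 \in E : nat)%:Z
}.

Definition array (j : nat) (s : store) (k : nat) : int := ar s j k%:Z.

(** The digits of a row have a stride of [3 * n], the final size at most. *)
Definition row (n : nat) (s : store) (id k : nat) : int :=
  ar s a_digits (id * (3 * n) + k)%N%:Z.

(** The last field makes the columns of future exponents zero. *)
Record rows (n : nat) (E : seq nat) (s : store) : Prop := Rows {
  rows_compact : forall id, (id < size E)%N -> compact E (row n s id);
  rows_value : forall id, (id < size E)%N -> value E (row n s id) = (nth 0%N E id)%:Z;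
  rows_fresh : forall id k, (id < 3 * n)%N -> (size E <= k < 3 * n)%N -> row n s id k = 0
}.

(** [normalize] finds room for the coefficients [X].  The bound [n] keeps the
sums within the table of halves. *)
Record room_for (n : nat) (E : seq nat) (S : nat -> bool) (m b : nat -> nat)
    (X : nat -> int) : Prop := RoomFor {
  room_roomy : roomy S m b;
  room_sub : forall t, S t -> t \in E;
  room_succ : forall t, S t -> t.+1 \in E;
  room_le : forall k, (k < size E)%N -> `|X k| <= (m (nth 0%N E k))%:Z;
  room_max : forall k, (k < size E)%N -> `|X k| <= n%:Z
}.

Lemma frame_consts n s s' : consts n s -> rg s' =1 rg s \/
   [/\ rg s' r_n = rg s r_n, rg s' r_3n = rg s r_3n & rg s' r_6n = rg s r_6n] ->
  ar s' a_half =1 ar s a_half -> ar s' a_row =1 ar s a_row -> consts n s'.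
Proof.
move=> [h1 h2 h3 h4 h5] e1 e2 e3.
have [e4 e5 e6] : [/\ rg s' r_n = rg s r_n, rg s' r_3n = rg s r_3n & rg s' r_6n = rg s r_6n].
  by case: e1.
by split; rewrite ?e4 ?e5 ?e6 // => k hk; rewrite ?e2 ?e3 ?h4 ?h5.
Qed.

Lemma den_consts n c s : consts n s ->
  all (fun r => r \notin assigned c) [:: r_n; r_3n; r_6n] ->
  all (fun j => j \notin stored c) [:: a_half; a_row] -> consts n (den c s).
Proof.
move=> [h1 h2 h3 h4 h5] /and4P[e1 e2 e3 _] /and3P[e4 e5 _].
by split; rewrite ?den_rg ?den_ar.
Qed.

Lemma den_listing n E L c s : listing n E L s -> r_size \notin assigned c ->
  all (fun j => j \notin stored c) [:: a_order; a_bit] -> listing n E L (den c s).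
Proof.
move=> [h1 h2 h3 h4 h5 h6] e1 /and3P[e4 e5 _].
by split; rewrite ?den_rg ?den_ar.
Qed.

Lemma row_ext n s s' : ar s' a_digits = ar s a_digits -> row n s' = row n s.
Proof. by rewrite /row => ->. Qed.

Lemma den_rows n E c s : rows n E s -> a_digits \notin stored c -> rows n E (den c s).
Proof.
move=> [h1 h2 h3] e; have er := row_ext n (den_ar s e).
by split; rewrite ?er.
Qed.

(** * Correctness of normalization *)

(** A loop with a fixed number of rounds that does nothing from round [N] on
acts as a loop of [N] rounds. *)
Lemma den_upto (P : nat -> store -> Prop) r e c s k N :
  rounds (rg s r) = k -> (N <= k)%N -> P 0%N s ->
  (forall i s', (i < N)%N -> (forall r', r' \notin assigned c -> rg s' r' = rg s r') ->
    (forall j, j \notin stored c -> ar s' j = ar s j) ->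
    P i s' -> 0 < ev e s' /\ P i.+1 (den c s')) ->
  (forall s', (forall r', r' \notin assigned c -> rg s' r' = rg s r') ->
    (forall j, j \notin stored c -> ar s' j = ar s j) ->
    P N s' -> ~~ (0 < ev e s')) ->
  P N (den (Rep r (When e c)) s).
Proof.
move=> hk Nk P0 PS PN.
rewrite -[N in P N](minn_idPr Nk).
apply: (den_rep (P := fun i s => P (minn i N) s) hk); first by rewrite min0n.
move=> i s' ik; rewrite [assigned _]/= [stored _]/= !denE !cats0 => fr fa.
cbv beta; case: (ltnP i N) => iN.
  move=> /(PS _ _ iN fr fa)[-> ].
  by rewrite (minn_idPl iN).
move=> /[dup] h /(PN _ fr fa)/negbTE ->.
by rewrite (minn_idPr (leqW iN)).
Qed.

Section Normalize.
Variables (n : nat) (E L : seq nat) (S : nat -> bool) (m b : nat -> nat) (s : store).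
Hypothesis cst : consts n s.
Hypothesis lst : listing n E L s.
Hypothesis room : room_for n E S m b (array a_x s).
Variable J : int.
Hypothesis sJ : rg s r_J = J.
Hypothesis J_le : `|J| <= (b 0%N)%:Z + 1.
Hypothesis J_max : `|J| <= (3 * n)%N%:Z + 1.

Let N := size E.
Let f := nth_exp E L.
Let x i := array a_x s (nth 0%N L i).
Let srt := listing_sorting lst.

Lemma size_gt0 : (0 < N)%N.
Proof. by have := listing_zero lst; rewrite /N; case: (E). Qed.

Lemma f0 : (0 < N)%N -> f 0%N = 0%N.
Proof. by move=> _; apply: nth_exp0 => //; exact: listing_zero lst. Qed.

Lemma S_adjacent i : (i < N)%N -> S (f i) -> adjacent N f i.
Proof. by move=> iN /(room_succ room); rewrite adjacent_mem. Qed.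

Lemma x_le i : (i < N)%N -> `|x i| <= (m (f i))%:Z.
Proof. by move=> iN; apply: room_le room _ _; exact: sorting_nth. Qed.

Lemma normalize_loop :
  let s' := den normalize s in
  forall i, (i < N)%N -> array a_cand s' (nth 0%N L i) = digit N f x J i.
Proof.
pose P i (s' : store) := [/\ rg s' r_i = i%:Z, rg s' r_carry = carry N f x J i &
  forall j, (j < i)%N -> array a_cand s' (nth 0%N L j) = digit N f x J j].
suff : P N (den normalize s) by case.
rewrite /normalize !denE.
set s1 := Store _ _.
have n0 : (0 < n)%N by have := listing_max lst; have := size_gt0; rewrite /N; lia.
apply: (den_upto (P := P) (k := (3 * n)%N)).
- by rewrite /s1 /= /upd /= (consts_3n cst).
- exact: listing_max lst.
- by split=> //; rewrite /s1 /= /upd /= sJ.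
- move=> i s2 iN fr fa [h1 h2 h3].
  have sz : rg s2 r_size = N%:Z by rewrite fr // /s1 /= /upd /= (listing_size lst).
  have hord j : (j < N)%N -> ar s2 a_order j%:Z = (nth 0%N L j)%:Z.
    by move=> jN; rewrite fa // (listing_order lst).
  have hx j : ar s2 a_x j = ar s a_x j by rewrite fa.
  have hb k : ar s2 a_bit k = ar s a_bit k by rewrite fa.
  have hh k : ar s2 a_half k = ar s a_half k by rewrite fa.
  split; first by rewrite /= sz h1; lia.
  have xn j : (j < N)%N -> `|x j| <= (3 * n)%N%:Z.
    move=> jN; apply: (@le_trans _ _ n%:Z); last by lia.
    exact/(room_max room)/sorting_nth.
  have cn : `|carry N f x J i| <= (3 * n)%N%:Z + 1.
    apply: (@carry_small N f x J _ i xn); [exact: J_max|exact: ltnW].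
  have bi : ar s a_bit (nth 0%N L i) = (adjacent N f i : nat)%:Z.
    by rewrite (listing_bit lst) ?sorting_nth // adjacent_mem.
  have hy : ar s a_half (x i + carry N f x J i) = halfz (x i + carry N f x J i).
    by apply: (consts_half cst); have := xn _ iN; lia.
  pose st := naf_step (adjacent N f i) (x i + carry N f x J i) (x i.+1).
  have cand v j : (j < i.+1)%N -> (v = st.1) ->
      upd_array (ar s2) a_cand (nth 0%N L i)%:Z v a_cand (nth 0%N L j)%:Z
      = digit N f x J j.
    rewrite ltnS leq_eqVlt /upd_array /updz /= => /orP[/eqP -> ->|ji _].
      by rewrite eqxx.
    rewrite eqz_nat nth_uniq ?(sorting_size srt) //; try by lia.
      by rewrite (ltn_eqF ji); exact: h3.
    by rewrite (perm_uniq (sorting_perm srt)) iota_uniq.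
  rewrite /normalize_body /P !denE /= /upd /=.
  have i1 : i%:Z + 1 = i.+1%:Z by lia.
  rewrite h1 (hord _ iN) hx h2 !hh hb bi hy i1 -/st /array.
  set y := x i + _; rewrite -!/(x i) -/y.
  case: (ltrP 0 (y - halfz y - halfz y)) => odd_y; last first.
    have st_y : st = (0, halfz y) by rewrite /st /naf_step -/y ltNge odd_y.
    by rewrite st_y /= h1 i1; split=> // j ji; apply: cand; rewrite ?st_y.
  case: (boolP (adjacent N f i)) => adj /=; last first.
    have st_y : st = (y, 0) by rewrite /st /naf_step -/y odd_y (negbTE adj).
    by rewrite st_y /= h1 i1; split=> // j ji; apply: cand; rewrite ?st_y.
  have i1N : (i.+1 < N)%N by case/andP: adj.
  rewrite (hord _ i1N) hx -/(x i.+1).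
  have -> : ar s a_half (halfz y + x i.+1) = halfz (halfz y + x i.+1).
    apply: (consts_half cst); have := xn _ i1N; have := xn _ iN.
    rewrite /y /halfz; lia.
  case: (ltrP 0 (_ - halfz (_ + _) - _)) => odd_n.
    have st_y : st = (-1, halfz y + 1) by rewrite /st /naf_step -/y odd_y adj odd_n.
    by rewrite st_y /= h1 i1; split=> // j ji; apply: cand; rewrite ?st_y.
  have st_y : st = (1, halfz y).
    by rewrite /st /naf_step -/y odd_y adj ltNge odd_n.
  by rewrite st_y /= h1 i1; split=> // j ji; apply: cand; rewrite ?st_y.
move=> s2 fr fa [h1 _ _].
by rewrite /= h1 fr // /s1 /= /upd /= (listing_size lst) subrr.
Qed.

(** The loop computes the digits of [digit], whose value and compactness were
established above. *)
Lemma normalize_ok :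
  compact E (array a_cand (den normalize s)) /\
  value E (array a_cand (den normalize s)) = J + value E (array a_x s).
Proof.
have loop := normalize_loop; have rm := room_roomy room.
have f0' := f0; have hS := S_adjacent; have hx := x_le.
split.
  apply: (compact_sorting srt) => [i iN|i adj].
    by rewrite loop //; apply: (digit_trit rm f0').
  have /andP[i1N _] := adj; rewrite !loop //; last exact: ltnW.
  exact: digit_naf.
rewrite !(value_sorting srt) -(digit_value rm f0' hS hx J_le size_gt0).
by apply: eq_bigr => i _; rewrite loop.
Qed.

End Normalize.

(** * Searching for a value among the exponents *)

Definition below (E : seq nat) (v : int) : nat := count (fun t : nat => t%:Z < v) E.

Section Search.
Variables (n : nat) (E L : seq nat) (s : store).
Hypothesis cst : consts n s.
Hypothesis lst : listing n E L s.
Hypothesis rws : rows n E s.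
Let w := array a_cand s.
Hypothesis cw : compact E w.

Let N := size E.
Let f := nth_exp E L.
Let v := value E w.
Let srt := listing_sorting lst.
Let digit_at j i := row n s (nth 0%N L j) (nth 0%N L i).

(** [t] rounds are over.  The last clause says that each effective round uses
one unit of [i + (hi - lo)], which is at most [2 * N] at the start. *)
Definition search_inv (t : nat) (s' : store) : Prop :=
  exists i lo hi : nat,
  [/\ [/\ rg s' r_i = i%:Z - 1, rg s' r_lo = lo%:Z & rg s' r_hi = hi%:Z - 1],
      [/\ (i <= N)%N, (lo <= hi)%N & (hi <= N)%N],
      forall j, (j < lo)%N -> (f j)%:Z < v,
      forall j, (hi <= j < N)%N -> v < (f j)%:Z &
      (forall j i', (lo <= j < hi)%N -> (i <= i' < N)%N ->
         digit_at j i' = w (nth 0%N L i')) /\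
      [|| i == 0%N, lo == hi | t + i + (hi - lo) <= 2 * N]%N].

Lemma row_compact j : (j < N)%N -> compact E (row n s (nth 0%N L j)).
Proof. by move=> jN; apply: rows_compact rws _ _; exact: sorting_nth. Qed.

Lemma row_value j : (j < N)%N -> value E (row n s (nth 0%N L j)) = (f j)%:Z.
Proof. by move=> jN; apply: rows_value rws _ _; exact: sorting_nth. Qed.

Lemma search_loop : search_inv (6 * n)%N (den search s).
Proof.
rewrite /search !denE /=; set s1 := Store _ _.
apply: (den_rep (P := search_inv)).
- by rewrite /s1 /= /upd /= (consts_6n cst).
- exists N, 0%N, N; split=> //.
  + by rewrite /s1 /= /upd /= (listing_size lst).
  + by move=> j; lia.
  + by split; [move=> j i; lia|apply/or3P/Or33; lia].
move=> t s2 _ fr fa [i [lo [hi [[hi1 hlo hhi] [iN lohi hiN] lt_v gt_v [eq_w fuel]]]]].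
have ord j : (j < N)%N -> ar s2 a_order j%:Z = (nth 0%N L j)%:Z.
  by move=> jN; rewrite fa // (listing_order lst).
have dig j k : (j < N)%N ->
    ar s2 a_digits (ar s2 a_row (nth 0%N L j)%:Z + k%:Z) = row n s (nth 0%N L j) k.
  move=> jN; rewrite !fa // (consts_row cst) //.
  by have := sorting_nth srt jN; have := listing_max lst; lia.
have cand k : ar s2 a_cand k = ar s a_cand k by rewrite fa.
rewrite !denE /= hi1 hlo hhi.
case: (posnP i) => [i0|ipos].
  rewrite i0 /=; exists 0%N, lo, hi; rewrite i0 in hi1 eq_w *; split=> //.
have -> : 0 < i%:Z - 1 + 1 :> int by lia.
case: (ltngtP lo hi) lohi => // [lt_lohi|lohi] _; last first.
  have -> : 0 < hi%:Z - 1 - lo%:Z + 1 = false by lia.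
  by exists i, lo, hi; split=> //; [rewrite lohi|split=> //; rewrite lohi eqxx orbT].
have -> : 0 < hi%:Z - 1 - lo%:Z + 1 by lia.
have i1 : i%:Z - 1 = i.-1%:Z by lia.
have h1 : hi%:Z - 1 = hi.-1%:Z by lia.
have loN : (lo < N)%N by lia.
have hi1N : (hi.-1 < N)%N by lia.
have i1N : (i.-1 < N)%N by lia.
rewrite ?denE /= /upd /= ?hi1 ?hlo ?hhi ?i1 ?h1 ?ord //.
rewrite !dig // cand -!/(digit_at _ _) -!/(array a_cand s _) -/w.
have agree j i' : (lo <= j < hi)%N -> (i.-1 < i')%N -> (i' < N)%N ->
   digit_at j i' = w (nth 0%N L i') by move=> hj ii' i'N; apply: eq_w; lia.
have fuel' : (t + i + (hi - lo) <= 2 * N)%N.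
  by move: fuel => /or3P[/eqP|/eqP|//]; lia.
case: (ltrP 0) => [lt_w|ge_w].
  exists i, lo.+1, hi; rewrite /= ?hlo; split=> //.
  - by split=> //; rewrite ?i1 //; lia.
  - move=> j; rewrite ltnS leq_eqVlt => /orP[/eqP ->|]; last exact: lt_v.
    rewrite -row_value //; apply: (sorting_lt srt (i := i.-1)) => //.
    + exact: row_compact.
    + by rewrite -subr_gt0.
    + by move=> i' ? ?; apply: agree => //; lia.
  split; last by apply/or3P/Or33; lia.
  by move=> j i' hj; apply: eq_w; lia.
case: (ltrP 0) => [gt_w|le_w].
  exists i, lo, hi.-1; rewrite /=; split=> //.
  - by split=> //; rewrite ?i1 //; lia.
  - move=> j hj; have [->|ne] := eqVneq j hi.-1; last by apply: gt_v; lia.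
    rewrite -row_value //; apply: (sorting_lt srt (i := i.-1)) => //.
    + exact: row_compact.
    + by rewrite -subr_gt0.
    + by move=> i' ? ?; symmetry; apply: agree => //; lia.
  split; last by apply/or3P/Or33; lia.
  by move=> j i' hj; apply: eq_w; lia.
exists i.-1, lo, hi; rewrite /=; split=> //.
- by split=> //; lia.
split; last by apply/or3P/Or33; lia.
move=> j i' hj hi'; have [->|ne] := eqVneq i' i.-1; last by apply: eq_w; lia.
have jN : (j < N)%N by lia.
(* Rows that agree above this place are ordered by their digits here. *)
have order j' j'' : (lo <= j' < hi)%N -> (lo <= j'' < hi)%N -> (j' <= j'')%N ->
    digit_at j' i.-1 <= digit_at j'' i.-1.
  move=> h' h'' le_j; rewrite leNgt; apply/negP => lt_d.
  have : value E (row n s (nth 0%N L j'')) < value E (row n s (nth 0%N L j')).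
    apply: (sorting_lt srt (i := i.-1)) => //; try (apply: row_compact; lia).
    by move=> i'' ? ?; rewrite -!/(digit_at _ _) !agree.
  rewrite !row_value; try lia.
  by rewrite ltz_nat /f nth_exp_lt //; lia.
have h_lo : digit_at lo i.-1 <= digit_at j i.-1 by apply: order; lia.
have h_hi : digit_at j i.-1 <= digit_at hi.-1 i.-1 by apply: order; lia.
apply/eqP; rewrite eq_le; apply/andP; split.
  by apply: le_trans h_hi _; rewrite -subr_le0.
by apply: le_trans h_lo; rewrite -subr_le0.
Qed.

(** If the interval is not empty in the end, all digits have been compared and
its rows equal the candidate; otherwise all exponents are below or above. *)
Lemma search_ok :
  rg (den search s) r_lo = (below E v)%:Z /\
  (0 < ev found (den search s)) = (v \in map Posz E).
Proof.
have [i [lo [hi [[_ hlo hhi] [iN lohi hiN] lt_v gt_v [eq_w fuel]]]]] := search_loop.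
have N3 := listing_max lst.
rewrite /found /= hlo hhi.
case: (ltngtP lo hi) lohi => // [lt_lohi|lohi] _; last first.
  have nv : v \notin map Posz E.
    apply/mapP => -[t /(mem_nth_exp srt)[j jN <-] vE].
    case: (ltnP j lo) => [/lt_v|?]; first by rewrite vE ltxx.
    by have := gt_v j; rewrite vE ltxx -lohi; lia.
  split; last by rewrite (negbTE nv); lia.
  congr Posz; apply/esym/(count_below srt) => //; first by rewrite lohi.
  by move=> j hj; apply/ltW/gt_v; lia.
have i0 : i = 0%N by move: fuel; rewrite -/N => /or3P[/eqP|/eqP|]; lia.
have val j : (lo <= j < hi)%N -> (f j)%:Z = v.
  move=> hj; rewrite -row_value; last by lia.
  rewrite /v !(value_sorting srt); apply: eq_bigr => k _.
  by rewrite -[w _](eq_w j) // i0 /=.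
have vlo : (f lo)%:Z = v by apply: val; lia.
split; last first.
  rewrite -vlo map_f; first by lia.
  by apply: nth_exp_mem => //; rewrite -/N; lia.
congr Posz; apply/esym/(count_below srt) => //; first by rewrite -/N; lia.
move=> j /andP[loj jN]; rewrite -vlo lez_nat leqNgt nth_exp_lt //; lia.
Qed.

End Search.

Lemma locate_ok n E L S m b s J :
  consts n s -> listing n E L s -> rows n E s ->
  room_for n E S m b (array a_x s) -> rg s r_J = J ->
  `|J| <= (b 0%N)%:Z + 1 -> `|J| <= (3 * n)%N%:Z + 1 ->
  let v := J + value E (array a_x s) in let s' := den locate s in
  [/\ compact E (array a_cand s'), value E (array a_cand s') = v,
      rg s' r_lo = (below E v)%:Z & (0 < ev found s') = (v \in map Posz E)].
Proof.
move=> cst lst rws room sJ J1 J2 v s'; rewrite /s' /v /locate den_seq.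
have [cw vw] := normalize_ok cst lst room sJ J1 J2.
set s1 := den normalize s in cw vw *.
have cst1 : consts n s1 by apply: den_consts.
have lst1 : listing n E L s1 by apply: den_listing.
have rws1 : rows n E s1 by apply: den_rows.
have [hlo hf] := search_ok cst1 lst1 rws1 cw.
have e : array a_cand (den search s1) = array a_cand s1 by rewrite /array den_ar.
by rewrite e hlo hf vw; split.
Qed.

(** * Inserting an exponent *)

Lemma below_le E v : (below E v <= size E)%N.
Proof. exact: count_size. Qed.

Lemma nth_exp_below E L v i : sorting E L -> (i < size E)%N ->
  ((nth_exp E L i)%:Z < v) = (i < below E v)%N.
Proof.
move=> srt iN.
pose pos := find (fun t : nat => v <= t%:Z) (mkseq (nth_exp E L) (size E)).
have posN : (pos <= size E)%N.
  by rewrite -[X in (_ <= X)%N](size_mkseq (nth_exp E L)) find_size.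
have lo j : (j < pos)%N -> (nth_exp E L j)%:Z < v.
  move=> jp; have := before_find 0%N jp.
  by rewrite nth_mkseq ?(leq_trans jp) // ltNge => ->.
have hi j : (pos <= j < size E)%N -> v <= (nth_exp E L j)%:Z.
  move=> /andP[pj jN]; have posN' : (pos < size E)%N by lia.
  have : has (fun t : nat => v <= t%:Z) (mkseq (nth_exp E L) (size E)).
    by rewrite has_find size_mkseq.
  move=> /(nth_find 0%N); rewrite -/pos nth_mkseq // => h.
  apply: le_trans h _; rewrite lez_nat leqNgt nth_exp_lt //; lia.
rewrite /below (count_below srt posN lo hi).
by case: (ltnP i pos) => ip; [rewrite lo|rewrite ltNge hi // ip].
Qed.

Lemma nth_exp_above E L (e i : nat) : sorting E L -> e \notin E ->
  (i < size E)%N -> (below E e%:Z <= i)%N -> (e < nth_exp E L i)%N.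
Proof.
move=> srt eE iN; rewrite leqNgt -(nth_exp_below _ srt iN) ltz_nat -leqNgt leq_eqVlt.
by case/orP=> // /eqP ee; rewrite ee nth_exp_mem in eE.
Qed.

(** The new exponent has the last position and the rank that the number of
smaller exponents gives. *)
Lemma sorting_insert E L e : sorting E L -> e \notin E ->
  let pos := below E e%:Z in
  sorting (rcons E e) (take pos L ++ size E :: drop pos L).
Proof.
move=> srt eE pos; split.
- by rewrite rcons_uniq eE (sorting_uniq srt).
- rewrite size_rcons -addn1 iotaD add0n /= cats1 perm_sym perm_rcons perm_sym.
  rewrite -cat1s perm_catCA /= perm_cons cat_take_drop.
  exact: sorting_perm srt.
have sz := sorting_size srt.
have eL l : {subset l <= L} -> [seq nth 0%N (rcons E e) k | k <- l] = [seq nth 0%N E k | k <- l].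
  move=> lL; apply/eq_in_map => k /lL; rewrite (sorting_mem srt) => kN.
  by rewrite nth_rcons kN.
rewrite map_cat /= nth_rcons ltnn eqxx !eL; try by [exact: mem_take|exact: mem_drop].
have := sorting_sorted srt; rewrite !(sorted_pairwise ltn_trans).
rewrite -{1}(cat_take_drop pos L) map_cat !pairwise_cat /=.
move=> /and3P[h1 h2 h3]; rewrite h2 h3 !andbT allrel_consr h1 andbT.
apply/andP; split.
  apply/allP => t /(nthP 0%N)[i]; rewrite size_map size_take sz => ip <-.
  have ip' : (i < pos)%N by move: ip; case: ifP; lia.
  have iN : (i < size E)%N by have := below_le E e%:Z; rewrite -/pos; lia.
  rewrite (nth_map 0%N) ?size_take ?sz // nth_take //.
  by have := nth_exp_below e%:Z srt iN; rewrite ip' ltz_nat.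
apply/allP => t /(nthP 0%N)[i]; rewrite size_map size_drop sz => ip <-.
rewrite (nth_map 0%N) ?size_drop ?sz // nth_drop.
by apply: nth_exp_above => //; rewrite -/pos; lia.
Qed.

Lemma nth_insert (L : seq nat) pos N i : (pos <= size L)%N ->
  nth 0%N (take pos L ++ N :: drop pos L) i =
  if (i < pos)%N then nth 0%N L i else if i == pos then N else nth 0%N L i.-1.
Proof.
move=> posL; rewrite nth_cat size_take_min (minn_idPl posL).
case: ltnP => ip; first by rewrite nth_take.
case: eqP => [->|ne]; first by rewrite subnn.
have -> : (i - pos = (i.-1 - pos).+1)%N by lia.
by rewrite /= nth_drop; congr nth; lia.
Qed.

Lemma value_rcons E e w : value (rcons E e) w = value E w + w (size E) * 2 ^+ e.
Proof.
rewrite /value size_rcons big_ord_recr /= nth_rcons ltnn eqxx; congr (_ + _).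
by apply: eq_bigr => k _; rewrite nth_rcons ltn_ord.
Qed.

Lemma eq_value E w w' : (forall k, (k < size E)%N -> w k = w' k) ->
  value E w = value E w'.
Proof. by move=> h; apply: eq_bigr => k _; rewrite h. Qed.

Lemma eq_compact E w w' : (forall k, (k < size E)%N -> w k = w' k) ->
  compact E w -> compact E w'.
Proof.
move=> h [c1 c2]; split=> [k kE|k k' kE k'E]; first by rewrite -h //; apply: c1.
by rewrite -(h k kE) -(h k' k'E); apply: c2.
Qed.

Lemma compact_rcons E e w : w (size E) = 0 -> compact E w -> compact (rcons E e) w.
Proof.
move=> w0 [c1 c2]; split=> [k|k k']; rewrite size_rcons ltnS leq_eqVlt.
  by case/orP=> [/eqP ->|/c1//]; rewrite w0.
case/orP=> [/eqP -> _|kE]; first by rewrite w0 eqxx.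
rewrite ltnS leq_eqVlt; case/orP=> [/eqP -> _|k'E]; first by rewrite w0 eqxx.
by rewrite !nth_rcons kE k'E; apply: c2.
Qed.

Lemma eq_pair_code w j k j' k' : (k < w)%N -> (k' < w)%N ->
  (j * w + k == j' * w + k')%N = (j == j') && (k == k').
Proof.
move=> kw k'w; case: (ltngtP j j') => [lt|lt|->]; last by rewrite eqn_add2l.
  have : (j.+1 * w <= j' * w)%N by rewrite leq_mul2r lt orbT.
  by rewrite mulSn /= => h; apply/eqP; lia.
have : (j'.+1 * w <= j * w)%N by rewrite leq_mul2r lt orbT.
by rewrite mulSn /= => h; apply/eqP; lia.
Qed.

Lemma copy_row_ok n N id s : consts n s -> rg s r_size = N%:Z -> (N <= 3 * n)%N ->
  rg s r_row = id%:Z -> (id < 3 * n)%N ->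
  forall id' k, (id' < 3 * n)%N -> (k < 3 * n)%N ->
  row n (den copy_row s) id' k =
    if (id' == id) && (k < N)%N then array a_cand s k else row n s id' k.
Proof.
move=> cst sz N3 hid idn id' k' id'n k'n.
pose P i s' := [/\ rg s' r_i = i%:Z &
  forall id' k, (id' < 3 * n)%N -> (k < 3 * n)%N -> row n s' id' k =
    if (id' == id) && (k < i)%N then array a_cand s k else row n s id' k].
suff [_ ->//] : P N (den copy_row s).
rewrite /copy_row !den_seq !den_let; set s1 := (X in den (Rep _ _) X).
have ha : rg s1 r_a = (id * (3 * n))%N%:Z.
  by rewrite /s1 /= /upd /= hid (consts_row cst).
have hsz : rg s1 r_size = N%:Z by rewrite /s1 /= /upd /= sz.
apply: (den_upto (P := P) (k := (3 * n)%N)).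
- by rewrite /s1 /= /upd /= (consts_3n cst).
- by [].
- by split=> // ? ? ? ?; rewrite ltn0 andbF.
- move=> i s2 iN fr fa [h1 h2].
  have sz2 : rg s2 r_size = N%:Z by rewrite fr.
  have ha2 : rg s2 r_a = (id * (3 * n))%N%:Z by rewrite fr.
  split; first by rewrite /= h1 sz2; lia.
  rewrite !denE; split; first by rewrite /= /upd /= h1; lia.
  move=> j k jn kn; rewrite /row /= /upd_array /updz /= h1 ha2.
  rewrite eqz_nat; have iN3 : (i < 3 * n)%N by lia.
  have -> : (j * (3 * n) + k == id * (3 * n) + i)%N = (j == id) && (k == i).
    exact: eq_pair_code.
  rewrite ltnS [(k <= i)%N]leq_eqVlt; have := h2 j k jn kn; rewrite /row => ->.
  have -> : ar s2 a_cand i%:Z = array a_cand s i by rewrite fa.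
  by case: eqP => //= _; case: eqP => [->|].
by move=> s2 fr fa [h1 _]; rewrite /= h1 fr // hsz subrr.
Qed.

Lemma make_room_ok n E L s pos : consts n s -> listing n E L s ->
  rg s r_lo = pos%:Z -> (pos <= size E)%N ->
  forall i : nat, ar (den make_room s) a_order i%:Z =
    if (pos < i <= size E)%N then ar s a_order i.-1%:Z else ar s a_order i%:Z.
Proof.
move=> cst lst hlo posN i.
pose P t s' := rg s' r_i = (size E - t)%N%:Z /\
  forall i : nat, ar s' a_order i%:Z =
    if (size E - t < i <= size E)%N then ar s a_order i.-1%:Z else ar s a_order i%:Z.
suff [_ ->] : P (size E - pos)%N (den make_room s) by rewrite subKn.
rewrite /make_room den_seq den_let; set s1 := (X in den (Rep _ _) X).
apply: (den_upto (P := P) (k := (3 * n)%N)).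
- by rewrite /s1 /= /upd /= (consts_3n cst).
- by have := listing_max lst; lia.
- split; first by rewrite /s1 /= /upd /= (listing_size lst) subn0.
  by move=> k; rewrite /s1 /= subn0; case: ifP => //; lia.
- move=> t s2 tN fr fa [h1 h2].
  have lo2 : rg s2 r_lo = pos%:Z by rewrite fr.
  split; first by rewrite /= h1 lo2; lia.
  rewrite !denE; split; first by rewrite /= /upd /= h1; lia.
  move=> k; rewrite /= /upd_array /updz /= h1 eqz_nat.
  have -> : (size E - t)%N%:Z - 1 = (size E - t.+1)%N%:Z by lia.
  rewrite !h2; case: eqP => [->|ne].
    have -> : ((size E - t.+1 < size E - t) && (size E - t <= size E))%N by lia.
    have -> : ((size E - t < size E - t.+1) && (size E - t.+1 <= size E))%N = false by lia.
    by congr (ar s a_order _%:Z); lia.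
  by congr (if _ then _ else _); lia.
by move=> s2 fr fa [h1 _]; have lo2 : rg s2 r_lo = pos%:Z; [rewrite fr|rewrite /= h1 lo2; lia].
Qed.

Definition has_below (E : seq nat) (e : nat) (z : int) : Prop :=
  (exists2 k : nat, (k < size E)%N & z = k%:Z /\ (nth 0%N E k).+1 = e) \/
  z = -1 /\ forall t, t \in E -> t.+1 != e.

(** Besides the new entry, the only bit that changes is the one of the
exponent that is smaller by one, if it is present. *)
Lemma insert_ok n E L s (e : nat) :
  consts n s -> listing n E L s -> rows n E s -> e \notin E -> (size E < 3 * n)%N ->
  compact E (array a_cand s) -> value E (array a_cand s) = e%:Z ->
  rg s r_lo = (below E e%:Z)%:Z -> rg s r_above = (e.+1 \in E : nat)%:Z ->
  has_below E e (rg s r_below) ->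
  let s' := den insert s in let pos := below E e%:Z in
  [/\ listing n (rcons E e) (take pos L ++ size E :: drop pos L) s',
      rows n (rcons E e) s',
      forall k, k != size E -> array a_parked s' k = array a_parked s k &
      array a_parked s' (size E) = 0].
Proof.
move=> cst lst rws eE szE cw vw hlo habove hbelow s' pos.
have srt := listing_sorting lst; have posN : (pos <= size E)%N := below_le _ _.
have sz : rg s r_size = (size E)%:Z := listing_size lst.
pose s1 := den make_room s.
pose s2 := Store (rg s1) (upd_array (ar s1) a_order pos%:Z (size E)%:Z).
pose s3 := Store (upd (rg s2) r_row (size E)%:Z) (ar s2).
pose s4 := den copy_row s3.
have rg1 r : r != r_i -> rg s1 r = rg s r.
  by move=> ri; rewrite /s1 den_rg //= !inE negb_or ri.
have ar1 j : j != a_order -> ar s1 j = ar s j.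
  by move=> ja; rewrite /s1 den_ar //= !inE.
have rg4 r : r \notin [:: r_i; r_row; r_a] -> rg s4 r = rg s r.
  rewrite !inE !negb_or => /and3P[h1 h2 h3].
  rewrite /s4 den_rg ?inE /= ?inE ?negb_or ?h1 ?h3 //.
  by rewrite /s3 /= /upd (negbTE h2) rg1.
have ar4 j : j \notin [:: a_order; a_digits] -> ar s4 j = ar s j.
  rewrite !inE !negb_or => /andP[h1 h2].
  rewrite /s4 den_ar /= ?inE ?h2 // /s3 /s2 /= /upd_array (negbTE h1).
  exact: ar1.
have ord4 : ar s4 a_order = updz (ar s1 a_order) pos%:Z (size E)%:Z.
  by rewrite /s4 den_ar.
have s'E : s' = den (a_bit:[$r_size] ::= $r_above ;;
  a_parked:[$r_size] ::= #0 ;;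
  When ($r_below :+ #1) (a_bit:[$r_below] ::= #1) ;; incr r_size)%P s4.
  have s2E : s2 = den (a_order:[$r_lo] ::= $r_size)%P s1.
    by rewrite /s2 den_sto /= !rg1 // hlo sz.
  have s3E : s3 = den (r_row ::= $r_size)%P s2 by rewrite /s3 den_let /= rg1 // sz.
  by rewrite /s4 s3E s2E.
have cst3 : consts n s3.
  by apply: (@frame_consts n s) => //; [right; rewrite /s3 /= /upd /= !rg1
    |rewrite /s3 /= /upd_array /= ar1|rewrite /s3 /= /upd_array /= ar1].
have row4 id k : (id < 3 * n)%N -> (k < 3 * n)%N -> row n s4 id k =
    if (id == size E) && (k < size E)%N then array a_cand s k else row n s id k.
  move=> idn kn; rewrite (@copy_row_ok n (size E) (size E)) //; last 2 first.
  - by rewrite /s3 /= /upd /= rg1.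
  - exact: ltnW.
  by rewrite /array /row /s3 /= /upd_array /= !ar1.
have order4 i : (i < (size E).+1)%N ->
    ar s4 a_order i%:Z = (nth 0%N (take pos L ++ size E :: drop pos L) i)%:Z.
  move=> iN; rewrite ord4 /updz eqz_nat nth_insert ?(sorting_size srt) //.
  rewrite (make_room_ok cst lst hlo posN).
  case: (ltngtP i pos) => ip //=.
    by rewrite (listing_order lst) //; lia.
  by rewrite -ltnS iN (listing_order lst) //; lia.
have row' id k : row n s' id k = row n s4 id k.
  by rewrite s'E /row den_ar.
have size' : rg s' r_size = (size E).+1%:Z.
  rewrite s'E !denE; case: ifP => _; rewrite /= /upd /= rg4 // sz; lia.
have row_old id : (id < size E)%N -> forall k, (k < size E)%N ->
    row n s id k = row n s' id k.
  move=> idE k kE; rewrite row' row4; try lia.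
  by rewrite (ltn_eqF idE).
have row_new : forall k, (k < size E)%N -> array a_cand s k = row n s' (size E) k.
  by move=> k kE; rewrite row' row4 ?eqxx ?kE //; lia.
have row_fresh id k : (id < 3 * n)%N -> (size E <= k < 3 * n)%N -> row n s' id k = 0.
  move=> idn /andP[kE kn]; rewrite row' row4 // ltnNge kE andbF.
  by apply: rows_fresh rws _ _ _ _; rewrite ?kE.
have fresh0 id : (id <= size E)%N -> row n s' id (size E) = 0.
  by move=> idE; apply: row_fresh; rewrite ?leqnn //; lia.
split.
- split.
  + by rewrite size' size_rcons.
  + by rewrite size_rcons.
  + exact: sorting_insert.
  + by rewrite mem_rcons inE (listing_zero lst) orbT.
  + by move=> i; rewrite size_rcons s'E den_ar //; exact: order4.
  move=> k; rewrite size_rcons ltnS => kE.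
  have bit4 j : ar s4 a_bit j = ar s a_bit j by rewrite ar4.
  have below_rg : rg s4 r_below = rg s r_below by rewrite rg4.
  have above_rg : rg s4 r_above = rg s r_above by rewrite rg4.
  have sz4 : rg s4 r_size = (size E)%:Z by rewrite rg4.
  have e1 : (e.+1 == e) = false by apply/eqP; lia.
  rewrite s'E !denE /= below_rg.
  have [bk|[ne nb]] : (exists2 j : nat, (j < size E)%N &
       rg s r_below = j%:Z /\ (nth 0%N E j).+1 = e) \/
      rg s r_below = -1 /\ forall t, t \in E -> t.+1 != e by [].
    case: bk => j jE [-> je]; have -> : 0 < j%:Z + 1 by lia.
    rewrite /= /upd_array /updz /= sz4 !eqz_nat above_rg habove.
    rewrite mem_rcons inE nth_rcons.
    move: kE; rewrite leq_eqVlt => /orP[/eqP ->|kE].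
      by rewrite gtn_eqF // ltnn eqxx e1.
    rewrite kE (ltn_eqF kE) bit4 (listing_bit lst) //.
    case: (eqVneq k j) => [->|kj]; first by rewrite je eqxx.
    case: eqP => // kje; case/eqP: kj.
    have : nth 0%N E k = nth 0%N E j by lia.
    by move/eqP; rewrite (nth_uniq 0%N kE jE (sorting_uniq srt)) => /eqP.
  have -> : 0 < rg s r_below + 1 = false by rewrite ne.
  rewrite /= /upd_array /updz /= sz4 !eqz_nat above_rg habove.
  rewrite mem_rcons inE nth_rcons.
  move: kE; rewrite leq_eqVlt => /orP[/eqP ->|kE].
    by rewrite ltnn eqxx e1.
  rewrite kE (ltn_eqF kE) bit4 (listing_bit lst) //.
  by rewrite (negbTE (nb _ (mem_nth 0%N kE))).
- split.
  + move=> id; rewrite size_rcons ltnS => idE.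
    apply: compact_rcons; first exact: fresh0.
    move: idE; rewrite leq_eqVlt => /orP[/eqP ->|idE]; first exact: eq_compact cw.
    by apply: eq_compact (row_old _ idE) _; apply: rows_compact rws _ _.
  + move=> id; rewrite size_rcons ltnS => idE.
    rewrite value_rcons fresh0 // mul0r addr0 nth_rcons.
    move: idE; rewrite leq_eqVlt => /orP[/eqP ->|idE].
      by rewrite ltnn eqxx -vw; apply/esym/eq_value.
    by rewrite idE -(rows_value rws idE); apply/esym/eq_value/row_old.
  + by move=> id k idn; rewrite size_rcons => kE; apply: row_fresh => //; lia.
- move=> k kE; rewrite s'E /array !denE.
  have pk4 : ar s4 a_parked k%:Z = ar s a_parked k%:Z by rewrite ar4.
  have sz4 : rg s4 r_size = (size E)%:Z by rewrite rg4.
  by case: ifP => _; rewrite /= /upd_array /updz /= sz4 eqz_nat (negbTE kE).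
rewrite s'E /array !denE; have sz4 : rg s4 r_size = (size E)%:Z by rewrite rg4.
by case: ifP => _; rewrite /= /upd_array /updz /= sz4 eqxx.
Qed.

(** * Making sure that an exponent is present *)

Record state (n : nat) (E L : seq nat) (s : store) : Prop := State {
  state_consts : consts n s;
  state_listing : listing n E L s;
  state_rows : rows n E s
}.

Lemma den_state n E L c s : state n E L s ->
  all (fun r => r \notin assigned c) [:: r_n; r_3n; r_6n; r_size] ->
  all (fun j => j \notin stored c) [:: a_half; a_row; a_order; a_bit; a_digits] ->
  state n E L (den c s).
Proof.
move=> [c1 c2 c3] /=; rewrite !andbT.
move=> /and4P[h1 h2 h3 h4] /and5P[h5 h6 h7 h8 h9].
split; first by apply: den_consts; rewrite //= ?h1 ?h2 ?h3 ?h5 ?h6.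
  by apply: den_listing; rewrite //= ?h7 ?h8.
exact: den_rows.
Qed.

Lemma rg_let r e s : rg (den (Let r e) s) r = ev e s.
Proof. by rewrite den_let /= /upd eqxx. Qed.

Lemma below_mem E L t : sorting E L -> t \in E ->
  (below E t%:Z < size E)%N /\ nth_exp E L (below E t%:Z) = t.
Proof.
move=> srt /(mem_nth_exp srt)[i iN <-].
suff -> : below E (nth_exp E L i)%:Z = i by [].
apply: (count_below srt) => [|j ji|j ij]; first exact: ltnW.
  by rewrite ltz_nat nth_exp_lt //; lia.
by rewrite lez_nat leqNgt nth_exp_lt //; lia.
Qed.

Lemma mem_Posz (E : seq nat) (t : nat) : (t%:Z \in map Posz E) = (t \in E).
Proof. by rewrite mem_map // => i j []. Qed.

Lemma room_for_rcons n E S m b X e : room_for n E S m b X -> X (size E) = 0 ->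
  room_for n (rcons E e) S m b X.
Proof.
move=> [r1 r2 r3 r4 r5] X0; split=> //.
- by move=> t /r2; rewrite mem_rcons inE orbC => ->.
- by move=> t /r3; rewrite mem_rcons inE orbC => ->.
- move=> k; rewrite size_rcons ltnS leq_eqVlt => /orP[/eqP ->|kE].
    by rewrite X0 normr0.
  by rewrite nth_rcons kE r4.
move=> k; rewrite size_rcons ltnS leq_eqVlt => /orP[/eqP ->|/r5//].
by rewrite X0 normr0.
Qed.

Definition add_exp (E : seq nat) (v : nat) : seq nat :=
  if v \in E then E else rcons E v.

Lemma mem_add_exp E v t : (t \in add_exp E v) = (t == v) || (t \in E).
Proof.
rewrite /add_exp; case: ifP => [vE|_]; last by rewrite mem_rcons inE.
by case: eqP => [->|].
Qed.

(** Shifts by one more and one less are only normalized if [v] is new; in that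
case the carry bound needs the additional room of the last hypothesis. *)
Lemma ensure_ok n E L S m b s (J v : nat) :
  state n E L s -> room_for n E S m b (array a_x s) -> rg s r_J = J%:Z ->
  J%:Z + value E (array a_x s) = v%:Z ->
  (J <= (b 0%N).+1)%N -> (J <= 3 * n)%N ->
  (v \notin E -> [/\ size E < 3 * n, J <= b 0 & J < 3 * n]%N) ->
  let s' := den ensure s in
  [/\ exists L', state n (add_exp E v) L' s', rg s' r_J = J%:Z &
     forall k, array a_parked s' k =
       if (v \notin E) && (k == size E) then 0 else array a_parked s k].
Proof.
move=> st room sJ vE J1 J2 Jfree.
have srt := listing_sorting (state_listing st).
have locate_at (s0 : store) (z : int) : state n E L s0 -> ar s0 a_x = ar s a_x ->
    rg s0 r_J = z -> `|z| <= (b 0%N)%:Z + 1 -> `|z| <= (3 * n)%N%:Z + 1 ->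
    let s' := den locate s0 in
    [/\ state n E L s', ar s' a_x = ar s a_x, rg s' r_J = z,
        compact E (array a_cand s') /\
        value E (array a_cand s') = z - J%:Z + v%:Z &
        rg s' r_lo = (below E (z - J%:Z + v%:Z))%:Z /\
        (0 < ev found s') = (z - J%:Z + v%:Z \in map Posz E)].
  move=> st0 X0 J0 z1 z2 s'.
  have room0 : room_for n E S m b (array a_x s0) by rewrite /array X0.
  have zv : z + value E (array a_x s0) = z - J%:Z + v%:Z.
    by rewrite -vE /array X0 addrA subrK.
  have [h1 h2 h3 h4] := locate_ok (state_consts st0) (state_listing st0)
    (state_rows st0) room0 J0 z1 z2.
  rewrite zv in h2 h3 h4; split=> //.
  - exact: den_state.
  - by rewrite /s' den_ar.
  - by rewrite /s' den_rg.
have [stA XA JA [_ _] [_ fA]] : let s' := den locate s in _ :=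
  locate_at s J%:Z st erefl sJ ltac:(lia) ltac:(lia).
move=> s'; rewrite /s' /ensure den_seq den_if fA subrr add0r mem_Posz.
rewrite /add_exp; case: ifP => vinE.
  rewrite den_skip; split=> //; first by exists L.
  by move=> k; rewrite /array den_ar.
move/negbT in vinE.
have [szE J3 J4] := Jfree vinE.
remember (den locate s) as sA eqn:sAE.
remember (den (r_J ::= $r_J :- #1)%P sA) as s1 eqn:s1E.
have st1 : state n E L s1 by rewrite s1E; apply: den_state.
have X1 : ar s1 a_x = ar s a_x by rewrite s1E den_ar.
have J1' : rg s1 r_J = J%:Z - 1 by rewrite s1E den_let /= /upd /= JA.
have [||stB XB JB _ [loB fB]] := locate_at s1 (J%:Z - 1) st1 X1 J1'; try lia.
remember (den locate s1) as sB eqn:sBE.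
have vB : J%:Z - 1 - J%:Z + v%:Z = v%:Z - 1 by lia.
rewrite vB in loB fB.
remember (den (If found (r_below ::= a_order@[$r_lo]) (r_below ::= #(-1)))%P sB) as s2 eqn:s2E.
have bel : has_below E v (rg s2 r_below).
  rewrite s2E den_if fB; case: ifP => [/mapP[t tE vt]|nv]; last first.
    right; split; first by rewrite den_let /= /upd.
    move=> t tE; apply/eqP => tv; move/negP: nv; apply.
    by rewrite -tv (_ : _ - 1 = t%:Z) ?mem_Posz //; lia.
  left; rewrite den_let /= /upd /= loB vt.
  have [bN bt] := below_mem srt tE; exists (nth 0%N L (below E t%:Z)).
    exact: sorting_nth.
  rewrite (listing_order (state_listing stB)) //; split=> //.
  by rewrite -/(nth_exp E L _) bt; lia.
remember (den (r_J ::= $r_J :+ #2)%P s2) as s3 eqn:s3E.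
have st3 : state n E L s3 by rewrite s3E s2E; do 2!apply: den_state => //.
have X3 : ar s3 a_x = ar s a_x by rewrite s3E den_ar // s2E den_ar.
have J3' : rg s3 r_J = J%:Z + 1.
  by rewrite s3E den_let /= /upd /= s2E den_rg // JB; lia.
have [||stC XC JC _ [_ fC]] := locate_at s3 (J%:Z + 1) st3 X3 J3'; try lia.
remember (den locate s3) as sC eqn:sCE.
have vC : J%:Z + 1 - J%:Z + v%:Z = v.+1%:Z by lia.
rewrite vC mem_Posz in fC.
remember (den (If found (r_above ::= #1) (r_above ::= #0))%P sC) as s4 eqn:s4E.
have abv : rg s4 r_above = (v.+1 \in E : nat)%:Z.
  by rewrite s4E den_if fC; case: ifP => _; rewrite den_let.
remember (den (r_J ::= $r_J :- #1)%P s4) as s5 eqn:s5E.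
have st5 : state n E L s5 by rewrite s5E s4E; do 2!apply: den_state => //.
have X5 : ar s5 a_x = ar s a_x by rewrite s5E den_ar // s4E den_ar.
have J5' : rg s5 r_J = J%:Z.
  have J4' : rg s4 r_J = J%:Z + 1 by rewrite s4E den_rg.
  by rewrite s5E rg_let /= J4' addrK.
have [||stD XD JD [cD wD] [loD _]] := locate_at s5 J%:Z st5 X5 J5'; try lia.
remember (den locate s5) as sD eqn:sDE.
rewrite subrr add0r in wD loD.
have abvD : rg sD r_above = (v.+1 \in E : nat)%:Z.
  by rewrite sDE den_rg // s5E den_rg.
have belD : has_below E v (rg sD r_below).
  by rewrite sDE den_rg // s5E den_rg // s4E den_rg // sCE den_rg // s3E den_rg.
have [lst' rws' pk1 pk2] := insert_ok (state_consts stD) (state_listing stD)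
  (state_rows stD) vinE szE cD wD loD abvD belD.
rewrite den_seq -s1E den_seq -sBE den_seq -s2E den_seq -s3E den_seq -sCE.
rewrite den_seq -s4E den_seq -s5E den_seq -sDE.
split.
- eexists; split; [|exact: lst'|exact: rws'].
  by apply: den_consts => //; exact: state_consts stD.
- by rewrite den_rg.
move=> k; case: (eqVneq k (size E)) => [->|kE]; first exact: pk2.
rewrite pk1 // /array sDE den_ar // s5E den_ar // s4E den_ar // sCE den_ar //.
by rewrite s3E den_ar // s2E den_ar // sBE den_ar // s1E den_ar // sAE den_ar.
Qed.

(** * Parking the exponent of a node *)

Definition parked (E : seq nat) (S : nat -> bool) (s : store) : Prop :=
  forall k, (k < size E)%N -> array a_parked s k = (S (nth 0%N E k) : nat)%:Z.

Lemma walk_ok n E L S s (e : nat) : state n E L s -> parked E S s ->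
  (forall t, S t -> t.+1 \in E) -> e \in E ->
  rg s r_lo = (below E e%:Z)%:Z -> rg s r_J = 0 ->
  let s' := den walk s in
  exists j, [/\ forall i, (i < j)%N -> S (e + i)%N, ~~ S (e + j)%N,
    rg s' r_J = j%:Z & exists2 u, (u < size E)%N &
      rg s' r_u = u%:Z /\ nth_exp E L u = (e + j)%N].
Proof.
move=> st pk succ eE hlo hJ s'; have srt := listing_sorting (state_listing st).
have [lt0 e0] := below_mem srt eE.
pose P i s' := exists j, [/\ forall i, (i < j)%N -> S (e + i)%N,
  rg s' r_J = j%:Z, exists2 u, (u < size E)%N &
      [/\ rg s' r_u = u%:Z, nth_exp E L u = (e + j)%N & (j <= u)%N] &
  j = i \/ ~~ S (e + j)%N].
suff [j [h1 h2 [u uN [hu nu ju]] h4]] : P (3 * n)%N s'.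
  exists j; split=> //; last by exists u.
  by case: h4 => // j3; have := listing_max (state_listing st); lia.
rewrite /s' /walk den_seq den_let; set s1 := Store _ _.
apply: (den_rep (P := P)).
- by rewrite /s1 /= /upd /= (consts_3n (state_consts st)).
- exists 0%N; split=> //; last by left.
  exists (below E e%:Z); rewrite ?addn0 //; split=> //.
move=> i s2 _ fr fa [j [h1 h2 [u uN [hu nu ju]] h4]].
have ord : ar s2 a_order u%:Z = (nth 0%N L u)%:Z.
  by rewrite fa // (listing_order (state_listing st)).
have pku : ar s2 a_parked (nth 0%N L u)%:Z = (S (e + j)%N : nat)%:Z.
  by rewrite fa // -nu [LHS]pk //; exact: sorting_nth.
rewrite den_if /= hu ord pku.
case: (boolP (S (e + j)%N)) => Sj /=; last first.
  by exists j; split=> //; [exists u|right].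
have adj := adjacent_mem srt uN; rewrite nu succ // in adj.
case/andP: adj => u1N /eqP eu1.
exists j.+1; split.
- by move=> i'; rewrite ltnS leq_eqVlt => /orP[/eqP ->|/h1].
- by rewrite den_seq rg_let /= /upd /= h2; lia.
- exists u.+1 => //; split; [|by rewrite eu1 nu addnS|by []].
  by rewrite den_seq den_rg // rg_let /= hu; lia.
by left; case: h4 => [->//|]; rewrite Sj.
Qed.

Lemma nth_add_exp E v k : (k < size E)%N -> nth 0%N (add_exp E v) k = nth 0%N E k.
Proof. by rewrite /add_exp; case: ifP => // _ kE; rewrite nth_rcons kE. Qed.

Lemma size_add_exp E v : size (add_exp E v) = (size E + (v \notin E))%N.
Proof. by rewrite /add_exp; case: ifP => _; rewrite ?size_rcons ?addn0 ?addn1. Qed.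

Lemma parked_add E S s s' v : parked E S s -> ~~ S v \/ v \in E ->
  (forall k, array a_parked s' k =
     if (v \notin E) && (k == size E) then 0 else array a_parked s k) ->
  parked (add_exp E v) S s'.
Proof.
move=> pk Sv hpk k; rewrite size_add_exp hpk.
case: (boolP (v \in E)) Sv => vE Sv /=; first by rewrite addn0 /add_exp vE; apply: pk.
rewrite addn1 ltnS leq_eqVlt => /orP[/eqP ->|kE].
  by rewrite eqxx /add_exp (negbTE vE) nth_rcons ltnn eqxx; case: Sv => // /negbTE ->.
by rewrite (ltn_eqF kE) nth_add_exp // pk.
Qed.

Lemma room_for_add n E S m b X v : room_for n E S m b X ->
  (v \notin E -> X (size E) = 0) -> room_for n (add_exp E v) S m b X.
Proof.
move=> h hX; rewrite /add_exp; case: ifP => // /negbT /hX.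
exact: room_for_rcons.
Qed.

(** So the shift needed to reach a free place is at most the number of parked
exponents, which is linear in [n]. *)
Lemma run_le_count (E : seq nat) (S : nat -> bool) (e j : nat) :
  (forall t, S t -> t \in E) -> (forall i, (i < j)%N -> S (e + i)%N) ->
  (j <= count S E)%N.
Proof.
move=> sub run; rewrite -size_filter -[j](size_iota e).
apply: uniq_leq_size; first exact: iota_uniq.
move=> t; rewrite mem_iota mem_filter => /andP[et tj].
have St : S t by have := run (t - e)%N; rewrite subnKC //; apply; lia.
by rewrite St sub.
Qed.

Lemma value_add_exp E v X : (v \notin E -> X (size E) = 0) ->
  value (add_exp E v) X = value E X.
Proof.
rewrite /add_exp; case: (boolP (v \in E)) => // _ /(_ isT) X0.
by rewrite value_rcons X0 mul0r addr0.
Qed.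

(** The two alternatives are the first node, whose exponent 0 is present and
free, and all others, for which 0 is parked and the room for shifts is
large. *)
Lemma place_ok n E L S m b s (p e : nat) :
  state n E L s -> room_for n E S m b (array a_x s) -> parked E S s ->
  rg s r_p = p%:Z -> value E (array a_x s) = e%:Z ->
  (forall k, (size E <= k < 3 * n)%N -> array a_x s k = 0) ->
  (0 < n)%N ->
  [/\ e \in E, ~~ S e & e.+1 \in E] \/
  [/\ size E + 2 <= 3 * n, count S E + 2 <= (b 0).+1 & count S E + 2 <= 3 * n]%N ->
  let s' := den place s in
  exists j E' L' id, [/\ forall i, (i < j)%N -> S (e + i)%N, ~~ S (e + j)%N,
    state n E' L' s' /\ parked E' (park S (e + j)) s',
    [/\ forall k, (k < size E)%N -> nth 0%N E' k = nth 0%N E k,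
        (e + j \in E')%N, ((e + j).+1 \in E')%N & forall t, t \in E -> t \in E'] &
    [/\ (size E <= size E')%N,
        (size E' <= size E + (if [&& e \in E, ~~ S e & e.+1 \in E] then 0 else 2))%N,
        (id < size E')%N, nth 0%N E' id = e &
        forall q, array a_image s' q = if q == p then id%:Z else array a_image s q]].
Proof.
move=> st room pk hp vE Xfresh n0 cases s'.
rewrite /s' /place den_seq; remember (den (r_J ::= #0)%P s) as s0 eqn:s0E.
have st0 : state n E L s0 by rewrite s0E; apply: den_state.
have X0 : ar s0 a_x = ar s a_x by rewrite s0E den_ar.
have J0 : rg s0 r_J = 0%:Z by rewrite s0E rg_let.
have room0 : room_for n E S m b (array a_x s0) by rewrite /array X0.
have vE0 : 0%:Z + value E (array a_x s0) = e%:Z by rewrite add0r -vE /array X0.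
have free1 : e \notin E -> [/\ size E < 3 * n, 0 <= b 0 & 0 < 3 * n]%N.
  by move=> eE; case: cases => [[eE']|[h1 h2 h3]]; [rewrite eE' in eE|split; lia].
rewrite den_seq; have [[L1 st1] J1 pk1] :=
  ensure_ok st0 room0 J0 vE0 (leq0n _) (leq0n _) free1.
have pk1' : parked (add_exp E e) S (den ensure s0).
  apply: (@parked_add _ _ s0) pk1.
    by move=> k kE; rewrite /array s0E den_ar //; apply: pk.
  by case: (boolP (e \in E)) => eE; [right|left; apply: contra eE => /(room_sub room)].
remember (den ensure s0) as s1 eqn:s1E.
set E1 := add_exp E e in st1 pk1' *.
have X1 : ar s1 a_x = ar s a_x by rewrite s1E den_ar.
have sz3 : (size E <= 3 * n)%N := listing_max (state_listing st).
have Xe : e \notin E -> array a_x s1 (size E) = 0.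
  by move=> /free1[h _ _]; rewrite /array X1; apply: Xfresh; rewrite leqnn.
have room1 : room_for n E1 S m b (array a_x s1).
  by apply: room_for_add => //; rewrite /array X1.
have eE1 : e \in E1 by rewrite mem_add_exp eqxx.
have vE1 : value E1 (array a_x s1) = e%:Z.
  by rewrite value_add_exp // -vE /array X1.
rewrite den_seq.
have [_ _ lo2 _] := locate_ok (state_consts st1) (state_listing st1) (state_rows st1)
  room1 J1 ltac:(lia) ltac:(lia).
rewrite add0r vE1 in lo2.
have st2 : state n E1 L1 (den locate s1) by apply: den_state.
have srt1 := listing_sorting (state_listing st1).
have J2 : rg (den locate s1) r_J = 0 by rewrite den_rg.
have p2 : rg (den locate s1) r_p = p%:Z.
  by rewrite den_rg // s1E den_rg // s0E den_rg.
have pk2 : parked E1 S (den locate s1) by move=> k kE; rewrite /array den_ar //; exact: pk1'.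
have X2 : ar (den locate s1) a_x = ar s a_x by rewrite den_ar.
have im2 : ar (den locate s1) a_image = ar s a_image.
  by rewrite den_ar // s1E den_ar // s0E den_ar.
remember (den locate s1) as s2 eqn:s2E.
have [ltE1 eq_e] := below_mem srt1 eE1.
pose id := nth 0%N L1 (below E1 e%:Z).
have idE : (id < size E1)%N by exact: sorting_nth.
rewrite den_seq.
have im3 q : array a_image (den (a_image:[$r_p] ::= a_order@[$r_lo])%P s2) q
    = if q == p then id%:Z else array a_image s q.
  rewrite den_sto /array /= /upd_array /updz /= p2 eqz_nat lo2 im2.
  by rewrite (listing_order (state_listing st2)).
have st3 : state n E1 L1 (den (a_image:[$r_p] ::= a_order@[$r_lo])%P s2) by apply: den_state.
have X3 : ar (den (a_image:[$r_p] ::= a_order@[$r_lo])%P s2) a_x = ar s a_x by rewrite den_ar.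
have pk3 : parked E1 S (den (a_image:[$r_p] ::= a_order@[$r_lo])%P s2).
  by move=> k kE; rewrite /array den_ar //; exact: pk2.
have lo3 : rg (den (a_image:[$r_p] ::= a_order@[$r_lo])%P s2) r_lo = (below E1 e%:Z)%:Z by rewrite den_rg.
have J3 : rg (den (a_image:[$r_p] ::= a_order@[$r_lo])%P s2) r_J = 0 by rewrite den_rg.
remember (den (a_image:[$r_p] ::= a_order@[$r_lo])%P s2) as s3 eqn:s3E.
have [j [run free J4 [u uN [hu nu]]]] := walk_ok st3 pk3 (room_succ room1) eE1 lo3 J3.
have j_cnt : (j <= count S E)%N by apply: run_le_count run; exact: room_sub room.
rewrite den_seq.
have st4 : state n E1 L1 (den walk s3) by apply: den_state.
remember (den walk s3) as s4 eqn:s4E.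
rewrite den_seq; remember (den (r_id ::= a_order@[$r_u])%P s4) as s5 eqn:s5E.
have id5 : rg s5 r_id = (nth 0%N L1 u)%:Z.
  by rewrite s5E rg_let /= hu (listing_order (state_listing st4)).
rewrite den_seq; remember (den (incr r_J) s5) as s6 eqn:s6E.
have st6 : state n E1 L1 s6 by rewrite s6E s5E; do 2!apply: den_state => //.
have X6 : ar s6 a_x = ar s a_x by rewrite s6E den_ar // s5E den_ar // s4E den_ar.
have J6 : rg s6 r_J = j.+1%:Z.
  by rewrite s6E rg_let /= s5E den_rg // J4; lia.
have room6 : room_for n E1 S m b (array a_x s6) by rewrite /array X6 -X1.
have vE6 : j.+1%:Z + value E1 (array a_x s6) = (e + j).+1%:Z.
  have -> : value E1 (array a_x s6) = e%:Z by rewrite -vE1 /array X6 X1.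
  lia.
(* If [e] is free, there is no shift but by one, and [e.+1] is present; otherwise
   the shift is bounded by the number of parked exponents. *)
have [jb [j3 free6]] : (j.+1 <= (b 0).+1)%N /\ (j.+1 <= 3 * n)%N /\
   ((e + j).+1 \notin E1 -> [/\ size E1 < 3 * n, j.+1 <= b 0 & j.+1 < 3 * n]%N).
  case: cases => [[eE Se e1E]|[h1 h2 h3]].
    have j0 : j = 0%N by case: (posnP j) => // /run; rewrite addn0 (negbTE Se).
    by rewrite j0 addn0; split=> //; split; [lia|rewrite mem_add_exp e1E orbT].
  split; first by lia.
  by split; [lia|move=> _; split; rewrite ?size_add_exp; lia].
rewrite den_seq; have [[L7 st7] J7 pk7] := ensure_ok st6 room6 J6 vE6 jb j3 free6.
have id7 : rg (den ensure s6) r_id = (nth 0%N L1 u)%:Z.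
  by rewrite den_rg // s6E den_rg.
have pk6 : parked E1 S s6.
  by move=> k kE; rewrite /array s6E den_ar // s5E den_ar // s4E den_ar //; exact: pk3.
have pk7' : parked (add_exp E1 (e + j).+1) S (den ensure s6).
  apply: (parked_add pk6) pk7.
  case: (boolP (S (e + j).+1)) => S1; [right|by left].
  exact: room_sub room1 _ S1.
have im7 : ar (den ensure s6) a_image = ar s3 a_image.
  by rewrite den_ar // s6E den_ar // s5E den_ar // s4E den_ar.
remember (den ensure s6) as s7 eqn:s7E.
set E2 := add_exp E1 (e + j).+1 in st7 pk7' *.
have le01 : (size E <= size E1)%N by rewrite /E1 size_add_exp; lia.
have le12 : (size E1 <= size E2)%N by rewrite /E2 size_add_exp; lia.
have kuE : (nth 0%N L1 u < size E2)%N by apply: leq_trans le12; exact: sorting_nth.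
have nth2 k : (k < size E1)%N -> nth 0%N E2 k = nth 0%N E1 k by exact: nth_add_exp.
exists j, E2, L7, id; split=> //.
- split; first by apply: den_state.
  move=> k kE; rewrite /array den_sto /= /upd_array /updz /= id7 eqz_nat /park.
  case: eqP => [->|ne].
    by rewrite nth2 ?sorting_nth // -/(nth_exp E1 L1 u) nu eqxx.
  rewrite [LHS]pk7' //; congr (Posz (nat_of_bool _)); case: eqP => // ek.
  case: ne; apply/eqP; rewrite -(nth_uniq 0%N kE kuE)
    ?(sorting_uniq (listing_sorting (state_listing st7))) //.
  by rewrite ek nth2 ?sorting_nth // -/(nth_exp E1 L1 u) nu.
- split.
  + by move=> k kE; rewrite nth2 ?nth_add_exp //; lia.
  + by rewrite mem_add_exp -nu nth_exp_mem ?orbT.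
  + by rewrite mem_add_exp eqxx.
  + by move=> t tE; rewrite !mem_add_exp tE !orbT.
split; [lia| |lia| |].
- rewrite /E2 /E1 !size_add_exp -addnA leq_add2l.
  case: ifP => [/and3P[eE Se e1E]|_]; last by case: (e \notin E); case: (_ \notin _).
  have j0 : j = 0%N by case: (posnP j) => // /run; rewrite addn0 (negbTE Se).
  by rewrite j0 addn0 mem_add_exp e1E eE orbT.
- by rewrite nth2.
by move=> q; rewrite /array den_ar // im7; exact: im3.
Qed.

(** * Reading a node of the input *)

(** A power circuit on [{0, ..., n - 1}], by its matrix of signs and the
exponents of the values of its nodes. *)
Record circuit (n : nat) (d : nat -> nat -> int) (e : nat -> nat) : Prop := Circuit {
  circuit_trit : forall p q, (p < n)%N -> (q < n)%N -> is_trit (d p q);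
  circuit_value : forall p, (p < n)%N ->
    \sum_(q < n) d p q * 2 ^+ e q = (e p)%:Z;
  circuit_acyclic : exists rk : nat -> nat, forall p q, (p < n)%N -> (q < n)%N ->
    d p q != 0 -> (rk q < rk p)%N
}.

Definition input_at (n : nat) (d : nat -> nat -> int) (s : store) : Prop :=
  (forall p q, (p < n)%N -> (q < n)%N -> ar s a_raw (p * n + q)%N%:Z = d p q).

Lemma gather_ok n d p s : consts n s -> input_at n d s ->
  rg s r_p = p%:Z -> (p < n)%N -> ar s a_input p%:Z = (p * n)%N%:Z ->
  forall k, (k < 3 * n)%N -> array a_x (den gather s) k =
    \sum_(q < n | ar s a_image q%:Z == k%:Z) d p q.
Proof.
move=> cst inp hp pn hin k kn.
rewrite /gather den_seq den_let den_seq; set s1 := Store _ _.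
remember (den (Rep r_3n _) s1) as s2 eqn:s2E.
have zero j : (j < 3 * n)%N -> ar s2 a_x j%:Z = 0.
  pose P i s' := rg s' r_i = i%:Z /\ forall j, (j < i)%N -> ar s' a_x j%:Z = 0.
  have : P (3 * n)%N s2.
    rewrite s2E; apply: (den_rep (P := P)); first by rewrite /s1 /= /upd /= (consts_3n cst).
      by [].
    move=> i s' _ _ _ [h1 h2]; rewrite den_seq den_sto; split.
      by rewrite rg_let /= h1; lia.
    move=> i'; rewrite den_ar // ltnS leq_eqVlt /= /upd_array /updz /= h1 eqz_nat.
    by case: eqP => //= _ /h2.
  by case=> _; apply.
have ar2 j : j != a_x -> ar s2 j = ar s j.
  by move=> jx; rewrite s2E den_ar //= inE.
have rg2 r : r != r_i -> rg s2 r = rg s r.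
  by move=> ri; rewrite s2E den_rg ?inE //= /upd (negbTE ri).
rewrite den_seq den_let den_seq den_let; set s3 := Store _ _.
pose P i s' := rg s' r_i = i%:Z /\ forall k, (k < 3 * n)%N ->
   ar s' a_x k%:Z = \sum_(q < i | ar s a_image q%:Z == k%:Z) d p q.
rewrite /array; suff [_ ->//] : P n (den (Rep r_n
    (a_x:[a_image@[$r_i]] ::= a_x@[a_image@[$r_i]] :+ a_raw@[$r_a :+ $r_i] ;;
     incr r_i)%P) s3).
have ra3 : rg s3 r_a = (p * n)%N%:Z.
  by rewrite /s3 /= /upd /= rg2 // ar2 // hp.
apply: (den_rep (P := P)).
- by rewrite /s3 /= /upd /= rg2 // (consts_n cst).
- by split=> // j jn; rewrite big_ord0 /s3 /= zero.
move=> i s' iN fr fa [h1 h2]; rewrite den_seq den_sto.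
have im' : ar s' a_image i%:Z = ar s a_image i%:Z by rewrite fa //= ar2.
have raw' : ar s' a_raw (p * n + i)%N%:Z = d p i by rewrite fa //= ar2 // inp.
have ra' : rg s' r_a = (p * n)%N%:Z by rewrite fr.
split; first by rewrite rg_let /= h1; lia.
move=> j jn; rewrite den_ar // /= /upd_array /updz /= h1 im' ra' -PoszD raw'.
rewrite big_mkcond big_ord_recr -big_mkcond /= eq_sym.
by case: eqP => [->|_]; rewrite h2 // addr0.
Qed.

Lemma value_gather n E (im : nat -> int) (dp : nat -> int) (e : nat -> nat) :
  (forall q, (q < n)%N -> dp q != 0 ->
     exists id, [/\ (id < size E)%N, im q = id%:Z & nth 0%N E id = e q]) ->
  \sum_(k < size E) (\sum_(q < n | im q == k%:Z) dp q) * 2 ^+ nth 0%N E k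
  = \sum_(q < n) dp q * 2 ^+ e q.
Proof.
move=> him.
under eq_bigr do rewrite mulr_suml.
rewrite (exchange_big_dep predT) //=; apply: eq_bigr => q _.
have [->|nz] := eqVneq (dp q) 0; first by rewrite mul0r big1 // => k _; rewrite mul0r.
have [id [idE -> eid]] := him q (ltn_ord q) nz.
rewrite (big_pred1 (Ordinal idE)) /= ?eid // => k.
Qed.

(** Several nodes may have the same exponent; the coefficient is then bounded
by the number of these cars, as [roomy] expects. *)
Lemma gather_le n E (im : nat -> int) (dp : nat -> int) (e : nat -> nat) D k :
  uniq D -> (forall q, (q < n)%N -> is_trit (dp q)) ->
  (forall q, (q < n)%N -> dp q != 0 -> q \in D) ->
  (forall q, q \in D -> exists id, [/\ (id < size E)%N, im q = id%:Z & nth 0%N E id = e q]) ->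
  `|\sum_(q < n | im q == k%:Z) dp q| <= (cars e D (nth 0%N E k))%:Z.
Proof.
move=> uD td sD him.
apply: le_trans (ler_norm_sum _ _ _) _.
rewrite /cars -size_filter.
apply: (@le_trans _ _ (\sum_(q < n | (im q == k%:Z) && ((q : nat) \in D)) (1 : int))).

  rewrite [leLHS](bigID (fun q : 'I_n => (q : nat) \in D)) /=.
  rewrite [X in _ + X]big1 ?addr0; last first.
    move=> q /andP[_ qD]; case: (eqVneq (dp q) 0) => [->|nz]; first by rewrite normr0.
    by rewrite (sD _ (ltn_ord q) nz) in qD.
  by apply: ler_sum => q _; have := td q (ltn_ord q); rewrite /is_trit; lia.
rewrite sumr_const -[leRHS]natz ler_nat.
rewrite cardE -(size_map (@nat_of_ord n)); apply: uniq_leq_size.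
  by rewrite map_inj_uniq; [exact: enum_uniq|exact: ord_inj].
move=> t /mapP[q]; rewrite mem_enum => /andP[/eqP imq qD] ->.
rewrite mem_filter qD andbT.
by have [id [_ ei <-]] := him _ qD; move: ei; rewrite imq => -[->].
Qed.

Lemma count_park (E E' : seq nat) (S : nat -> bool) t : uniq E -> uniq E' ->
  (forall x, S x -> x \in E) -> (forall x, x \in E -> x \in E') ->
  ~~ S t -> t \in E' -> count (park S t) E' = (count S E).+1.
Proof.
move=> uE uE' sub sub' St tE'.
rewrite -!size_filter -[(size _).+1]/(size (t :: filter S E)).
apply/perm_size/uniq_perm; rewrite ?filter_uniq //=.
  by rewrite mem_filter (negbTE St) filter_uniq.
move=> x; rewrite mem_filter inE mem_filter /park.
case: eqP => [->|_] /=; first by rewrite tE'.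
by case: (boolP (S x)) => //= Sx; rewrite sub' ?sub.
Qed.

(** * The order of processing *)

Definition pending (n : nat) (d : nat -> nat -> int) (D : seq nat) (p : nat) : nat :=
  count (fun q => (d p q != 0) && (q \notin D)) (iota 0 n).

(** The first [h] nodes of the queue [Q] are processed, and [Q] contains
exactly the nodes without arcs to an unprocessed node. *)
Record kahn (n : nat) (d : nat -> nat -> int) (h : nat) (Q : seq nat) (s : store) : Prop :=
 Kahn {
  kahn_head : rg s r_head = h%:Z;
  kahn_tail : rg s r_tail = (size Q)%:Z;
  kahn_uniq : uniq Q;
  kahn_lt : forall p, p \in Q -> (p < n)%N;
  kahn_queue : forall i, (i < size Q)%N -> ar s a_queue i%:Z = (nth 0%N Q i)%:Z;
  kahn_deg : forall p, (p < n)%N -> ar s a_deg p%:Z = (pending n d (take h Q) p)%:Z;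
  kahn_mem : forall p, (p < n)%N -> (p \in Q) = (pending n d (take h Q) p == 0%N);
  kahn_input : forall p, (p < n)%N -> ar s a_input p%:Z = (p * n)%N%:Z;
  kahn_raw : input_at n d s
}.

Lemma pending0 n d D p : pending n d D p = 0%N ->
  forall q, (q < n)%N -> d p q != 0 -> q \in D.
Proof.
move=> /eqP; rewrite -leqn0 leqNgt -has_count => /hasPn h q qn nz.
by have := h q; rewrite mem_iota nz /= negbK; apply.
Qed.

(** If the queue were exhausted it would contain, by induction along the arcs,
every node. *)
Lemma kahn_progress n d e h Q s : circuit n d e -> kahn n d h Q s ->
  (h < n)%N -> (h < size Q)%N.
Proof.
move=> crc kh hn; rewrite ltnNge; apply/negP => Qh.
have tQ : take h Q = Q by exact: take_oversize.
have [rk hrk] := circuit_acyclic crc.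
have all_in m p : (rk p < m)%N -> (p < n)%N -> p \in Q.
  elim: m p => // m IH p pm pn; rewrite (kahn_mem kh) // tQ /pending.
  rewrite -leqn0 leqNgt -has_count; apply/hasPn => q; rewrite mem_iota => qn.
  case: (eqVneq (d p q) 0) => //= nz; rewrite negbK.
  by apply: IH => //; apply: leq_trans (hrk _ _ pn qn nz) _.
have : (size (iota 0 n) <= size Q)%N.
  apply: uniq_leq_size; first exact: iota_uniq.
  by move=> p; rewrite mem_iota => pn; apply: (all_in (rk p).+1).
rewrite size_iota; lia.
Qed.

Lemma pending_rcons n d D p r : p \notin D -> (p < n)%N ->
  pending n d D r = (pending n d (rcons D p) r + (d r p != 0)%R)%N.
Proof.
move=> pD pn; rewrite /pending -(cat_take_drop p (iota 0 n)) take_iota drop_iota add0n.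
rewrite (minn_idPl (ltnW pn)) -[(n - p)%N]prednK ?subn_gt0 //= !count_cat /=.
have eq_c l : p \notin l -> count (fun q => (d r q != 0) && (q \notin rcons D p)) l =
    count (fun q => (d r q != 0) && (q \notin D)) l.
  move=> pl; apply: eq_in_count => q ql; rewrite mem_rcons inE negb_or.
  by have -> : q != p by apply: contraNneq pl => <-.
rewrite !eq_c ?mem_iota; try lia.
by rewrite pD mem_rcons inE eqxx andbF andbT; lia.
Qed.

Lemma rg_nonzero e s : rg (den (nonzero e) s) r_z = (nat_of_bool (ev e s != 0))%:Z.
Proof.
rewrite /nonzero den_if; case: ifP => h1; first by rewrite rg_let /=; case: eqP => //; lia.
by rewrite den_if; case: ifP => h2; rewrite rg_let /= in h2 *; case: eqP => //; lia.
Qed.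

Lemma release_ok n d h Q s : consts n s -> kahn n d h Q s -> (h < size Q)%N ->
  rg s r_p = (nth 0%N Q h)%:Z ->
  exists2 Q', kahn n d h.+1 Q' (den release s) &
    take h.+1 Q' = rcons (take h Q) (nth 0%N Q h).
Proof.
move=> cst kh hQ hp; set p := nth 0%N Q h in hp *; set D := take h Q.
have pn : (p < n)%N by apply: (kahn_lt kh); exact: mem_nth.
have pD : p \notin D.
  apply/negP => /(nthP 0%N)[i]; rewrite size_take hQ => ih.
  rewrite nth_take // => /eqP; rewrite nth_uniq ?(kahn_uniq kh) //; first by move/eqP; lia.
  exact: ltn_trans ih hQ.
have split_p r := pending_rcons d r pD pn.
set D' := rcons D p in split_p *.
(* After [i] rounds: the nodes of [R] have been pushed, and the first [i] degrees
   do not count the arcs to [p] any more. *)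
pose P i s' := exists R, [/\ [/\ rg s' r_i = i%:Z & rg s' r_tail = (size (Q ++ R))%:Z],
   uniq R, forall r, (r \in R) = [&& (r < i)%N, d r p != 0 & pending n d D' r == 0%N],
   forall j, (j < size (Q ++ R))%N -> ar s' a_queue j%:Z = (nth 0%N (Q ++ R) j)%:Z &
   forall r, (r < n)%N -> ar s' a_deg r%:Z = (pending n d (if (r < i)%N then D' else D) r)%:Z].
rewrite /release den_seq den_let den_seq; set s1 := Store _ _.
remember (den (Rep r_n _) s1) as s2 eqn:s2E.
have raw1 q : (q < n)%N -> ar s a_raw (ar s a_input q%:Z + p%:Z) = d q p.
  by move=> qn; rewrite (kahn_input kh) // -PoszD (kahn_raw kh).
have [R [[hi ht] uR mR qR dR]] : P n s2.
  rewrite s2E; apply: (den_rep (P := P)).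
  - by rewrite /s1 /= /upd /= (consts_n cst).
  - exists [::]; rewrite cats0; split=> //.
    + by split=> //; rewrite /s1 /= /upd /= (kahn_tail kh).
    + exact: kahn_queue kh.
    + exact: kahn_deg kh.
  move=> i s' iN fr fa [R [[hi ht] uR mR qR dR]].
  rewrite den_seq; remember (den (nonzero _) s') as s3 eqn:s3E.
  have z3 : rg s3 r_z = (nat_of_bool (d i p != 0))%:Z.
    rewrite s3E rg_nonzero /= hi !fa // (_ : rg s' r_p = p%:Z) ?raw1 //.
    by rewrite fr.
  have ar3 : ar s3 = ar s'.
    by rewrite s3E /nonzero !den_if; case: ifP => _; [|case: ifP => _].
  have rg3 r : r != r_z -> rg s3 r = rg s' r.
    by move=> rz; rewrite s3E den_rg //= !inE (negbTE rz).
  have i3 : rg s3 r_i = i%:Z by rewrite rg3.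
  have t3 : rg s3 r_tail = (size (Q ++ R))%:Z by rewrite rg3.
  have deg_i : ar s3 a_deg i%:Z = (pending n d D i)%:Z by rewrite ar3 dR // ltnn.
  have deg_r r : (r < n)%N -> r != i -> ar s3 a_deg r%:Z =
      (pending n d (if (r < i.+1)%N then D' else D) r)%:Z.
    by move=> rn ri; rewrite ar3 dR // ltnS [(r <= i)%N]leq_eqVlt (negbTE ri).
  have mem_S (b : bool) : b = (d i p != 0) && (pending n d D' i == 0%N) ->
      forall r, (r \in (if b then rcons R i else R)) =
        [&& (r < i.+1)%N, d r p != 0 & pending n d D' r == 0%N].
    move=> be r; have -> : (r \in (if b then rcons R i else R)) = (b && (r == i)) || (r \in R).
      by case: b {be} => //; rewrite mem_rcons inE.
    rewrite mR ltnS [(r <= i)%N]leq_eqVlt; case: eqP => [->|_]; rewrite ?andbF //.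
    by rewrite ltnn /= orbF andbT be.
  have iR : i \notin R by rewrite mR ltnn.
  rewrite den_seq den_if [ev _ _]/= z3; case: (boolP (d i p != 0)) => nz /=; last first.
    rewrite den_skip; exists R; split=> //.
    - by split; [rewrite rg_let /= i3; lia|rewrite den_rg].
    - by move=> r; rewrite -(mem_S false) ?(negbTE nz).
    - by move=> j jQ; rewrite den_ar // ar3 qR.
    move=> r rn; rewrite den_ar //; case: (eqVneq r i) => [->|/deg_r]; last exact.
    by rewrite deg_i ltnSn (split_p i) (negbTE nz) addn0.
  rewrite den_seq; remember (den (a_deg:[_] ::= _)%P s3) as s4 eqn:s4E.
  have deg4 r : (r < n)%N -> ar s4 a_deg r%:Z =
      (pending n d (if (r < i.+1)%N then D' else D) r)%:Z.
    move=> rn; rewrite s4E den_sto /= /upd_array /updz /= i3 eqz_nat deg_i.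
    case: (eqVneq r i) => [->|/deg_r]; last exact.
    rewrite ltnSn (split_p i) nz; lia.
  have i4 : rg s4 r_i = i%:Z by rewrite s4E den_rg.
  have t4 : rg s4 r_tail = (size (Q ++ R))%:Z by rewrite s4E den_rg.
  have q4 : ar s4 a_queue = ar s' a_queue by rewrite s4E den_ar // ar3.
  rewrite den_if [ev _ _]/= i4 deg4 // ltnSn ltz_nat.
  case: (posnP (pending n d D' i)) => [z|pos].
    rewrite /push den_seq; remember (den (a_queue:[_] ::= _)%P s4) as s5 eqn:s5E.
    have i5 : rg s5 r_i = i%:Z by rewrite s5E den_rg.
    have t5 : rg s5 r_tail = (size (Q ++ R))%:Z by rewrite s5E den_rg.
    exists (rcons R i); split.
    - split; first by rewrite rg_let /= /upd /= i5; lia.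
      by rewrite den_rg // rg_let /= t5 -rcons_cat size_rcons; lia.
    - by rewrite rcons_uniq iR.
    - by move=> r; rewrite -(mem_S true) ?nz ?z.
    - move=> j; rewrite -rcons_cat size_rcons nth_rcons ltnS leq_eqVlt => jQ.
      rewrite !den_ar // s5E den_sto /= /upd_array /updz /= t4 eqz_nat i4 q4.
      case: eqP jQ => [->|_] /=; first by rewrite ltnn.
      by move=> jQ; rewrite jQ qR.
    by move=> r rn; rewrite !den_ar // s5E den_ar // deg4.
  rewrite den_skip; exists R; split=> //.
  - by split; [rewrite rg_let /= i4; lia|rewrite den_rg].
  - by move=> r; rewrite -(mem_S false) // nz eqn0Ngt pos.
  by move=> j jQ; rewrite den_ar // q4 qR.
have tk : take h.+1 (Q ++ R) = D' by rewrite takel_cat // (take_nth 0%N).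
exists (Q ++ R) => //; split; rewrite ?tk.
- by rewrite rg_let /= s2E den_rg // /s1 /= /upd /= (kahn_head kh); lia.
- by rewrite den_rg.
- rewrite cat_uniq (kahn_uniq kh) uR andbT; apply/hasPn => r; rewrite mR.
  case/and3P=> rn nz _; rewrite (kahn_mem kh) // -/D (split_p r) nz; lia.
- by move=> r; rewrite mem_cat => /orP[/(kahn_lt kh)//|]; rewrite mR => /andP[].
- by move=> j jQ; rewrite den_ar // qR.
- by move=> r rn; rewrite den_ar // dR // rn.
- move=> r rn; rewrite mem_cat (kahn_mem kh) // mR rn -/D (split_p r) /=.
  by case: (d r p != 0) => /=; [rewrite addn1|rewrite addn0 orbF].
- by move=> r rn; rewrite den_ar // s2E den_ar // (kahn_input kh).
move=> r q rn qn; rewrite den_ar // s2E den_ar //; exact: (kahn_raw kh).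
Qed.

(** * Processing one node *)

(** The state of the construction when the cars of the nodes of [D] are
parked.  The bound on the size is [n + 2] before the first node and after it,
and grows by two with every further node. *)
Record placed (n : nat) (e : nat -> nat) (D E L : seq nat) (S : nat -> bool)
    (b : nat -> nat) (s : store) : Prop := Placed {
  placed_state : state n E L s;
  placed_parked : parked E S s;
  placed_parking : parking n e D S b;
  placed_sub : forall t, S t -> t \in E;
  placed_succ : forall t, S t -> t.+1 \in E;
  placed_image : forall q, q \in D -> exists id,
    [/\ (id < size E)%N, ar s a_image q%:Z = id%:Z & nth 0%N E id = e q];
  placed_size : (size E <= n + 2 * maxn (size D) 1)%N;
  placed_count : count S E = (n + size D)%N;
  placed_zero : S 0%N = (0 < size D)%N;
  placed_one : 1%N \in E;
  placed_repr : forall c : nat -> int, (forall q, is_trit (c q)) -> exists g,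
    represents S (\sum_(q <- D) c q * 2 ^+ e q) (\sum_(q <- D) `|c q|)%N g
}.

Lemma den_kahn n d h Q c s : kahn n d h Q s ->
  all (fun r => r \notin assigned c) [:: r_head; r_tail] ->
  all (fun j => j \notin stored c) [:: a_queue; a_deg; a_input; a_raw] ->
  kahn n d h Q (den c s).
Proof.
move=> [h1 h2 h3 h4 h5 h6 h7 h8 h9] /and3P[e1 e2 _] /and5P[e3 e4 e5 e6 _].
by split; rewrite /input_at ?den_rg ?den_ar.
Qed.

Lemma den_placed n e D E L S b c s : placed n e D E L S b s ->
  all (fun r => r \notin assigned c) [:: r_n; r_3n; r_6n; r_size] ->
  all (fun j => j \notin stored c) [:: a_half; a_row; a_order; a_bit; a_digits] ->
  all (fun j => j \notin stored c) [:: a_parked; a_image] ->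
  placed n e D E L S b (den c s).
Proof.
move=> [h1 h2 h3 h4 h5 h6 h7 h8 h9 h10 h11] e1 e2 /and3P[e3 e4 _].
split=> //; first exact: den_state.
  by move=> k kE; rewrite /array den_ar //; exact: h2.
by move=> q qD; rewrite den_ar //; exact: h6.
Qed.

(** The first node has no arcs, hence exponent 0, where it parks at once,
with no new exponent; for all others [parking_zero] gives the room for
shifts, as [2 ^ n] exceeds [n]. *)
Lemma place_step n d e D E L S b s p : circuit n d e ->
  placed n e D E L S b s -> input_at n d s -> (p < n)%N -> p \notin D ->
  uniq D -> (forall q, q \in D -> (q < n)%N) ->
  (forall q, (q < n)%N -> d p q != 0 -> q \in D) ->
  rg s r_p = p%:Z -> ar s a_input p%:Z = (p * n)%N%:Z ->
  exists E' L' S' b', placed n e (p :: D) E' L' S' b' (den place (den gather s)).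
Proof.
move=> crc plc inp pn pD uD ltD arcs hp hin.
have [st pk prk sub succ im sz cnt zero one repr] := plc.
have n0 : (0 < n)%N by exact: leq_ltn_trans pn.
have hX := gather_ok (state_consts st) inp hp pn hin.
have E3 := listing_max (state_listing st).
have szD : (size D < n)%N.
  rewrite -(size_iota 0 n); apply: (@uniq_leq_size _ (p :: D)); first by rewrite /= pD.
  by move=> q; rewrite inE mem_iota => /orP[/eqP ->|/ltD].
have td q : (q < n)%N -> is_trit (d p q) by move=> qn; apply: circuit_trit crc _ _ pn qn.
have im' q : (q < n)%N -> d p q != 0 -> exists id,
    [/\ (id < size E)%N, ar s a_image q%:Z = id%:Z & nth 0%N E id = e q].
  by move=> qn nz; apply: im; apply: arcs.
have st1 : state n E L (den gather s) by apply: den_state.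
have p1 : rg (den gather s) r_p = p%:Z by rewrite den_rg.
have pk1 : parked E S (den gather s) by move=> k kE; rewrite /array den_ar //; apply: pk.
have vX : value E (array a_x (den gather s)) = (e p)%:Z.
  rewrite -(circuit_value crc pn) -(@value_gather n E (fun q => ar s a_image q) _ _ im').
  by apply: eq_bigr => k _; rewrite hX //; have := ltn_ord k; lia.
have im1 : ar (den gather s) a_image = ar s a_image by rewrite den_ar.
remember (den gather s) as s1 eqn:s1E.
have cars_le t : (cars e D t <= n)%N by rewrite (leq_trans (count_size _ _)) // ltnW.
have le_cars k : (k < size E)%N ->
    `|array a_x s1 k| <= (cars e D (nth 0%N E k))%:Z.
  move=> kE; rewrite hX; last by lia.
  exact: (@gather_le n E (fun q => ar s a_image q) (d p) e).
have room : room_for n E S (cars e D) b (array a_x s1).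
  split=> //; first exact: parking_room prk.
  by move=> k kE; apply: le_trans (le_cars k kE) _; rewrite lez_nat.
have fresh k : (size E <= k < 3 * n)%N -> array a_x s1 k = 0.
  move=> /andP[Ek kn]; rewrite hX // big1 // => q /eqP imq.
  have [//|nz] := eqVneq (d p q) 0.
  have [id [idE ei _]] := im' q (ltn_ord q) nz.
  by move: ei; rewrite imq => -[kid]; lia.
have first_car : size D = 0%N -> [/\ e p = 0, e p \in E, ~~ S (e p) & (e p).+1 \in E]%N.
  move=> D0; have ep : e p = 0%N.
    have := circuit_value crc pn; rewrite big1 => [[]//|q _].
    have [->|/(arcs _ (ltn_ord q))] := eqVneq (d p q) 0; first by rewrite mul0r.
    by move/size0nil: D0 => ->.
  by rewrite ep (listing_zero (state_listing st)) one zero D0.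
have cases : [/\ e p \in E, ~~ S (e p) & (e p).+1 \in E] \/
  [/\ size E + 2 <= 3 * n, count S E + 2 <= (b 0).+1 & count S E + 2 <= 3 * n]%N.
  case: (posnP (size D)) => D0; first by case: (first_car D0) => _ h1 h2 h3; left.
  right; rewrite cnt; have := parking_zero prk; rewrite zero D0 => /(_ isT).
  have := ltn_expl n (ltnSn 1); rewrite expnS.
  move: (2 ^ n)%N (size D) (b 0%N) (size E) D0 szD sz => x sD b0 sE; clear.
  by move=> *; split; lia.
have [j [E' [L' [id [run free [st' pk'] [nthE inE1 inE2 subE] [le1 le2 idE eid im2]]]]]] :=
  place_ok st1 room pk1 p1 vX fresh n0 cases.
have [b' prk'] := parking_park prk run free.
have uE : uniq E := sorting_uniq (listing_sorting (state_listing st)).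
have uE' : uniq E' := sorting_uniq (listing_sorting (state_listing st')).
exists E', L', (park S (e p + j)), b'; split=> //.
- by move=> t; rewrite /park => /orP[/eqP ->//|/sub/subE].
- by move=> t; rewrite /park => /orP[/eqP ->//|/succ/subE].
- move=> q; rewrite inE; have := im2 q; rewrite /array => ->.
  case: eqP => [->|_] /=; first by exists id.
  move=> /im[id' [h1 h2 h3]]; exists id'; rewrite im1 nthE //; split=> //.
  exact: leq_trans le1.
- move: le2 sz; rewrite /=; case: (posnP (size D)) => D0.
    by have [_ -> -> ->] := first_car D0; rewrite D0 addn0; apply: leq_trans.
  move=> le2 sz; have {le2} : (size E' <= size E + 2)%N.
    by apply: leq_trans le2 _; rewrite leq_add2l; case: ifP.
  by move: (size D) (size E) (size E') D0 sz => sD sE sE'; clear; lia.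
- by rewrite (count_park uE uE') // cnt addnS.
- rewrite /park zero /=; case: (posnP (size D)) => D0; last by rewrite orbT.
  have [ep _ Se _] := first_car D0.
  have j0 : j = 0%N by case: (posnP j) => // /run; rewrite addn0 (negbTE Se).
  by rewrite ep j0.
- exact: subE.
move=> c tc; have [g rg_] := repr c tc.
have [g' rg'] := represents_park rg_ (tc p) run free.
by exists g'; rewrite !big_cons addrC [(_ + \sum_(_ <- _) _)%N]addnC.
Qed.

Definition main_inv (n : nat) (d : nat -> nat -> int) (e : nat -> nat) (h : nat)
    (s : store) : Prop :=
  exists Q E L S b, [/\ kahn n d h Q s, (h <= size Q)%N &
    placed n e (rev (take h Q)) E L S b s].

Lemma process_ok n d e h s : circuit n d e -> (h < n)%N ->
  main_inv n d e h s -> main_inv n d e h.+1 (den process s).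
Proof.
move=> crc hn [Q [E [L [S [b [kh _ plc]]]]]].
have hQ := kahn_progress crc kh hn.
rewrite /process den_seq; remember (den (r_p ::= a_queue@[$r_head])%P s) as s1 eqn:s1E.
set p := nth 0%N Q h.
have p1 : rg s1 r_p = p%:Z by rewrite s1E rg_let /= (kahn_head kh) (kahn_queue kh).
have kh1 : kahn n d h Q s1 by rewrite s1E; apply: den_kahn.
have plc1 : placed n e (rev (take h Q)) E L S b s1 by rewrite s1E; apply: den_placed.
have pQ : p \in Q by exact: mem_nth.
have pn := kahn_lt kh pQ.
have pD : p \notin take h Q.
  apply/negP => /(nthP 0%N)[i]; rewrite size_take hQ => ih.
  rewrite nth_take // => /eqP; rewrite nth_uniq ?(kahn_uniq kh) //; first by move/eqP; lia.
  exact: ltn_trans ih hQ.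
have arcs : forall q, (q < n)%N -> d p q != 0 -> q \in take h Q.
  by apply: pending0; apply/eqP; rewrite -(kahn_mem kh pn).
have [E' [L' [S' [b' plc2]]]] : exists E' L' S' b',
    placed n e (p :: rev (take h Q)) E' L' S' b' (den place (den gather s1)).
  apply: (place_step crc plc1 (kahn_raw kh1)) => //.
  - by rewrite mem_rev.
  - by rewrite rev_uniq take_uniq // (kahn_uniq kh).
  - by move=> q; rewrite mem_rev => /mem_take; exact: kahn_lt kh q.
  - by move=> q qn nz; rewrite mem_rev arcs.
  - exact: kahn_input kh1 _ pn.
rewrite den_seq den_seq.
have kh2 : kahn n d h Q (den place (den gather s1)) by do 2!apply: den_kahn => //.
have p2 : rg (den place (den gather s1)) r_p = p%:Z by rewrite !den_rg.
remember (den place (den gather s1)) as s2 eqn:s2E.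
have cst2 := state_consts (placed_state plc2).
have [Q' kh3 tQ] := release_ok cst2 kh2 hQ p2.
exists Q', E', L', S', b'; split=> //; last by rewrite tQ rev_rcons; exact: den_placed.
have := congr1 size tQ; rewrite size_rcons !size_take hQ.
by case: ifP => [/ltnW|_ ->].
Qed.

(** * The initial chain *)

Lemma halves_ok n s : (0 < n)%N -> rg s r_6n = (6 * n)%N%:Z ->
  forall y, `|y| <= (8 * n)%N%:Z -> ar (den halves s) a_half y = halfz y.
Proof.
move=> n0 h6 y hy.
pose P (k : nat) s' := rg s' r_k = k%:Z /\
  forall y, 2 - (2 * k)%N%:Z <= y <= (2 * k)%N%:Z - 1 -> ar s' a_half y = halfz y.
have : P (6 * n)%N (den halves s).
  rewrite /halves den_seq den_let; set s1 := Store _ _.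
  apply: (den_rep (P := P)); first by rewrite /s1 /= /upd /= h6.
    by split=> // z; lia.
  move=> i s2 _ _ _ [hi hH]; rewrite den_seq den_sto den_seq den_sto den_seq den_sto.
  rewrite den_seq den_sto; split; first by rewrite rg_let /= hi; lia.
  move=> z hz; rewrite den_ar //= /upd_array /updz /= hi.
  case: eqP => z1; first by rewrite /halfz; lia.
  case: eqP => z2; first by rewrite /halfz; lia.
  case: eqP => z3; first by rewrite /halfz; lia.
  case: eqP => z4; first by rewrite /halfz; lia.
  by apply: hH; lia.
by case=> _; apply; lia.
Qed.

Definition start_exps (n : nat) : seq nat := iota 0 (n + 2).

Lemma nth_start n k : (k < n + 2)%N -> nth 0%N (start_exps n) k = k.
Proof. by move=> kn; rewrite nth_iota. Qed.

Lemma sorting_start n : sorting (start_exps n) (start_exps n).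
Proof.
split; rewrite ?iota_uniq ?size_iota //.
rewrite (_ : map _ _ = start_exps n) ?iota_ltn_sorted //.
rewrite -[RHS]map_id; apply/eq_in_map => k; rewrite mem_iota => kn.
by rewrite nth_start.
Qed.

Lemma count_start n : count (fun t => 0 < t <= n)%N (start_exps n) = n.
Proof.
rewrite /start_exps (_ : n + 2 = 1 + (n + 1))%N; last by lia.
rewrite 2!iotaD !count_cat /= add0n add1n ltnn !addn0 add0n.
rewrite (@eq_in_count _ _ predT) ?count_predT ?size_iota // => t.
by rewrite mem_iota => /andP[h1 h2]; rewrite h1 /=; lia.
Qed.

Definition chain_layout : cmd :=
  (a_row:[$r_i] ::= $r_a ;; r_a ::= $r_a :+ $r_3n ;;
    a_order:[$r_i] ::= $r_i ;;
    If ($r_size :- $r_i :- #1)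
       (a_bit:[$r_i] ::= #1 ;;
        If $r_i (a_parked:[$r_i] ::= #1) (a_parked:[$r_i] ::= #0))
       (a_bit:[$r_i] ::= #0 ;; a_parked:[$r_i] ::= #0) ;;
    incr r_i)%P.

Lemma layout_ok n N s : rg s r_size = N%:Z -> rg s r_3n = (3 * n)%N%:Z ->
  rg s r_i = 0 -> rg s r_a = 0 ->
  forall j, (j < 3 * n)%N -> let s' := den (Rep r_3n chain_layout) s in
  [/\ ar s' a_row j%:Z = (j * (3 * n))%N%:Z, ar s' a_order j%:Z = j%:Z,
      ar s' a_bit j%:Z = (nat_of_bool (j.+1 < N)%N)%:Z &
      ar s' a_parked j%:Z = (nat_of_bool ((0 < j) && (j.+1 < N))%N)%:Z].
Proof.
move=> hsz h3 hi ha j jn s'.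
pose P (i : nat) s' := [/\ rg s' r_i = i%:Z, rg s' r_a = (i * (3 * n))%N%:Z &
  forall j, (j < i)%N ->
  [/\ ar s' a_row j%:Z = (j * (3 * n))%N%:Z, ar s' a_order j%:Z = j%:Z,
      ar s' a_bit j%:Z = (nat_of_bool (j.+1 < N)%N)%:Z &
      ar s' a_parked j%:Z = (nat_of_bool ((0 < j) && (j.+1 < N))%N)%:Z]].
suff [_ _] : P (3 * n)%N s' by apply.
apply: (den_rep (P := P)); rewrite ?h3 //.
move=> i s1 _ fr _ [h1 h2 hP].
have sz1 : rg s1 r_size = N%:Z by rewrite fr.
have n1 : rg s1 r_3n = (3 * n)%N%:Z by rewrite fr.
rewrite /chain_layout den_seq; remember (den (a_row:[_] ::= _)%P s1) as s2 eqn:s2E.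
rewrite den_seq; remember (den (r_a ::= _)%P s2) as s3 eqn:s3E.
rewrite den_seq; remember (den (a_order:[_] ::= _)%P s3) as s4 eqn:s4E.
have i4 : rg s4 r_i = i%:Z by rewrite s4E den_rg // s3E den_rg // s2E den_rg.
have sz4 : rg s4 r_size = N%:Z by rewrite s4E den_rg // s3E den_rg // s2E den_rg.
have row4 k : ar s4 a_row k = if k == i%:Z then (i * (3 * n))%N%:Z else ar s1 a_row k.
  by rewrite s4E den_ar // s3E den_ar // s2E den_sto /= /upd_array /updz /= h1 h2.
have ord4 k : ar s4 a_order k = if k == i%:Z then i%:Z else ar s1 a_order k.
  have i3 : rg s3 r_i = i%:Z by rewrite s3E den_rg // s2E den_rg.
  rewrite s4E den_sto /= /upd_array /updz /= i3.
  by case: ifP => // _; rewrite s3E den_ar // s2E den_ar.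
have bit4 : ar s4 a_bit = ar s1 a_bit by rewrite s4E den_ar // s3E den_ar // s2E den_ar.
have pk4 : ar s4 a_parked = ar s1 a_parked.
  by rewrite s4E den_ar // s3E den_ar // s2E den_ar.
have a4 : rg s4 r_a = (i.+1 * (3 * n))%N%:Z.
  by rewrite s4E den_rg // s3E rg_let /= s2E !den_rg // h2 n1 mulSn; lia.
rewrite den_seq; remember (den (If _ _ _) s4) as s5 eqn:s5E.
have row5 : ar s5 a_row = ar s4 a_row by rewrite s5E den_ar.
have ord5 : ar s5 a_order = ar s4 a_order by rewrite s5E den_ar.
have i5 : rg s5 r_i = i%:Z by rewrite s5E den_rg.
have a5 : rg s5 r_a = (i.+1 * (3 * n))%N%:Z by rewrite s5E den_rg.
have [bit5 pk5] : (forall k, ar s5 a_bit k = if k == i%:Z then (nat_of_bool (i.+1 < N)%N)%:Z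
     else ar s1 a_bit k) /\ (forall k, ar s5 a_parked k =
       if k == i%:Z then (nat_of_bool ((0 < i) && (i.+1 < N))%N)%:Z else ar s1 a_parked k).
  rewrite s5E den_if [ev _ _]/= sz4 i4 (_ : (0 < N%:Z - i%:Z - 1) = (i.+1 < N)%N); last by lia.
  case: ltnP => iN; rewrite den_seq den_sto /= ?den_if /= ?i4; last first.
    by split=> k; rewrite /= ?den_sto /= /upd_array /updz /= ?i4 ?andbF ?bit4 ?pk4.
  rewrite ltz_nat; case: posnP => _; split=> k;
    by rewrite ?den_sto /= /upd_array /updz /= ?i4 ?bit4 ?pk4.
split; [by rewrite rg_let /= i5; lia|by rewrite den_rg|].
move=> k; rewrite ltnS leq_eqVlt !den_ar // row5 ord5 row4 ord4 bit5 pk5 eqz_nat.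
by case: eqP => [->|_ /= /hP].
Qed.

(** The rows of the chain are produced by normalizing the numbers
[0, ..., n + 1] as shifts of the zero marking.  Here all of [0, ..., n] may
carry, as every successor is in the list. *)
Lemma chain_ok n s : (0 < n)%N ->
  rg s r_n = n%:Z -> rg s r_3n = (3 * n)%N%:Z -> rg s r_6n = (6 * n)%N%:Z ->
  (forall y, `|y| <= (8 * n)%N%:Z -> ar s a_half y = halfz y) ->
  (forall k, ar s a_x k = 0) -> (forall k, ar s a_digits k = 0) ->
  let s' := den chain s in let E := start_exps n in
  state n E E s' /\ parked E (fun t => 0 < t <= n)%N s'.
Proof.
move=> n0 h1 h3 h6 hH hX hD s' E.
rewrite /s' /chain den_seq; remember (den (If _ _ _) s) as s1 eqn:s1E.
have sz1 : rg s1 r_size = (n + 2)%N%:Z.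
  by rewrite s1E den_if /= h1 ltz_nat n0 rg_let /= h1.
rewrite den_seq; remember (den (r_i ::= _)%P s1) as s2 eqn:s2E.
rewrite den_seq; remember (den (r_a ::= _)%P s2) as s3 eqn:s3E.
rewrite den_seq -/chain_layout.
have fr3 r : r \notin [:: r_size; r_i; r_a] -> rg s3 r = rg s r.
  rewrite !inE !negb_or => /and3P[e1 e2 e3].
  by rewrite s3E den_rg ?inE // s2E den_rg ?inE // s1E den_rg //= !inE (negbTE e1).
have sz3 : rg s3 r_size = (n + 2)%N%:Z by rewrite s3E den_rg // s2E den_rg.
have i3 : rg s3 r_i = 0 by rewrite s3E den_rg // s2E rg_let.
have a3 : rg s3 r_a = 0 by rewrite s3E rg_let.
have n3 : rg s3 r_3n = (3 * n)%N%:Z by rewrite fr3.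
have lay := layout_ok sz3 n3 i3 a3.
have ar3 j : ar s3 j = ar s j by rewrite s3E den_ar // s2E den_ar // s1E den_ar.
remember (den (Rep r_3n chain_layout) s3) as s4 eqn:s4E.
have cst4 : consts n s4.
  split; rewrite ?s4E ?den_rg ?fr3 // => y hy; first by rewrite den_ar // ar3 hH.
  by rewrite -s4E; have [] := lay _ hy.
have lst4 : listing n E E s4.
  split.
  - by rewrite s4E den_rg // sz3 size_iota.
  - by rewrite size_iota; lia.
  - exact: sorting_start.
  - by rewrite mem_iota; lia.
  - move=> i; rewrite size_iota => iN; rewrite nth_start //.
    by have [|_ -> _ _] := lay i; lia.
  move=> k; rewrite size_iota => kN; rewrite nth_start // mem_iota.
  by have [|_ _ -> _] := lay k; [lia|].
have pk4 : parked E (fun t => 0 < t <= n)%N s4.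
  move=> k; rewrite size_iota => kN; rewrite nth_start //.
  have [|_ _ _] := lay k; first by lia.
  by rewrite /array => ->; congr (Posz (nat_of_bool _)); lia.
have X4 : ar s4 a_x = ar s a_x by rewrite s4E den_ar // ar3.
have D4 : ar s4 a_digits = ar s a_digits by rewrite s4E den_ar // ar3.
rewrite den_seq; remember (den (r_J ::= _)%P s4) as s5 eqn:s5E.
pose P (J : nat) s' := [/\ rg s' r_J = J%:Z,
  forall id, (id < J)%N -> compact E (row n s' id) /\ value E (row n s' id) = id%:Z &
  forall id k, (id < 3 * n)%N -> (size E <= k < 3 * n)%N -> row n s' id k = 0].
have [J6 rows6 fresh6] : P (n + 2)%N (den (Rep r_3n (When ($r_size :- $r_J)
    (normalize ;; r_row ::= $r_J ;; copy_row ;; incr r_J)%P)%P) s5).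
  apply: (den_upto (P := P) (k := (3 * n)%N)).
  - by rewrite s5E den_rg // s4E den_rg // fr3 // h3.
  - by lia.
  - split; first by rewrite s5E rg_let.
      by [].
    by move=> id k _ _; rewrite /row s5E den_ar // D4 hD.
  - move=> J s6 JN fr fa [hJ hrows hfresh].
    have sz6 : rg s6 r_size = (n + 2)%N%:Z by rewrite fr // s5E den_rg // s4E den_rg.
    split; first by rewrite /= sz6 hJ; lia.
    have cst6 : consts n s6.
      have [e1 e2 e3 e4 e5] := cst4.
      by split; rewrite ?fr ?fa // s5E ?den_rg ?den_ar.
    have lst6 : listing n E E s6.
      have [e1 e2 e3 e4 e5 e6] := lst4.
      by split; rewrite ?fr ?fa // s5E ?den_rg ?den_ar.
    have room : room_for n E (fun t => t <= n)%N (fun=> 0)%N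
        (fun t => (2 ^ (n.+1 - t)).-1)%N (array a_x s6).
      have x0 k : array a_x s6 k = 0 by rewrite /array fa // s5E den_ar // X4 hX.
      split; first exact: roomy_start.
      - by move=> t; rewrite mem_iota; lia.
      - by move=> t; rewrite mem_iota; lia.
      - by move=> k _; rewrite x0 normr0.
      by move=> k _; rewrite x0 normr0.
    have pow : (n.+2 <= 2 ^ n.+1)%N := ltn_expl n.+1 (ltnSn 1).
    have [||cw vw] := normalize_ok cst6 lst6 room hJ.
    + by rewrite subn0; move: (2 ^ n.+1)%N pow JN => x; clear; lia.
    + by move: JN n0; clear; lia.
    have vX : value E (array a_x s6) = 0.
      rewrite /value big1 // => k _.
      by rewrite /array fa // s5E den_ar // X4 hX mul0r.
    rewrite vX addr0 in vw.
    have dig7 : ar (den normalize s6) a_digits = ar s6 a_digits by rewrite den_ar.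
    have J7 : rg (den normalize s6) r_J = J%:Z by rewrite den_rg.
    have sz7 : rg (den normalize s6) r_size = (n + 2)%N%:Z by rewrite den_rg.
    have cst7 : consts n (den normalize s6) by apply: den_consts.
    rewrite den_seq; remember (den normalize s6) as s7 eqn:s7E.
    rewrite den_seq; remember (den (r_row ::= _)%P s7) as s8 eqn:s8E.
    have cst8 : consts n s8 by rewrite s8E; apply: den_consts.
    have sz8 : rg s8 r_size = (n + 2)%N%:Z by rewrite s8E den_rg.
    have row8 : rg s8 r_row = J%:Z by rewrite s8E rg_let.
    have J8 : rg s8 r_J = J%:Z by rewrite s8E den_rg.
    have N3 : (n + 2 <= 3 * n)%N by lia.
    have Jn : (J < 3 * n)%N by lia.
    have cp := copy_row_ok cst8 sz8 N3 row8 Jn.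
    have cand8 : array a_cand s8 = array a_cand s7 by rewrite /array s8E den_ar.
    have dig8 id k : row n s8 id k = row n s6 id k by rewrite /row s8E den_ar // dig7.
    rewrite den_seq; remember (den copy_row s8) as s9 eqn:s9E.
    have J9 : rg s9 r_J = J%:Z by rewrite s9E den_rg.
    have row9 id : row n (den (incr r_J) s9) id = row n s9 id by rewrite /row den_ar.
    have szE : size E = (n + 2)%N by rewrite size_iota.
    split; first by rewrite rg_let /= J9; lia.
      move=> id; rewrite ltnS leq_eqVlt row9 => /orP[/eqP ->|idJ].
        have eqr k : (k < size E)%N -> array a_cand s7 k = row n s9 J k.
          by rewrite szE => kN; rewrite cp ?eqxx ?kN ?cand8 //; lia.
        by split; [exact: eq_compact eqr cw|rewrite -(eq_value eqr)].
      have eqr k : (k < size E)%N -> row n s6 id k = row n s9 id k.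
        by rewrite szE => kN; rewrite cp ?(ltn_eqF idJ) ?dig8 //; lia.
      have [c v] := hrows id idJ.
      by split; [exact: eq_compact eqr c|rewrite -(eq_value eqr)].
    move=> id k idn kn; rewrite row9 cp //; last by case/andP: kn.
    by rewrite -szE ltnNge (andP kn).1 andbF dig8 hfresh.
  move=> s6 fr fa [hJ _ _]; rewrite /= hJ fr // s5E den_rg // s4E den_rg // sz3.
  by rewrite subrr.
split.
  split.
  - by rewrite s5E; do 2!apply: den_consts => //.
  - by rewrite s5E; do 2!apply: den_listing => //.
  split; rewrite ?size_iota //.
  - by move=> id idN; case: (rows6 id idN).
  - by move=> id idN; rewrite nth_start //; case: (rows6 id idN).
  by rewrite -[(n + 2)%N](size_iota 0); exact: fresh6.
move=> k kE; rewrite /array den_ar // s5E den_ar //; exact: pk4.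
Qed.

(** * From the input to the complete list of exponents *)

Lemma sinks_ok n d s : rg s r_n = n%:Z -> input_at n d s ->
  (forall k, ar s a_deg k = 0) -> exists Q, kahn n d 0 Q (den sinks s).
Proof.
move=> hn inp hdeg.
rewrite /sinks den_seq; remember (den (r_i ::= _)%P s) as s1 eqn:s1E.
rewrite den_seq; remember (den (r_a ::= _)%P s1) as s2 eqn:s2E.
rewrite den_seq; remember (den (r_head ::= _)%P s2) as s3 eqn:s3E.
rewrite den_seq; remember (den (r_tail ::= _)%P s3) as s4 eqn:s4E.
have ar4 : ar s4 = ar s by rewrite s4E s3E s2E s1E.
have n4 : rg s4 r_n = n%:Z.
  by rewrite s4E den_rg // s3E den_rg // s2E den_rg // s1E den_rg.
have i4 : rg s4 r_i = 0 by rewrite s4E den_rg // s3E den_rg // s2E den_rg // s1E rg_let.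
have a4 : rg s4 r_a = 0 by rewrite s4E den_rg // s3E den_rg // s2E rg_let.
have h4 : rg s4 r_head = 0 by rewrite s4E den_rg // s3E rg_let.
have t4 : rg s4 r_tail = 0 by rewrite s4E rg_let.
pose P (i : nat) s' := exists Q, [/\ [/\ rg s' r_i = i%:Z, rg s' r_a = (i * n)%N%:Z &
   rg s' r_tail = (size Q)%:Z], uniq Q,
   forall p, (p \in Q) = (p < i)%N && (pending n d [::] p == 0%N),
   forall j, (j < size Q)%N -> ar s' a_queue j%:Z = (nth 0%N Q j)%:Z &
   (forall p, ar s' a_deg p%:Z = (if (p < i)%N then pending n d [::] p else 0%N)%:Z) /\
   (forall p, (p < i)%N -> ar s' a_input p%:Z = (p * n)%N%:Z)].
remember (den (Rep r_n _) s4) as s5 eqn:s5E.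
have [Q [[i5 _ t5] uQ mQ qQ [dQ iQ]]] : P n s5.
  rewrite s5E; apply: (den_rep (P := P)); first by rewrite n4.
    exists [::]; split=> //.
    by split=> // p; rewrite ar4 hdeg.
  move=> i s6 iN fr fa [Q [[i6 a6 t6] uQ mQ qQ [dQ iQ]]].
  have n6 : rg s6 r_n = n%:Z by rewrite fr.
  have raw6 : ar s6 a_raw = ar s a_raw by rewrite fa // ar4.
  rewrite den_seq; remember (den (a_input:[_] ::= _)%P s6) as s7 eqn:s7E.
  rewrite den_seq; remember (den (r_q ::= _)%P s7) as s8 eqn:s8E.
  have rg8 r : r != r_q -> rg s8 r = rg s6 r.
    by move=> rq; rewrite s8E den_rg ?inE // s7E den_rg.
  have inp8 k : ar s8 a_input k = if k == i%:Z then (i * n)%N%:Z else ar s6 a_input k.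
    by rewrite s8E den_ar // s7E den_sto /= /upd_array /updz /= i6 a6.
  have ar8 j : j != a_input -> ar s8 j = ar s6 j.
    by move=> ja; rewrite s8E den_ar // s7E den_ar //= inE.
  rewrite den_seq; remember (den (Rep r_n _) s8) as s9 eqn:s9E.
  pose T (q : nat) s' := rg s' r_q = q%:Z /\ forall k, ar s' a_deg k =
     if k == i%:Z then (count (fun q => (d i q != 0) && (q \notin [::])) (iota 0 q))%:Z
     else ar s6 a_deg k.
  have [_ deg9] : T n s9.
    rewrite s9E; apply: (den_rep (P := T)); first by rewrite rg8 // n6.
      split; first by rewrite s8E rg_let.
      by move=> k; rewrite ar8 //; case: eqP => // ->; rewrite dQ ltnn.
    move=> q s10 qn fr' fa' [q10 d10].
    have i10 : rg s10 r_i = i%:Z by rewrite fr' // rg8.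
    have a10 : rg s10 r_a = (i * n)%N%:Z by rewrite fr' // rg8.
    have raw10 : ar s10 a_raw = ar s a_raw by rewrite fa' // ar8 // raw6.
    rewrite den_seq; remember (den (nonzero _) s10) as s11 eqn:s11E.
    have z11 : rg s11 r_z = (nat_of_bool (d i q != 0))%:Z.
      by rewrite s11E rg_nonzero /= a10 q10 raw10 -PoszD inp.
    have i11 : rg s11 r_i = i%:Z by rewrite s11E den_rg.
    have q11 : rg s11 r_q = q%:Z by rewrite s11E den_rg.
    have d11 : ar s11 a_deg = ar s10 a_deg by rewrite s11E den_ar.
    rewrite den_seq; split; first by rewrite rg_let /= q11; lia.
    move=> k; rewrite den_ar // -[q.+1]addn1 iotaD count_cat add0n.
    rewrite den_sto /= /upd_array /updz /= i11 d11 z11 !d10 eqxx.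
    by case: eqP => // _; rewrite andbT addn0.
  have i9 : rg s9 r_i = i%:Z by rewrite s9E den_rg // rg8.
  have a9 : rg s9 r_a = (i * n)%N%:Z by rewrite s9E den_rg // rg8.
  have n9 : rg s9 r_n = n%:Z by rewrite s9E den_rg // rg8.
  have t9 : rg s9 r_tail = (size Q)%:Z by rewrite s9E den_rg // rg8.
  have q9 : ar s9 a_queue = ar s6 a_queue by rewrite s9E den_ar // ar8.
  have inp9 : ar s9 a_input = ar s8 a_input by rewrite s9E den_ar.
  have deg9' p : ar s9 a_deg p%:Z = (if (p < i.+1)%N then pending n d [::] p else 0%N)%:Z.
    rewrite deg9 eqz_nat ltnS [(p <= i)%N]leq_eqVlt.
    by case: eqP => [->|_ /=]; rewrite ?dQ.
  have inp9' p : (p < i.+1)%N -> ar s9 a_input p%:Z = (p * n)%N%:Z.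
    rewrite ltnS leq_eqVlt inp9 inp8 eqz_nat.
    by case: eqP => [->|_ /=] //; exact: iQ.
  have iQ' : i \notin Q by rewrite mQ ltnn.
  rewrite den_seq den_if [ev _ _]/= i9 deg9' ltnSn ltz_nat.
  case: (posnP (pending n d [::] i)) => zi.
    exists (rcons Q i).
    rewrite /push [den _ s9]den_seq.
    remember (den (a_queue:[_] ::= _)%P s9) as s10 eqn:s10E.
    have t10 : rg s10 r_tail = (size Q)%:Z by rewrite s10E den_rg.
    have i10 : rg s10 r_i = i%:Z by rewrite s10E den_rg.
    have a10 : rg s10 r_a = (i * n)%N%:Z by rewrite s10E den_rg.
    have n10 : rg s10 r_n = n%:Z by rewrite s10E den_rg.
    have q10 k : ar s10 a_queue k = if k == (size Q)%:Z then i%:Z else ar s6 a_queue k.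
      by rewrite s10E den_sto /= /upd_array /updz /= t9 i9 q9.
    have d10 : ar s10 a_deg = ar s9 a_deg by rewrite s10E den_ar.
    have in10 : ar s10 a_input = ar s9 a_input by rewrite s10E den_ar.
    remember (den (incr r_tail) s10) as s11 eqn:s11E.
    have t11 : rg s11 r_tail = (size Q).+1%:Z by rewrite s11E rg_let /= t10 -PoszD addn1.
    have i11 : rg s11 r_i = i%:Z by rewrite s11E den_rg.
    have a11 : rg s11 r_a = (i * n)%N%:Z by rewrite s11E den_rg.
    have n11 : rg s11 r_n = n%:Z by rewrite s11E den_rg.
    have ar11 : ar s11 = ar s10 by rewrite s11E.
    rewrite den_seq; remember (den (r_a ::= _)%P s11) as s12 eqn:s12E.
    have a12 : rg s12 r_a = (i.+1 * n)%N%:Z by rewrite s12E rg_let /= a11 n11 mulSn; lia.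
    have i12 : rg s12 r_i = i%:Z by rewrite s12E den_rg.
    have t12 : rg s12 r_tail = (size Q).+1%:Z by rewrite s12E den_rg.
    have ar12 : ar s12 = ar s10 by rewrite s12E.
    split.
    - split; first by rewrite rg_let /= i12; lia.
        by rewrite den_rg.
      by rewrite den_rg // t12 size_rcons.
    - by rewrite rcons_uniq iQ'.
    - move=> p; rewrite mem_rcons inE mQ ltnS [(p <= i)%N]leq_eqVlt.
      by case: eqP => [->|//]; rewrite zi ltnn.
    - move=> j; rewrite size_rcons nth_rcons den_ar // ar12 q10 eqz_nat ltnS leq_eqVlt.
      case: eqP => [->|_ /= jQ]; first by rewrite ltnn.
      by rewrite jQ qQ.
    split=> p; rewrite den_ar // ar12 ?d10 ?in10; [exact: deg9'|exact: inp9'].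
  rewrite den_skip den_seq; remember (den (r_a ::= _)%P s9) as s12 eqn:s12E.
  have a12 : rg s12 r_a = (i.+1 * n)%N%:Z by rewrite s12E rg_let /= a9 n9 mulSn; lia.
  have i12 : rg s12 r_i = i%:Z by rewrite s12E den_rg.
  have t12 : rg s12 r_tail = (size Q)%:Z by rewrite s12E den_rg.
  have ar12 : ar s12 = ar s9 by rewrite s12E.
  exists Q; split=> //.
  - split; first by rewrite rg_let /= i12; lia.
      by rewrite den_rg.
    by rewrite den_rg.
  - move=> p; rewrite mQ ltnS [(p <= i)%N]leq_eqVlt.
    by case: (p =P i) => [->|//]; rewrite ltnn eqn0Ngt zi.
  - by move=> j jQ; rewrite den_ar // ar12 q9 qQ.
  split=> p; rewrite den_ar // ar12; [exact: deg9'|exact: inp9'].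
exists Q; split=> //; rewrite ?take0.
- by rewrite s5E den_rg.
- by move=> p; rewrite mQ => /andP[].
- by move=> p pn; rewrite ?take0 dQ pn.
- by move=> p pn; rewrite ?take0 mQ pn.
by move=> p q pn qn; rewrite s5E den_ar // ar4 inp.
Qed.

Lemma build_ok n d e s : (0 < n)%N -> circuit n d e ->
  rg s r_n = n%:Z -> rg s r_3n = (3 * n)%N%:Z -> rg s r_6n = (6 * n)%N%:Z ->
  input_at n d s -> (forall j k, j != a_raw -> ar s j k = 0) ->
  main_inv n d e n (den (Rep r_n process) (den sinks (den chain (den halves s)))).
Proof.
move=> n0 crc h1 h3 h6 inp zero.
have hH := halves_ok n0 h6.
have [X2 D2] : (forall k, ar (den halves s) a_x k = 0) /\
    (forall k, ar (den halves s) a_digits k = 0).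
  by split=> k; rewrite den_ar // zero.
have n2 : rg (den halves s) r_n = n%:Z by rewrite den_rg.
have n3 : rg (den halves s) r_3n = (3 * n)%N%:Z by rewrite den_rg.
have n6 : rg (den halves s) r_6n = (6 * n)%N%:Z by rewrite den_rg.
have inp2 : input_at n d (den halves s) by move=> p q *; rewrite den_ar // inp.
have deg2 k : ar (den halves s) a_deg k = 0 by rewrite den_ar // zero.
remember (den halves s) as s2 eqn:s2E.
have [st3 pk3] := chain_ok n0 n2 n3 n6 hH X2 D2.
have inp3 : input_at n d (den chain s2) by move=> p q *; rewrite den_ar // inp2.
have deg3 k : ar (den chain s2) a_deg k = 0 by rewrite den_ar // deg2.
have n3' : rg (den chain s2) r_n = n%:Z by rewrite den_rg.
remember (den chain s2) as s3 eqn:s3E.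
have [Q kh] := sinks_ok n3' inp3 deg3.
have plc3 : placed n e [::] (start_exps n) (start_exps n) (fun t => 0 < t <= n)%N
    (fun t => if t == 0 then 0 else (2 ^ (n.+1 - t)).-1)%N s3.
  split=> //.
  - exact: parking_start.
  - by move=> t; rewrite mem_iota; lia.
  - by move=> t; rewrite mem_iota; lia.
  - by rewrite size_iota /=; lia.
  - by rewrite count_start addn0.
  - by rewrite mem_iota; lia.
  move=> c _; exists (fun=> 0); split=> //.
  exists 0%N => T _; rewrite !big_nil /weigh; split; first by rewrite big1 // => t _; rewrite mul0r.
  by rewrite big1.
have n4 : rg (den sinks s3) r_n = n%:Z by rewrite den_rg.
have inv0 : main_inv n d e 0 (den sinks s3).
  exists Q, (start_exps n), (start_exps n); do 2!eexists; split; [exact: kh|by []|].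
  by rewrite take0; apply: den_placed plc3 _ _ _.
remember (den sinks s3) as s4 eqn:s4E.
apply: (den_rep (P := main_inv n d e)) => //; first by rewrite n4.
move=> i s5 iN _ _; exact: process_ok.
Qed.

(** * Growing the ternary tree *)

(** Records are numbered from 1 in the order of allocation; index 0 marks a
missing child. *)
Definition record_of (A : seq (seq trit)) (w : seq trit) : nat := (index w A).+1.
Definition pointer (B : nat) (a : nat) : nat := (B + 64 * a + 32)%N.

Fixpoint chained (link : int -> int) (B : nat) (A : seq (seq trit)) (p : int)
    (l : seq (seq trit)) : Prop :=
  if l is w :: l' then
    p = (pointer B (record_of A w))%:Z /\ chained link B A (link (record_of A w)%:Z) l'
  else p = -1.

Lemma eq_chained link link' B A A' p l :
  (forall w, w \in l -> record_of A' w = record_of A w) ->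
  (forall w, w \in l -> link' (record_of A w)%:Z = link (record_of A w)%:Z) ->
  chained link B A p l -> chained link' B A' p l.
Proof.
elim: l p => //= w l IH p hr hl [-> h].
rewrite hr ?mem_head ?hl ?mem_head //; split=> //.
by apply: IH h => v vl; [apply: hr|apply: hl]; rewrite inE vl orbT.
Qed.

(** Lists of levels grow at the front, hence the reversal. *)
Definition level (A : seq (seq trit)) (i : nat) : seq (seq trit) :=
  [seq w <- rev A | size w == i].

(** The nodes of the tree are the words of [A], in the order of
allocation. *)
Record trie (B N al : nat) (A : seq (seq trit)) (s : store) : Prop := Trie {
  trie_uniq : uniq A;
  trie_root : index [::] A = 0%N /\ [::] \in A;
  trie_parent : forall w t, rcons w t \in A -> w \in A;
  trie_size : forall w, w \in A -> (size w <= N)%N;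
  trie_last : rg s r_last = (size A)%:Z;
  trie_lastptr : rg s r_lastptr = (pointer B (size A))%:Z;
  trie_child : forall w t, w \in A ->
    ar s (4 + child_offset t)%N (record_of A w)%:Z =
      (if rcons w t \in A then record_of A (rcons w t) else 0%N)%:Z /\
    ar s (child_offset t) (record_of A w)%:Z =
      if rcons w t \in A then (pointer B (record_of A (rcons w t)))%:Z else -1;
  trie_fresh : forall (a : nat) t, (size A < a)%N -> ar s (4 + child_offset t)%N a%:Z = 0;
  trie_level : forall i, (i <= N)%N ->
    chained (ar s a_link) B A (ar s a_raw (al + i)%N%:Z) (level A i)
}.

Lemma record_rcons A u w : w \in A -> record_of (rcons A u) w = record_of A w.
Proof. by move=> wA; rewrite /record_of -cats1 index_cat wA. Qed.

Lemma record_new A u : u \notin A -> record_of (rcons A u) u = (size A).+1.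
Proof. by move=> uA; rewrite /record_of -cats1 index_cat (negbTE uA) /= eqxx addn0. Qed.

Lemma record_le A w : w \in A -> (record_of A w <= size A)%N.
Proof. by rewrite /record_of index_mem. Qed.

Lemma record_inj A w w' : w \in A -> w' \in A -> record_of A w = record_of A w' -> w = w'.
Proof. by move=> wA w'A []; apply: index_inj. Qed.

Lemma child_offset_le t : (child_offset t <= 2)%N.
Proof. by case: t. Qed.

Lemma den_trie B N al A c s : trie B N al A s ->
  all (fun r => r \notin assigned c) [:: r_last; r_lastptr] ->
  all (fun j => j \notin stored c) [:: 0; 1; 2; 3; 4; 5; 6; a_raw]%N ->
  trie B N al A (den c s).
Proof.
move=> [h1 h2 h3 h4 h5 h6 h7 h8 h9] /and3P[e1 e2 _].
move=> /= /and5P[f0 f1 f2 f3 /and5P[f4 f5 f6 f7 _]].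
have arE t : ar (den c s) (4 + child_offset t)%N = ar s (4 + child_offset t)%N /\
   ar (den c s) (child_offset t) = ar s (child_offset t) by case: t; rewrite !den_ar.
split; rewrite ?den_rg //.
- by move=> w t wA; have [-> ->] := arE t; exact: h7.
- by move=> a t aA; have [-> _] := arE t; exact: h8.
by move=> i iN; rewrite !den_ar //; exact: h9.
Qed.

Definition grow (A : seq (seq trit)) (u : seq trit) : seq (seq trit) :=
  if u \in A then A else rcons A u.

Lemma mem_grow A u v : (v \in grow A u) = (v == u) || (v \in A).
Proof.
rewrite /grow; case: ifP => uA; last by rewrite mem_rcons inE.
by case: eqP => [->|].
Qed.

Lemma level_rcons A u i : level (rcons A u) i =
  if size u == i then u :: level A i else level A i.
Proof. by rewrite /level rev_rcons /=. Qed.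

Lemma mem_level A i w : (w \in level A i) = (w \in A) && (size w == i).
Proof. by rewrite mem_filter mem_rev andbC. Qed.

(** Of the output area only the list heads of the levels are touched. *)
Lemma descend_ok B N al A s w t (i : nat) : trie B N al A s -> w \in A ->
  rg s r_x = (record_of A w)%:Z -> rg s r_i = i%:Z -> (size w + i.+1 = N)%N ->
  rg s r_size = N%:Z -> rg s r_al = al%:Z ->
  let s' := den (descend (child_offset t)) s in let u := rcons w t in
  [/\ trie B N al (grow A u) s', rg s' r_x = (record_of (grow A u) u)%:Z,
      rg s' r_ptr = (pointer B (record_of (grow A u) u))%:Z &
      forall z : int, (forall l : nat, (l <= N)%N -> z <> (al + l)%N%:Z) ->
        ar s' a_raw z = ar s a_raw z].
Proof.
move=> T wA hx hi sz hN hal s' u.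
have [T1 [T2 T2'] T3 T4 T5 T6 T7 T8 T9] := T.
have [c4 c0] := T7 w t wA.
have oN : forall j, (child_offset t == (4 + j)%N) = false.
  by move=> j; have := child_offset_le t; case: eqP => //; lia.
rewrite /s' /descend den_if [ev _ _]/= hx c4 -/u /grow.
case: ifP => uA.
  rewrite ltz_nat /record_of ltn0Sn.
  have T' : trie B N al A (den (r_ptr ::= (child_offset t)@[$r_x] ;;
      r_x ::= (4 + child_offset t)%N@[$r_x])%P s) by apply: den_trie => //; case: (t).
  split=> //.
  - by rewrite den_seq rg_let /= ?den_let /= /upd /= hx c4 -/u uA.
  by rewrite den_seq den_rg // rg_let /= hx c0 -/u uA.
rewrite ltxx.
remember (den (incr r_last) s) as s1 eqn:s1E.
rewrite den_seq -s1E den_seq; remember (den (r_lastptr ::= _)%P s1) as s2 eqn:s2E.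
have last2 : rg s2 r_last = (size A).+1%:Z.
  by rewrite s2E den_rg // s1E rg_let /= T5 -PoszD addn1.
have ptr2 : rg s2 r_lastptr = (pointer B (size A).+1)%:Z.
  by rewrite s2E rg_let /= s1E den_rg // T6 /pointer; lia.
have rg2 r : r \notin [:: r_last; r_lastptr] -> rg s2 r = rg s r.
  rewrite !inE negb_or => /andP[e1 e2].
  by rewrite s2E den_rg ?inE // s1E den_rg ?inE.
have ar2 : ar s2 = ar s by rewrite s2E s1E.
rewrite den_seq; remember (den ((4 + _)%N:[_] ::= _)%P s2) as s3 eqn:s3E.
rewrite den_seq; remember (den (child_offset t :[_] ::= _)%P s3) as s4 eqn:s4E.
have ar4 j z : ar s4 j z =
    if (j == (4 + child_offset t)%N) && (z == (record_of A w)%:Z) then (size A).+1%:Z else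
    if (j == child_offset t) && (z == (record_of A w)%:Z)
    then (pointer B (size A).+1)%:Z else ar s j z.
  have x3 : rg s3 r_x = (record_of A w)%:Z by rewrite s3E den_rg // rg2.
  have l3 : rg s3 r_lastptr = (pointer B (size A).+1)%:Z by rewrite s3E den_rg.
  rewrite s4E den_sto /= /upd_array x3 l3 s3E den_sto /= /upd_array rg2 // hx last2 ar2.
  rewrite /updz; case: (eqVneq j (child_offset t)) => [->|_] /=; last first.
    by case: eqP => //= _; case: eqP.
  by rewrite oN /=; case: eqP.
have rg4 r : r \notin [:: r_last; r_lastptr] -> rg s4 r = rg s r.
  by move=> hr; rewrite s4E den_rg // s3E den_rg // rg2.
have last4 : rg s4 r_last = (size A).+1%:Z by rewrite s4E den_rg // s3E den_rg.
have ptr4 : rg s4 r_lastptr = (pointer B (size A).+1)%:Z.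
  by rewrite s4E den_rg // s3E den_rg.
rewrite den_seq; remember (den new_record s4) as s5 eqn:s5E.
have rg5 r : rg s5 r = rg s4 r by rewrite s5E den_rg.
have ar5 j z : ar s5 j z =
    if (j <= 2)%N && (z == (size A).+1%:Z) then -1 else ar s4 j z.
  rewrite s5E /new_record !denE /= /upd_array /updz last4.
  by case: j => [|[|[|j]]] //=; case: eqP.
rewrite den_seq; remember (den (a_link:[_] ::= _)%P s5) as s6 eqn:s6E.
have idx5 : rg s5 r_al + rg s5 r_size - rg s5 r_i = (al + (size w).+1)%N%:Z.
  by rewrite !rg5 !rg4 // hal hN hi -sz; lia.
have raw5 z : ar s5 a_raw z = ar s a_raw z.
  by rewrite ar5 ar4 /=; case: (child_offset t) (child_offset_le t) => [|[|[|]]].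
have ar6 j z : ar s6 j z = if (j == a_link) && (z == (size A).+1%:Z)
    then ar s a_raw (al + (size w).+1)%N%:Z else ar s5 j z.
  rewrite s6E den_sto /= /upd_array /updz rg5 last4 idx5 raw5.
  by case: eqP => //= ->.
have rg6 r : rg s6 r = rg s4 r by rewrite s6E den_rg // rg5.
rewrite den_seq; remember (den (a_raw:[_] ::= _)%P s6) as s7 eqn:s7E.
have ar7 j z : ar s7 j z = if (j == a_raw) && (z == (al + (size w).+1)%N%:Z)
    then (pointer B (size A).+1)%:Z else ar s6 j z.
  rewrite s7E den_sto /= /upd_array /updz.
  rewrite !rg6 ptr4 -!rg5 idx5.
  by case: eqP => //= ->.
have rg7 r : rg s7 r = rg s4 r by rewrite s7E den_rg // rg6.
have uA' : u \notin A by rewrite uA.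
rewrite den_seq; remember (den (r_x ::= _)%P s7) as s8 eqn:s8E.
have ar8 : ar s8 = ar s7 by rewrite s8E.
have x8 : rg s8 r_x = (size A).+1%:Z by rewrite s8E rg_let /= rg7 last4.
have rg8 r : r != r_x -> rg s8 r = rg s4 r by move=> hr; rewrite s8E den_rg ?inE // rg7.
have ptr8 : rg s8 r_lastptr = (pointer B (size A).+1)%:Z by rewrite rg8.
have ar9 : ar (den (r_ptr ::= $r_lastptr)%P s8) = ar s7 by rewrite den_let -ar8.
have x9 : rg (den (r_ptr ::= $r_lastptr)%P s8) r_x = (size A).+1%:Z by rewrite den_rg.
have p9 : rg (den (r_ptr ::= $r_lastptr)%P s8) r_ptr = (pointer B (size A).+1)%:Z.
  by rewrite rg_let.
have l9 : rg (den (r_ptr ::= $r_lastptr)%P s8) r_last = (size A).+1%:Z.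
  by rewrite den_rg // rg8.
have lp9 : rg (den (r_ptr ::= $r_lastptr)%P s8) r_lastptr = (pointer B (size A).+1)%:Z.
  by rewrite den_rg.
remember (den (r_ptr ::= $r_lastptr)%P s8) as s9 eqn:s9E.
have kid z t' : ar s9 (4 + child_offset t')%N z =
    if (t' == t) && (z == (record_of A w)%:Z) then (size A).+1%:Z
    else ar s (4 + child_offset t')%N z.
  rewrite ar9 ar7 ar6 ar5 ar4.
  case: (eqVneq t' t) => [->|ne]; last by clear -ne; case: t' t ne => [] [].
  by rewrite eqxx; case: (t).
have ptr z t' : ar s9 (child_offset t') z =
    if z == (size A).+1%:Z then -1 else
    if (t' == t) && (z == (record_of A w)%:Z) then (pointer B (size A).+1)%:Z
    else ar s (child_offset t') z.
  rewrite ar9 ar7 ar6 ar5 ar4.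
  case: (eqVneq t' t) => [->|ne]; last by clear -ne; case: t' t ne => [] [].
  by rewrite eqxx; case: (t).
have link z : ar s9 a_link z = if z == (size A).+1%:Z
    then ar s a_raw (al + (size w).+1)%N%:Z else ar s a_link z.
  by rewrite ar9 ar7 ar6 ar5 ar4; case: (t).
have raw z : ar s9 a_raw z = if z == (al + (size w).+1)%N%:Z
    then (pointer B (size A).+1)%:Z else ar s a_raw z.
  by rewrite ar9 ar7 ar6 raw5.
have szu : size u = (size w).+1 by rewrite size_rcons.
have wu : (w == u) = false.
  by apply/eqP => wu; have := szu; rewrite -wu; lia.
have rec_ne v : v \in A -> ((record_of A v)%:Z == (size A).+1%:Z :> int) = false.
  by move=> vA; rewrite eqz_nat ltn_eqF // ltnS record_le.
clear s5E s6E s7E s8E s9E s4E s3E s2E s1E ar9 ar8 ar7 ar6 ar5 ar4 ar2.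
have child_u t' : rcons u t' \in rcons A u = false.
  apply/negP; rewrite mem_rcons inE => /orP[/eqP/(congr1 size)|/T3].
    by rewrite size_rcons; lia.
  by rewrite uA.
split; rewrite ?record_new //; last first.
  by move=> z hz; rewrite raw; case: eqP => // ez; case: (hz (size w).+1) => //; lia.
split=> //.
- by rewrite rcons_uniq uA' T1.
- by rewrite -cats1 index_cat T2' T2 mem_cat T2'.
- move=> v t'; rewrite !mem_rcons !inE => /orP[/eqP/rcons_inj[-> _]|/T3 ->].
    by rewrite wA orbT.
  by rewrite orbT.
- by move=> v; rewrite mem_rcons inE => /orP[/eqP ->|/T4//]; rewrite szu; lia.
- by rewrite size_rcons.
- by rewrite size_rcons.
- move=> v t'; rewrite mem_rcons inE => /orP[/eqP ->|vA].
    rewrite record_new // child_u kid ptr eqxx T8 //.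
    by rewrite [_ == (record_of A w)%:Z]eq_sym rec_ne // andbF.
  rewrite record_rcons // kid ptr rec_ne // mem_rcons inE eqz_nat.
  have -> : (rcons v t' == u) = (t' == t) && (record_of A v == record_of A w).
    apply/eqP/andP => [/rcons_inj[-> ->]|[/eqP -> /eqP/record_inj ->]] //.
  case: andP => [[/eqP -> /eqP/(record_inj vA wA) ->]|_] /=; first by rewrite record_new.
  have [k0 p0] := T7 v t' vA; rewrite k0 p0; case: ifP => // vtA.
  by rewrite record_rcons.
- move=> a t'; rewrite size_rcons => aA; have aA' : (size A < a)%N := ltnW aA.
  rewrite kid T8 // eqz_nat gtn_eqF ?andbF //.
  exact: leq_ltn_trans (record_le wA) aA'.
move=> l lN; rewrite level_rcons szu raw eqz_nat eqn_add2l [l == _]eq_sym.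
have keep : chained (ar s9 a_link) B (rcons A u) (ar s a_raw (al + l)%N%:Z) (level A l).
  apply: eq_chained (T9 l lN) => v; rewrite mem_level => /andP[vA _].
    exact: record_rcons.
  by rewrite link rec_ne.
case: eqP => [el|_] //=; split; first by rewrite record_new.
by rewrite record_new // link eqxx el.
Qed.

(** * Writing the tree and the bits *)

Definition digit_of (N : nat) (s : store) (r l : nat) : int :=
  ar s a_digits (ar s a_row (ar s a_order r%:Z) + ar s a_order (N - l.+1)%N%:Z).

Definition spelled (N : nat) (wd : nat -> seq trit) (s : store) : Prop :=
  forall r, (r < N)%N -> size (wd r) = N /\
    forall l, (l < N)%N -> digit_of N s r l = int_of_trit (nth Zero (wd r) l).

Definition extends (A A' : seq (seq trit)) (u : seq trit) : Prop :=
  [/\ {subset A <= A'}, forall w, w \in A -> record_of A' w = record_of A w &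
      forall w, w \in A' -> w \in A \/ w = take (size w) u].

Lemma extends_grow A A' u l : extends A A' u -> (l < size u)%N ->
  extends A (grow A' (take l.+1 u)) u.
Proof.
move=> [e1 e2 e3] lu; split.
- by move=> w wA; rewrite mem_grow e1 ?orbT.
- move=> w wA; rewrite /grow; case: ifP => _; first exact: e2.
  by rewrite record_rcons ?e2 ?e1.
move=> w; rewrite mem_grow => /orP[/eqP ->|/e3//]; right.
by rewrite size_takel.
Qed.

(** After each letter the current record is that of a prefix of the word, and
the words of the tree are the old ones and prefixes of the new one. *)
Lemma add_word_ok n B N al A wd s (r : nat) : trie B N al A s -> spelled N wd s ->
  rg s r_3n = (3 * n)%N%:Z -> (N <= 3 * n)%N -> (r < N)%N ->
  rg s r_rank = r%:Z -> rg s r_size = N%:Z -> rg s r_al = al%:Z ->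
  rg s 3%N = (pointer B 1)%:Z ->
  let s' := den add_word s in
  exists A', [/\ trie B N al A' s' /\ extends A A' (wd r), wd r \in A',
    rg s' r_ptr = (pointer B (record_of A' (wd r)))%:Z &
    forall z : int, (forall l : nat, (l <= N)%N -> z <> (al + l)%N%:Z) ->
        ar s' a_raw z = ar s a_raw z].
Proof.
move=> T sp h3 N3 rN hr hN hal hroot s'.
have [szr spr] := sp r rN.
pose P (l : nat) s' := exists A', [/\ trie B N al A' s' /\ extends A A' (wd r),
  take l (wd r) \in A',
  [/\ rg s' r_x = (record_of A' (take l (wd r)))%:Z,
      rg s' r_ptr = (pointer B (record_of A' (take l (wd r))))%:Z &
      rg s' r_i = N%:Z - l%:Z - 1] &
  forall z : int, (forall l : nat, (l <= N)%N -> z <> (al + l)%N%:Z) ->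
        ar s' a_raw z = ar s a_raw z].
suff [A' [T' inA [_ hp _] hraw]] : P N s'.
  have tk : take N (wd r) = wd r by rewrite -szr take_size.
  by rewrite tk in inA hp; exists A'.
rewrite /s' /add_word den_seq; remember (den (r_x ::= _)%P s) as s1 eqn:s1E.
rewrite den_seq; remember (den (r_ptr ::= _)%P s1) as s2 eqn:s2E.
rewrite den_seq; remember (den (r_i ::= _)%P s2) as s3 eqn:s3E.
rewrite den_seq; remember (den (r_a ::= _)%P s3) as s4 eqn:s4E.
have ar4 : ar s4 = ar s by rewrite s4E s3E s2E s1E.
have rg4 x : x \notin [:: r_x; r_ptr; r_i; r_a] -> rg s4 x = rg s x.
  rewrite !inE !negb_or => /and4P[e1 e2 e3 e4].
  by rewrite s4E den_rg ?inE // s3E den_rg ?inE // s2E den_rg ?inE // s1E den_rg ?inE.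
have a4 : rg s4 r_a = ar s a_row (ar s a_order r%:Z).
  have r3 : rg s3 r_rank = r%:Z by rewrite s3E den_rg // s2E den_rg // s1E den_rg.
  have ar3 : ar s3 = ar s by rewrite s3E s2E s1E.
  by rewrite s4E rg_let /= r3 ar3.
have x4 : rg s4 r_x = 1 by rewrite s4E den_rg // s3E den_rg // s2E den_rg // s1E rg_let.
have p4 : rg s4 r_ptr = (pointer B 1)%:Z.
  by rewrite s4E den_rg // s3E den_rg // s2E rg_let /= s1E den_rg.
have i4 : rg s4 r_i = N%:Z - 1.
  by rewrite s4E den_rg // s3E rg_let /= s2E den_rg // s1E den_rg // hN.
have T4 : trie B N al A s4.
  by rewrite s4E s3E s2E s1E; do 4!apply: den_trie => //.
have [root0 rootA] := trie_root T.
apply: (den_upto (P := P) (k := (3 * n)%N)) => //.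
- by rewrite rg4 // h3.
- exists A; rewrite take0 /record_of root0; split=> //; last by rewrite ar4.
    by split=> //; split=> // w wA; left.
  by split=> //; rewrite i4 subr0.
- move=> l s5 lN fr fa [A' [[T5 ext] inA [x5 p5 i5] raw5]].
  have iE : rg s5 r_i = (N - l.+1)%N%:Z by rewrite i5; lia.
  split; first by rewrite /= iE; lia.
  rewrite den_seq; remember (den (r_w ::= _)%P s5) as s6 eqn:s6E.
  have w6 : rg s6 r_w = int_of_trit (nth Zero (wd r) l).
    rewrite s6E rg_let /= iE fr // a4 !fa // ar4 -spr //.
  have T6 : trie B N al A' s6 by rewrite s6E; apply: den_trie.
  have x6 : rg s6 r_x = (record_of A' (take l (wd r)))%:Z by rewrite s6E den_rg.
  have i6 : rg s6 r_i = (N - l.+1)%N%:Z by rewrite s6E den_rg.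
  have N6 : rg s6 r_size = N%:Z by rewrite s6E den_rg // fr // rg4.
  have al6 : rg s6 r_al = al%:Z by rewrite s6E den_rg // fr // rg4.
  have raw6 : ar s6 a_raw = ar s5 a_raw by rewrite s6E den_ar.
  have lw : (l < size (wd r))%N by rewrite szr.
  have sz : (size (take l (wd r)) + (N - l.+1).+1 = N)%N.
    by rewrite size_takel; lia.
  have [T7 x7 p7 raw7] := descend_ok (nth Zero (wd r) l) T6 inA x6 i6 sz N6 al6.
  rewrite -(take_nth Zero lw) in T7 x7 p7.
  have step : den (If $r_w (descend 2) (If (#0 :- $r_w) (descend 0) (descend 1)))%P s6
      = den (descend (child_offset (nth Zero (wd r) l))) s6.
    rewrite den_if [ev _ _]/= w6 den_if [ev _ _]/= w6.
    by case: (nth Zero (wd r) l).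
  rewrite den_seq step.
  have i7 : rg (den (descend (child_offset (nth Zero (wd r) l))) s6) r_i = (N - l.+1)%N%:Z.
    by rewrite den_rg //; case: (nth Zero (wd r) l).
  remember (den (descend _) s6) as s7 eqn:s7E.
  exists (grow A' (take l.+1 (wd r))); split.
  + by split; [apply: den_trie|exact: extends_grow].
  + by rewrite mem_grow eqxx.
  + by split; [rewrite den_rg|rewrite den_rg|rewrite rg_let /= i7; lia].
  by move=> z hz; rewrite den_ar // raw7 // raw6 raw5.
move=> s5 fr fa [A' [_ _ [_ _ i5] _]]; rewrite /= i5; lia.
Qed.

Lemma root_ok n B N nn s : (N <= 3 * n)%N ->
  rg s r_3n = (3 * n)%N%:Z -> rg s r_6n = (6 * n)%N%:Z -> rg s r_nn = nn%:Z ->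
  rg s base_reg = B%:Z ->
  (forall t z, ar s (4 + child_offset t)%N z = 0) ->
  let s' := den root s in let al := (nn + 6 * n)%N in
  trie B N al [:: [::]] s' /\
  [/\ rg s' 1%N = nn%:Z, rg s' 2%N = (nn + 3 * n)%N%:Z, rg s' r_al = al%:Z &
      rg s' 3%N = (pointer B 1)%:Z].
Proof.
move=> N3 h3 h6 hnn hB zero s' al.
rewrite /s' /root den_seq; remember (den (1%N ::= _)%P s) as s1 eqn:s1E.
have a1 : rg s1 1%N = nn%:Z by rewrite s1E rg_let.
have rg1 x : x != 1%N -> rg s1 x = rg s x by move=> ne; rewrite s1E den_rg ?inE.
have ar1 : ar s1 = ar s by rewrite s1E.
clear s1E.
rewrite den_seq; remember (den (2%N ::= _)%P s1) as s2 eqn:s2E.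
have a2 : rg s2 2%N = (nn + 3 * n)%N%:Z by rewrite s2E rg_let /= !rg1 // hnn h3.
have rg2 x : x != 2%N -> rg s2 x = rg s1 x by move=> ne; rewrite s2E den_rg ?inE.
have ar2 : ar s2 = ar s by rewrite s2E.
clear s2E.
rewrite den_seq; remember (den (r_al ::= _)%P s2) as s3 eqn:s3E.
have a3 : rg s3 r_al = al%:Z by rewrite s3E rg_let /= !rg2 // !rg1 // hnn h6.
have rg3 x : x != r_al -> rg s3 x = rg s2 x by move=> ne; rewrite s3E den_rg ?inE.
have ar3 : ar s3 = ar s by rewrite s3E.
clear s3E.
rewrite den_seq; remember (den (3%N ::= _)%P s3) as s4 eqn:s4E.
have a4 : rg s4 3%N = (pointer B 1)%:Z.
  by rewrite s4E rg_let /= rg3 // rg2 // rg1 // hB /pointer; lia.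
have rg4 x : x != 3%N -> rg s4 x = rg s3 x by move=> ne; rewrite s4E den_rg ?inE.
have ar4 : ar s4 = ar s by rewrite s4E.
clear s4E.
rewrite den_seq; remember (den (r_last ::= _)%P s4) as s5 eqn:s5E.
have a5 : rg s5 r_last = 1 by rewrite s5E rg_let.
have rg5 x : x != r_last -> rg s5 x = rg s4 x by move=> ne; rewrite s5E den_rg ?inE.
have ar5 : ar s5 = ar s by rewrite s5E.
clear s5E.
rewrite den_seq; remember (den (r_lastptr ::= _)%P s5) as s6 eqn:s6E.
have a6 : rg s6 r_lastptr = (pointer B 1)%:Z by rewrite s6E rg_let /= rg5.
have rg6 x : x != r_lastptr -> rg s6 x = rg s5 x by move=> ne; rewrite s6E den_rg ?inE.
have ar6 : ar s6 = ar s by rewrite s6E.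
clear s6E.
rewrite den_seq; remember (den new_record s6) as s7 eqn:s7E.
have rg7 x : rg s7 x = rg s6 x by rewrite s7E den_rg.
have ar7 j z : ar s7 j z = if (j <= 2)%N && (z == 1) then -1 else ar s j z.
  rewrite s7E /new_record !denE /= /upd_array /updz rg6 // a5 ar6.
  by case: j => [|[|[|j]]] //=; case: eqP.
clear s7E.
rewrite den_seq; remember (den (a_link:[_] ::= _)%P s7) as s8 eqn:s8E.
have rg8 x : rg s8 x = rg s6 x by rewrite s8E den_rg // rg7.
have ar8 j z : ar s8 j z = if (j <= 3)%N && (z == 1) then -1 else ar s j z.
  rewrite s8E den_sto /= /upd_array /updz.
  case: (eqVneq j a_link) => [->|ne]; last first.
    by rewrite ar7 [(j <= 3)%N]leq_eqVlt (negbTE ne).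
  by rewrite ar7; case: eqP.
clear s8E.
rewrite den_seq; remember (den (a_raw:[_] ::= _)%P s8) as s9 eqn:s9E.
have rg9 x : rg s9 x = rg s6 x by rewrite s9E den_rg // rg8.
have ar9 j z : ar s9 j z = if (j == a_raw) && (z == al%:Z) then (pointer B 1)%:Z else
    if (j <= 3)%N && (z == 1) then -1 else ar s j z.
  have e1 : rg s8 3%N = (pointer B 1)%:Z by rewrite rg8 rg6 // rg5.
  have e2 : rg s8 r_al = al%:Z by rewrite rg8 rg6 // rg5 // rg4.
  by rewrite s9E den_sto /= /upd_array /updz e1 e2; case: eqP => [->|_] /=; rewrite ar8.
clear s9E.
rewrite den_seq; remember (den (r_i ::= _)%P s9) as s10 eqn:s10E.
have i10 : rg s10 r_i = 0 by rewrite s10E rg_let.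
have rg10 x : x != r_i -> rg s10 x = rg s6 x.
  by move=> ne; rewrite s10E den_rg ?inE // rg9.
have ar10 : ar s10 = ar s9 by rewrite s10E.
clear s10E.
pose P (i : nat) s' := rg s' r_i = i%:Z /\ forall z, ar s' a_raw z =
   if [&& al%:Z < z & z <= (al + i)%N%:Z] then -1 else ar s9 a_raw z.
have al10 : rg s10 r_al = al%:Z by rewrite rg10 // rg6 // rg5 // rg4.
have h10 : rg s10 r_3n = (3 * n)%N%:Z.
  by rewrite rg10 // rg6 // rg5 // rg4 // rg3 // rg2 // rg1.
set loop := Rep _ _.
have [_ raw11] : P (3 * n)%N (den loop s10).
  apply: (den_rep (P := P)); first by rewrite h10.
    by split=> // z; rewrite ar10; case: ifP => //; lia.
  move=> i s11 iN fr fa [hi hraw].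
  have al11 : rg s11 r_al = al%:Z by rewrite fr.
  rewrite den_seq; split; first by rewrite den_rg // rg_let /= hi; lia.
  move=> z; rewrite den_sto /= /upd_array /updz /= /upd /= al11 hi hraw.
  case: eqP => ez; first by rewrite ifT //; lia.
  by congr (if _ then _ else _); lia.
have rg11 x : x != r_i -> rg (den loop s10) x = rg s6 x.
  by move=> ne; rewrite den_rg ?inE // rg10.
have ar11 j : j != a_raw -> ar (den loop s10) j = ar s9 j.
  by move=> ne; rewrite den_ar ?inE // ar10.
remember (den loop s10) as s11 eqn:s11E.
split; last first.
  split; rewrite rg11 // rg6 // rg5 // ?rg4 // rg3 // rg2 //.
split=> //.
- by move=> w t; rewrite inE => /eqP/(congr1 size); rewrite size_rcons.
- by move=> w; rewrite inE => /eqP ->.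
- by rewrite rg11 // rg6.
- by rewrite rg11.
- move=> w t; rewrite inE => /eqP ->.
  have -> : rcons [::] t \in [:: [::]] = false by [].
  rewrite !ar11; try by case: (t).
  by rewrite !ar9 zero; case: (t).
- move=> a t _; rewrite ar11; last by case: (t).
  by rewrite ar9 zero; case: (t).
move=> i iN; rewrite raw11 ar11 //.
case: i iN => [|i] iN.
  have -> : (al%:Z < (al + 0)%N%:Z :> int) && ((al + 0)%N%:Z <= (al + 3 * n)%N%:Z :> int) = false by lia.
  by split; rewrite ar9 ?addn0 ?eqxx.
have -> : (al%:Z < (al + i.+1)%N%:Z :> int) && ((al + i.+1)%N%:Z <= (al + 3 * n)%N%:Z :> int) by lia.
by [].
Qed.

Lemma write_tree_ok n B N nn wd s : (N <= 3 * n)%N -> spelled N wd s ->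
  rg s r_3n = (3 * n)%N%:Z -> rg s r_6n = (6 * n)%N%:Z -> rg s r_nn = nn%:Z ->
  rg s base_reg = B%:Z -> rg s r_size = N%:Z ->
  (forall t z, ar s (4 + child_offset t)%N z = 0) ->
  let s' := den write_tree s in let al := (nn + 6 * n)%N in
  exists A, [/\ trie B N al A s',
    forall r, (r < N)%N -> wd r \in A /\
      ar s' a_raw (nn + r)%N%:Z = (pointer B (record_of A (wd r)))%:Z,
    forall w, w \in A -> w = [::] \/ exists2 r, (r < N)%N & w = take (size w) (wd r) &
    [/\ rg s' 1%N = nn%:Z, rg s' 2%N = (nn + 3 * n)%N%:Z, rg s' r_al = al%:Z &
      rg s' 3%N = (pointer B 1)%:Z]].
Proof.
move=> N3 sp h3 h6 hnn hB hN zero s' al.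
have [T1 [h1 h2 hal hroot]] := root_ok N3 h3 h6 hnn hB zero.
rewrite /s' /write_tree den_seq.
have n1 : rg (den root s) r_3n = (3 * n)%N%:Z by rewrite den_rg.
have N1 : rg (den root s) r_size = N%:Z by rewrite den_rg.
have sp1 : spelled N wd (den root s).
  by move=> r rN; have [e1 e2] := sp r rN; split=> // l lN; rewrite -e2 // /digit_of !den_ar.
remember (den root s) as s1 eqn:s1E.
rewrite den_seq; remember (den (r_rank ::= _)%P s1) as s2 eqn:s2E.
pose P (r : nat) s' := exists A, [/\ trie B N al A s', rg s' r_rank = r%:Z,
    forall r', (r' < r)%N -> wd r' \in A /\
      ar s' a_raw (nn + r')%N%:Z = (pointer B (record_of A (wd r')))%:Z &
    forall w, w \in A -> w = [::] \/ exists2 r', (r' < N)%N & w = take (size w) (wd r')].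
have rg2 x : x != r_rank -> rg s2 x = rg s1 x by move=> ne; rewrite s2E den_rg ?inE.
set loop := Rep _ _.
suff [A [e1 e2 e3 e4]] : P N (den loop s2).
  by exists A; split=> //; split; rewrite den_rg // rg2.
apply: (den_upto (P := P) (k := (3 * n)%N)) => //.
- by rewrite rg2 // n1.
- exists [:: [::]]; split=> //.
  + by rewrite s2E; apply: den_trie.
  + by rewrite s2E rg_let.
  by move=> w; rewrite inE => /eqP ->; left.
- move=> r s3 rN fr fa [A [T3 r3 done3 cov3]].
  have N3' : rg s3 r_size = N%:Z by rewrite fr // rg2.
  split; first by rewrite /= N3' r3; lia.
  have sp3 : spelled N wd s3.
    move=> q qN; have [f1 f2] := sp1 q qN; split=> // l lN.
    by rewrite -f2 // /digit_of !fa // s2E.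
  have n3 : rg s3 r_3n = (3 * n)%N%:Z by rewrite fr // rg2.
  have al3 : rg s3 r_al = al%:Z by rewrite fr // rg2.
  have root3 : rg s3 3%N = (pointer B 1)%:Z by rewrite fr // rg2.
  have [A' [[T4 [x1 x2 x3]] inA p4 raw4]] := add_word_ok T3 sp3 n3 N3 rN r3 N3' al3 root3.
  have r4 : rg (den add_word s3) r_rank = r%:Z by rewrite den_rg.
  have an4 : rg (den add_word s3) 1%N = nn%:Z by rewrite den_rg // fr // rg2.
  rewrite den_seq; remember (den add_word s3) as s4 eqn:s4E.
  rewrite den_seq; remember (den (a_raw:[_] ::= _)%P s4) as s5 eqn:s5E.
  have raw5 z : ar s5 a_raw z = if z == (nn + r)%N%:Z then
      (pointer B (record_of A' (wd r)))%:Z else ar s4 a_raw z.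
    by rewrite s5E den_sto /= /upd_array /updz /= an4 r4 p4.
  have r5 : rg s5 r_rank = r%:Z by rewrite s5E den_rg.
  have T5 : trie B N al A' s5.
    have [t1 t2 t3 t4 t5 t6 t7 t8 t9] := T4.
    have off j : j != a_raw -> ar s5 j = ar s4 j by move=> ne; rewrite s5E den_ar ?inE.
    split=> //.
    - by rewrite s5E den_rg.
    - by rewrite s5E den_rg.
    - by move=> w t wA; rewrite !off; [exact: t7|case: (t)|case: (t)].
    - by move=> a t aA; rewrite off; [exact: t8|case: (t)].
    move=> i iN; rewrite off // raw5 eqz_nat.
    by rewrite gtn_eqF; [exact: t9|rewrite /al; lia].
  exists A'; split.
  + exact: den_trie.
  + by rewrite rg_let /= r5; lia.
  + move=> q; rewrite ltnS leq_eqVlt den_ar // raw5 eqz_nat eqn_add2l.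
    case: eqP => [->//|_ /= qr]; have [wA hq] := done3 q qr.
    split; first exact: x1.
    rewrite x2 // raw4 // => l lN /eqP; rewrite eqz_nat /al; lia.
  by move=> w /x3[/cov3//|wr]; right; exists r.
by move=> s3 fr fa [A [_ r3 _ _]]; rewrite /= r3 fr // rg2 // N1 subrr.
Qed.

Lemma write_bits_ok n s ab : rg s r_3n = (3 * n)%N%:Z -> rg s 2%N = ab%:Z ->
  forall z, ar (den write_bits s) a_raw z =
    if (ab%:Z <= z) && (z < (ab + 3 * n)%N%:Z)
    then ar s a_bit (ar s a_order (z - ab%:Z)) else ar s a_raw z.
Proof.
move=> h3 h2 z.
pose P (i : nat) s' := rg s' r_i = i%:Z /\ forall z, ar s' a_raw z =
    if (ab%:Z <= z) && (z < (ab + i)%N%:Z)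
    then ar s a_bit (ar s a_order (z - ab%:Z)) else ar s a_raw z.
suff [_ ->//] : P (3 * n)%N (den write_bits s).
rewrite /write_bits den_seq; remember (den (r_i ::= _)%P s) as s1 eqn:s1E.
have ar1 : ar s1 = ar s by rewrite s1E.
apply: (den_rep (P := P)); first by rewrite s1E den_rg // h3.
  split; first by rewrite s1E rg_let.
  by move=> y; rewrite ar1; case: ifP => //; lia.
move=> i s2 iN fr fa [hi hraw].
have ab2 : rg s2 2%N = ab%:Z by rewrite fr // s1E den_rg.
have b2 : ar s2 a_bit = ar s a_bit by rewrite fa // ar1.
have o2 : ar s2 a_order = ar s a_order by rewrite fa // ar1.
rewrite den_seq; split; first by rewrite rg_let /= hi; lia.
move=> y; rewrite den_ar // den_sto /= /upd_array /updz /= ab2 hi b2 o2 hraw.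
case: eqP => [->|ne].
  rewrite ifT; last by lia.
  by congr (ar s a_bit (ar s a_order _)); lia.
by congr (if _ then _ else _); lia.
Qed.

(** * The result of a run *)

Lemma trit_of_intK z : is_trit z -> int_of_trit (trit_of_int z) = z.
Proof.
rewrite /is_trit /trit_of_int => hz; case: eqP => [->//|n1]; case: eqP => [->//|n0] /=.
lia.
Qed.

(** Read from the root, the letters belong to decreasing exponents. *)
Definition word (D : nat -> nat -> int) (L : seq nat) (r : nat) : seq trit :=
  [seq trit_of_int (D (nth 0%N L r) k) | k <- rev L].

(** What the rest of the proof needs from a run: the circuit given by [E] and
[D], its relation to the exponents [e] of the input, and the output area. *)
Record result (n B nn : nat) (e : nat -> nat) (s : store) (E L : seq nat)
    (D : nat -> nat -> int) (S : nat -> bool) (A : seq (seq trit)) : Prop := Result {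
  result_max : (size E <= 3 * n)%N;
  result_sorting : sorting E L;
  result_compact : forall id, (id < size E)%N -> compact E (D id);
  result_value : forall id, (id < size E)%N -> value E (D id) = (nth 0%N E id)%:Z;
  result_mem : forall p, (p < n)%N -> e p \in E;
  result_sub : forall t, S t -> t \in E;
  result_repr : forall c : nat -> int, (forall q, is_trit (c q)) -> exists g,
    represents S (\sum_(q < n) c q * 2 ^+ e q) (\sum_(q < n) `|c q|)%N g;
  result_trie : trie B (size E) (nn + 6 * n) A s;
  result_word : forall r, (r < size E)%N -> word D L r \in A /\
    ar s a_raw (nn + r)%N%:Z = (pointer B (record_of A (word D L r)))%:Z;
  result_cover : forall w, w \in A ->
    w = [::] \/ exists2 r, (r < size E)%N & w = take (size w) (word D L r);
  result_bits : forall i, (i.+1 < size E)%N ->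
    ar s a_raw (nn + 3 * n + i)%N%:Z = (nat_of_bool ((nth_exp E L i).+1 \in E))%:Z;
  result_regs : [/\ rg s 0%N = (size E)%:Z, rg s 1%N = nn%:Z,
    rg s 2%N = (nn + 3 * n)%N%:Z, rg s 3%N = (pointer B 1)%:Z &
    rg s 4%N = (nn + 6 * n)%N%:Z]
}.

(** What the last phase reads, for empty circuits too, where the state of the
construction is not available as 0 is not in the list. *)
Record ready (n B nn : nat) (E L : seq nat) (D : nat -> nat -> int) (s : store) : Prop :=
 Ready {
  ready_3n : rg s r_3n = (3 * n)%N%:Z;
  ready_6n : rg s r_6n = (6 * n)%N%:Z;
  ready_nn : rg s r_nn = nn%:Z;
  ready_base : rg s base_reg = B%:Z;
  ready_size : rg s r_size = (size E)%:Z;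
  ready_kids : forall t z, ar s (4 + child_offset t)%N z = 0;
  ready_digit : forall r l, (r < size E)%N -> (l < size E)%N ->
    ar s a_digits (ar s a_row (ar s a_order r%:Z) + ar s a_order l%:Z) =
      D (nth 0%N L r) (nth 0%N L l);
  ready_bit : forall i, (i < size E)%N -> ar s a_bit (ar s a_order i%:Z) =
    (nat_of_bool ((nth_exp E L i).+1 \in E))%:Z
}.

Definition write_output : cmd :=
  (write_tree ;; write_bits ;; 0%N ::= $r_size ;; 4%N ::= $r_al)%P.

Lemma write_output_ok n B nn e E L D (S : nat -> bool) s :
  (size E <= 3 * n)%N -> sorting E L ->
  (forall id, (id < size E)%N -> compact E (D id)) ->
  (forall id, (id < size E)%N -> value E (D id) = (nth 0%N E id)%:Z) ->
  (forall p, (p < n)%N -> e p \in E) -> (forall t, S t -> t \in E) ->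
  (forall c : nat -> int, (forall q, is_trit (c q)) -> exists g,
    represents S (\sum_(q < n) c q * 2 ^+ e q) (\sum_(q < n) `|c q|)%N g) ->
  ready n B nn E L D s ->
  exists A, result n B nn e (den write_output s) E L D S A.
Proof.
move=> h1 h2 h3 h4 h5 h6 h7 [r1 r2 r3 r4 r5 r6 r7 r8].
have sp : spelled (size E) (word D L) s.
  move=> r rN; rewrite /word size_map size_rev (sorting_size h2); split=> // l lN.
  rewrite (nth_map 0%N) ?size_rev ?(sorting_size h2) // nth_rev ?(sorting_size h2) //.
  rewrite trit_of_intK; last first.
    have lN' : (size E - l.+1 < size E)%N by lia.
    by case: (h3 _ (sorting_nth h2 rN)) => tD _; apply/tD/(sorting_nth h2).
  by rewrite /digit_of r7 //; lia.
have [A [T hw cov [g1 g2 gal g3]]] := write_tree_ok h1 sp r1 r2 r3 r4 r5 r6.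
exists A.
have n1 : rg (den write_tree s) r_3n = (3 * n)%N%:Z by rewrite den_rg.
have N1 : rg (den write_tree s) r_size = (size E)%:Z by rewrite den_rg.
have bit1 i : (i < size E)%N -> ar (den write_tree s) a_bit
    (ar (den write_tree s) a_order i%:Z) = (nat_of_bool ((nth_exp E L i).+1 \in E))%:Z.
  by move=> iN; rewrite !den_ar // r8.
rewrite /write_output den_seq; remember (den write_tree s) as s1 eqn:s1E.
have raw2 := write_bits_ok n1 g2.
have rg2 r : r != r_i -> rg (den write_bits s1) r = rg s1 r.
  by move=> ne; rewrite den_rg //= !inE (negbTE ne).
have ar2 j : j != a_raw -> ar (den write_bits s1) j = ar s1 j.
  by move=> ne; rewrite den_ar ?inE.
rewrite den_seq; remember (den write_bits s1) as s2 eqn:s2E.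
have T2 : trie B (size E) (nn + 6 * n) A s2.
  have [t1 t2 t3 t4 t5 t6 t7 t8 t9] := T.
  split=> //; rewrite ?rg2 //.
  - by move=> w t wA; rewrite !ar2; [exact: t7|case: (t)|case: (t)].
  - by move=> a t aA; rewrite ar2; [exact: t8|case: (t)].
  move=> i iN; rewrite ar2 // raw2 ifF; [exact: t9|lia].
rewrite den_seq; remember (den (0%N ::= _)%P s2) as s3 eqn:s3E.
have ar4 : ar (den (4%N ::= $r_al)%P s3) = ar s2 by rewrite s3E.
have rg4 r : r != 4%N -> r != 0%N -> rg (den (4%N ::= $r_al)%P s3) r = rg s2 r.
  by move=> ne4 ne0; rewrite den_rg ?inE // s3E den_rg ?inE.
split=> //.
- by rewrite s3E; do 2!apply: den_trie => //.
- move=> r rN; have [wA hr] := hw r rN; split=> //.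
  by rewrite ar4 raw2 ifF //; lia.
- move=> i iN; rewrite ar4 raw2 ifT; last by lia.
  rewrite (_ : _ - _ = i%:Z); last by lia.
  by apply: bit1; exact: ltnW.
split; try by rewrite rg4 // rg2.
  by rewrite den_rg // s3E rg_let /= rg2.
by rewrite rg_let /= s3E den_rg // rg2.
Qed.

Lemma main_ok n B nn d e s : circuit n d e ->
  rg s r_n = n%:Z -> rg s r_3n = (3 * n)%N%:Z -> rg s r_6n = (6 * n)%N%:Z ->
  rg s r_nn = nn%:Z -> rg s base_reg = B%:Z ->
  input_at n d s -> (forall j k, j != a_raw -> ar s j k = 0) ->
  exists E L D S A, result n B nn e (den main s) E L D S A.
Proof.
move=> crc hn h3 h6 hnn hB inp zero.
have -> : den main s = den write_output
    (den (Rep r_n process) (den sinks (den chain (den halves s)))).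
  by rewrite /main /write_output 4!den_seq.
set s1 := den (Rep r_n process) _.
have f1 x : x \in [:: r_3n; r_6n; r_nn; base_reg] -> rg s1 x = rg s x.
  rewrite !inE => hx; rewrite /s1 !den_rg //; by case/or4P: hx => /eqP ->.
have kids : forall t z, ar s1 (4 + child_offset t)%N z = 0.
  by move=> t z; rewrite /s1 !den_ar ?zero //; case: t.
case: (posnP n) => n0.
  exists [::], [::], (fun _ _ => 0), (fun=> false).
  have sz : rg s1 r_size = 0.
    rewrite /s1 [den (Rep _ _)]/den -/den.
    have -> : rg (den sinks (den chain (den halves s))) r_n = 0 by rewrite !den_rg // hn n0.
    rewrite /= den_rg // /chain den_seq den_rg //.
    by rewrite den_if /= den_rg // hn n0 ltxx rg_let.
  apply: write_output_ok => //.
  - by rewrite n0.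
  - move=> c _; exists (fun=> 0); split=> //; exists 0%N => T _.
    by rewrite n0 !big_ord0 /weigh; split; rewrite big1 // => t _; rewrite mul0r.
  by split=> //; rewrite f1 ?inE.
have [Q [E [L [S [b [kh hQ plc]]]]]] := build_ok n0 crc hn h3 h6 inp zero.
rewrite -/s1 in kh plc.
have [st pk prk sub succ im sz cnt zro one repr] := plc.
have [cst lst rws] := st; have srt := listing_sorting lst.
have sD : size (rev (take n Q)) = n by rewrite size_rev size_take; case: ltngtP hQ => // ->.
have uD : uniq (rev (take n Q)) by rewrite rev_uniq take_uniq // (kahn_uniq kh).
have subD : {subset rev (take n Q) <= iota 0 n}.
  by move=> q; rewrite mem_rev mem_iota => /mem_take /(kahn_lt kh).
have memD : rev (take n Q) =i iota 0 n.
  by apply: (uniq_min_size uD subD _).2; rewrite sD size_iota.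
have pD : perm_eq (rev (take n Q)) (iota 0 n).
  by apply: uniq_perm => //; exact: iota_uniq.
exists E, L, (row n s1), S; apply: write_output_ok => //.
- exact: listing_max lst.
- exact: rows_compact rws.
- exact: rows_value rws.
- move=> p pn; have [|id [idE _ <-]] := im p; first by rewrite memD mem_iota.
  exact: mem_nth.
- move=> c tc; have [g rg_] := repr c tc; exists g.
  rewrite -(big_mkord predT (fun q => c q * 2 ^+ e q)) -(big_mkord predT (fun q => `|c q|%N)).
  by rewrite /index_iota subn0 -!(perm_big _ pD).
split=> //; try by rewrite f1 ?inE.
- exact: listing_size lst.
- move=> r l rN lN; rewrite !(listing_order lst) // (consts_row cst) //.
  by apply: leq_trans (listing_max lst); exact: sorting_nth.
by move=> i iN; rewrite (listing_order lst) // (listing_bit lst) // sorting_nth.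
Qed.

(** * Running time *)

Definition make_tree : cmd := (prelude ;; square ;; base ;; main)%P.

Arguments compile : simpl never.

Lemma compile_seq p k d c1 c2 : code_at p k (compile k d (Seq c1 c2)) ->
  let k1 := (k + size (compile k d c1))%N in
  [/\ code_at p k (compile k d c1), code_at p k1 (compile k1 d c2) &
    (k + size (compile k d (Seq c1 c2)) = k1 + size (compile k1 d c2))%N].
Proof.
move=> h k1; have E : compile k d (Seq c1 c2) = compile k d c1 ++ compile k1 d c2 by [].
rewrite E in h *; case: (code_at_cat h) => h1 h2.
by rewrite size_cat addnA; split.
Qed.

(** Input matrix, then three output arrays of [3 * n] entries and one more cell
for the last list head. *)
Definition base_of (n : nat) : nat := (n * n + 9 * n + 1)%N.

Lemma square_value n s : rg s r_n = n%:Z ->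
  rg (den square s) r_nn = (n * n)%N%:Z.
Proof.
move=> hn; pose P (i : nat) s' := rg s' r_nn = (i * n)%N%:Z.
rewrite /square den_seq; apply: (den_rep (P := P)); first by rewrite den_rg // hn.
  by rewrite /P rg_let mul0n.
move=> i s' _ fr _ h; rewrite /P rg_let /= h (fr r_n) // den_rg // hn mulSn; lia.
Qed.

Lemma code_at_self p : code_at p 0 p.
Proof. by exists [::], [::]; rewrite cats0. Qed.

(** The read-only registers are computed before the part that loops over them,
because a loop counter has to be read-only in the whole part; therefore the
program is treated as a sequence of four parts, each with its own cost. *)
Lemma run_ok prg : prg = compile 0 scratch make_tree ->
  exists C, forall n (mat : seq int), size mat = (n * n)%N ->
  exists t c s, [/\ halts_in prg
      (Config 0 (fun r => if r == 0%N then n%:Z else 0) (nth 0 mat)) t c,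
    (t <= C * maxn 1 (n ^ 2))%N,
    [/\ rg s r_n = n%:Z, rg s r_3n = (3 * n)%N%:Z, rg s r_6n = (6 * n)%N%:Z,
        rg s r_nn = (n * n)%N%:Z & rg s base_reg = (base_of n)%:Z],
    (forall z : nat, ar s a_raw z%:Z = nth 0 mat z) /\
      (forall j z, j != a_raw -> ar s j z = 0) &
    (forall r, (r < scratch)%N -> creg c r = rg (den main s) r) /\
      holds_arrays (base_of n) (den main s) (cmem c)].
Proof.
move=> prgE; have [K1 cost1] := cost_poly prelude; have [K2 cost2] := cost_poly square.
have [K3 cost3] := cost_poly base; have [K4 cost4] := cost_poly main.
(* [D] bounds the loop counters, and 36 is the square of 6. *)
exists (36 * (K1 + K2 + K3 + K4))%N => n mat szm.
pose D := (6 * maxn 1 n)%N; pose B := base_of n.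
have D0 : (0 < D)%N by rewrite /D muln_gt0 /= leq_max.
pose g0 := fun r : nat => if r == 0%N then n%:Z else 0.
pose s0 := Store g0 (fun j z => if (j == a_raw) && (0 <= z) then nth 0 mat `|z|%N else 0).
have hold0 : holds_arrays B s0 (nth 0 mat).
  move=> j z j32; rewrite /cell /=.
  case: (eqVneq j a_raw) => [->|ne] /=.
    case: (lerP 0 z) => [z0|z0] /=; last by rewrite nth_default // szm /B /base_of; lia.
    case: ltrP => zB //.
    by rewrite !nth_default ?szm /B /base_of //; rewrite /B /base_of in zB; lia.
  by rewrite nth_default // szm /B /base_of; lia.
have code0 : code_at prg 0 (compile 0 scratch make_tree).
  by rewrite -prgE; exact: code_at_self.
have size0 : size prg = (0 + size (compile 0 scratch make_tree))%N by rewrite -prgE.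
have [code1 {}code0 e1] := compile_seq code0.
have [code2 {}code0 e2] := compile_seq code0.
have [code3 code4 e3] := compile_seq code0.
rewrite e1 e2 e3 in size0; clear e1 e2 e3.
have inv1 : ro_inv [::] B D s0 by split.
have [g1 [m1 [run1 hold1 rel1 _]]] :=
  compile_ok prelude_ok inv1 hold0 (leqnn _) code1 (fun r _ => erefl (g0 r)).
pose s1 := den prelude s0.
have [n1 h31 h61] : [/\ rg s1 r_n = n%:Z, rg s1 r_3n = (3 * n)%N%:Z &
    rg s1 r_6n = (6 * n)%N%:Z].
  rewrite /s1 /prelude !denE /= /upd /= /g0 /=; split; last 2 first; [lia|lia|by []].
have rounds_le s : [/\ rg s r_n = n%:Z, rg s r_3n = (3 * n)%N%:Z &
    rg s r_6n = (6 * n)%N%:Z] ->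
    forall r, r \in [:: r_n; r_3n; r_6n] -> (rounds (rg s r) <= D)%N.
  have nD : (n <= maxn 1 n)%N by rewrite leq_maxr.
  by move=> [q1 q2 q3] r; rewrite !inE => /or3P[]/eqP ->; rewrite ?q1 ?q2 ?q3 /= /D; lia.
have inv2 : ro_inv [:: r_n; r_3n; r_6n] B D s1.
  by split=> // r hr _; apply: rounds_le.
have [g2 [m2 [run2 hold2 rel2 _]]] :=
  compile_ok square_ok inv2 hold1 (leqnn _) code2 rel1.
have nn2 := square_value n1.
have fr2 r : r != r_nn -> rg (den square s1) r = rg s1 r.
  by move=> ne; rewrite den_rg //= !inE (negbTE ne).
have ar2 : ar (den square s1) = ar s1.
  by rewrite /square den_seq /den -/den; elim: (rounds _) => //= k ->.
have inv3 : ro_inv [:: r_n; r_3n; r_6n] B D (den square s1).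
  by split=> // r hr _; apply: rounds_le => //; rewrite !fr2.
have [g3 [m3 [run3 hold3 rel3 _]]] :=
  compile_ok base_ok inv3 hold2 (leqnn _) code3 rel2.
pose s3 := den base (den square s1).
have fr3 r : r != base_reg -> rg s3 r = rg (den square s1) r.
  by move=> ne; rewrite /s3 den_rg ?inE.
have B3 : rg s3 base_reg = B%:Z.
  by rewrite /s3 rg_let /= nn2 !fr2 // h31 h61 /B /base_of; lia.
have inv4 : ro_inv [:: base_reg; r_n; r_3n; r_6n] B D s3.
  split=> // r; rewrite inE => /orP[/eqP ->//|hr] _.
  by apply: rounds_le => //; rewrite !fr3 // !fr2.
have [g4 [m4 [run4 hold4 rel4 _]]] :=
  compile_ok main_cmd_ok inv4 hold3 (leqnn _) code4 rel3.
have := reach_trans (reach_trans (reach_trans run1 run2) run3) run4.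
set T := (_ + _ + _ + _)%N => -[t tT ht].
exists t, (Config (size prg) g4 m4), s3; split.
- split; last by rewrite /halted.
  by rewrite size0.
- apply: leq_trans tT _; rewrite /T.
  have D2 : (D ^ 2 = 36 * maxn 1 (n ^ 2))%N.
    by rewrite /D expnMn; congr (_ * _)%N; case: (n) => // k; rewrite !(maxn_idPr _) // expn_gt0.
  have up K c : (depth c <= 2)%N -> (forall D, 0 < D -> cost D c <= K * D ^ depth c)%N ->
      (cost D c <= K * D ^ 2)%N.
    move=> dc hc; apply: leq_trans (hc D D0) _.
    by rewrite leq_mul2l leq_pexp2l ?orbT.
  rewrite [X in (_ <= X)%N](_ : _ = (K1 + K2 + K3 + K4) * D ^ 2)%N; last by rewrite D2; lia.
  rewrite !mulnDl; apply: leq_add; [apply: leq_add; [apply: leq_add|]|]; by apply: up.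
- by split; [rewrite fr3 ?fr2|rewrite fr3 ?fr2|rewrite fr3 ?fr2|rewrite fr3|exact: B3].
- have ar3 : ar s3 = ar s0 by rewrite /s3 /base den_let /= ar2 /s1.
  rewrite ar3; split=> [z //|j z ne] /=.
  by rewrite (negbTE ne).
by split.
Qed.

(** * A power circuit as a matrix with exponents *)

Lemma int_of_trit_eq0 t : (int_of_trit t == 0) = (t == Zero).
Proof. by case: t. Qed.

Lemma int_of_trit_is_trit t : is_trit (int_of_trit t).
Proof. by case: t. Qed.

Lemma intrX2 (R : realType) m : (2 ^+ m : R) = (2 ^+ m : int)%:~R.
Proof. by rewrite rmorphXn. Qed.

Section Exponents.
Variables (R : realType) (Pi : power_circuit R).

(** By definition of a power circuit the marking of a node has an integer
value; it is nonnegative by the lemmas that follow. *)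
Definition expo (P : Pi) : nat := Num.truncn (eps (Lambda (@delta R Pi) P)).

(** The value of [P], being that of a marking too, is an integer, and no
negative power of 2 is one. *)
Lemma eps_Lambda (P : Pi) : eps (Lambda (@delta R Pi) P) = (expo P)%:R.
Proof.
have /intrP [z hz] := eval_int (Lambda (@delta R Pi) P).
have e2 : eps_node P = 2 ^ z.
  rewrite /eps_node eval_nodeE; last exact: delta_acyclic.
  by rewrite hz powR_intmul.
have /intrP [y hy] := eval_int (fun Q : Pi => if Q == P then Plus else Zero).
have hy2 : eps_node P = y%:~R.
  rewrite -hy /eval_marking (bigD1 P) //= eqxx mul1r big1 ?addr0 // => Q /negbTE ->.
  exact: mul0r.
have [m zm] : exists m : nat, z = m%:Z.
  case: z {hz} e2 => [m|k] e2; first by exists m.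
  have p0 : (0 : R) < eps_node P by rewrite e2 exprz_gt0.
  have p1 : eps_node P < 1.
    by rewrite e2 -[2 ^ _]/((2 ^+ k.+1)^-1) invf_lt1 ?exprn_gt0 ?exprn_egt1 // ltr1n.
  move: p0 p1; rewrite hy2 ltr0z ltrz1; lia.
by rewrite /expo /eps hz zm -pmulrn natrK.
Qed.

Lemma eps_nodeE (P : Pi) : eps_node P = 2 ^+ expo P.
Proof.
rewrite /eps_node eval_nodeE; last exact: delta_acyclic.
by rewrite -/(eps _) eps_Lambda powR_mulrn.
Qed.

Lemma expo_sum (P : Pi) :
  \sum_(Q : Pi) int_of_trit (delta P Q) * 2 ^+ expo Q = (expo P)%:Z.
Proof.
apply: (@intr_inj R); rewrite rmorph_sum /=.
rewrite -pmulrn -eps_Lambda.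
apply: eq_bigr => Q _; rewrite rmorphM /= -intrX2 -eps_nodeE //.
Qed.

Variables (s : seq Pi) (sP : perm_eq s (enum Pi)).

Definition ent (p q : nat) : int :=
  if (onth s p, onth s q) is (Some P, Some Q) then int_of_trit (delta P Q) else 0.

Definition expo_at (p : nat) : nat := if onth s p is Some P then expo P else 0%N.

Lemma size_nodes : size s = #|Pi|.
Proof. by rewrite (perm_size sP) cardE. Qed.

Lemma big_onth (A : nmodType) (F : Pi -> A) (F' : nat -> A) :
  (forall q Q, onth s q = Some Q -> F' q = F Q) ->
  \sum_(q < size s) F' q = \sum_(Q : Pi) F Q.
Proof.
move=> h; rewrite -[RHS]big_enum -(perm_big _ sP) /=.
have -> : \sum_(i <- s) F i = \sum_(x <- [seq F' q | q <- iota 0 (size s)]) x.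
  suff -> : [seq F' q | q <- iota 0 (size s)] = [seq F Q | Q <- s] by rewrite big_map.
  apply: (@eq_from_nth _ 0); rewrite !size_map size_iota // => i hi.
  rewrite (nth_map 0%N) ?size_iota // nth_iota // add0n.
  have [Q E] : exists Q, onth s i = Some Q.
    by move: hi; rewrite ltnNge -onthNE; case: (onth s i) => // Q _; exists Q.
  by rewrite (nth_map Q) // (onth_nth _ _ _ _ E); apply: h.
by rewrite big_map -(big_mkord xpredT F') /index_iota subn0.
Qed.

Lemma onth_lt p : (p < size s)%N -> exists P, onth s p = Some P.
Proof.
move=> hp; by move: hp; rewrite ltnNge -onthNE; case: (onth s p) => // P _; exists P.
Qed.

Lemma circuit_of : circuit (size s) ent expo_at.
Proof.
split=> [p q _ _|p pn|].
- rewrite /ent; case: (onth s p) => // P; case: (onth s q) => // Q.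
  exact: int_of_trit_is_trit.
- have [P EP] := onth_lt pn; rewrite /expo_at EP -expo_sum.
  rewrite -(big_onth (F' := fun q => ent p q * 2 ^+ expo_at q)) // => q Q EQ.
  by rewrite /ent /expo_at EP EQ.
- pose rk p := if onth s p is Some P then #|connect (darc (@delta R Pi)) P| else 0%N.
  exists rk => p q pn qn; have [P EP] := onth_lt pn; have [Q EQ] := onth_lt qn.
  rewrite /ent /rk EP EQ int_of_trit_eq0 => ne; apply/proper_card/properP; split.
    apply/subsetP => S; rewrite /in_mem /= => QS.
    by apply: connect_trans (connect1 _) QS.
  exists P; rewrite /in_mem /= ?connect0 //; apply: acyclic_back => //.
  exact: delta_acyclic.
Qed.

Lemma size_matrix : size [seq int_of_trit (delta P Q) | P <- s, Q <- s] = (size s * size s)%N.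
Proof. exact: size_allpairs. Qed.

End Exponents.

Lemma nth_allpairs_onth (T U : Type) (f : T -> T -> U) x0 (s1 s2 : seq T) p q P Q :
  onth s1 p = Some P -> onth s2 q = Some Q ->
  nth x0 [seq f P Q | P <- s1, Q <- s2] (p * size s2 + q) = f P Q.
Proof.
elim: s1 p => [|x s1 IH] [|p] //=.
  move=> [->] hq.
  have q2 : (q < size s2)%N.
    by rewrite ltnNge -onthNE hq.
  by rewrite mul0n add0n nth_cat size_map q2 (nth_map Q) // (onth_nth _ _ _ _ hq).
move=> hp hq; rewrite nth_cat size_map mulSn -addnA ltnNge leq_addr /=.
by rewrite addKn; apply: IH.
Qed.

(** * The power circuit and the tree of a list of exponents *)

Lemma trit_of_int_eq0 z : (trit_of_int z == Zero) = (z == 0).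
Proof.
rewrite /trit_of_int; case: (z =P -1) => [->|_]; first by [].
by case: (z == 0).
Qed.

Section Output.
Variables (R : realType) (E L : seq nat) (D : nat -> nat -> int).
Hypothesis srt : sorting E L.
Hypothesis cmp : forall id, (id < size E)%N -> compact E (D id).
Hypothesis val_D : forall id, (id < size E)%N -> value E (D id) = (nth 0%N E id)%:Z.

Let uE : uniq E := sorting_uniq srt.

Definition out_delta (i k : 'I_(size E)) : trit := trit_of_int (D i k).

Lemma out_deltaE i k : int_of_trit (out_delta i k) = D i k.
Proof. by rewrite trit_of_intK //; case: (cmp (ltn_ord i)) => h _; apply: h. Qed.

Lemma out_delta_lt (i k : 'I_(size E)) : D i k != 0 -> (nth 0%N E k < nth 0%N E i)%N.
Proof.
move=> nz; have := compact_below uE (cmp (ltn_ord i)) (ltn_ord k) nz.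
by rewrite val_D // ltz_nat; apply; rewrite lez_nat.
Qed.

Lemma out_acyclic : acyclic out_delta.
Proof.
case=> // i p; rewrite /= => cyc.
pose gt (i k : 'I_(size E)) := (nth 0%N E k < nth 0%N E i)%N.
have : path gt i (rcons p i).
  apply: sub_path cyc => j k; rewrite /darc /= trit_of_int_eq0; exact: out_delta_lt.
have gt_trans : transitive gt by move=> y x z h1 h2; apply: ltn_trans h2 h1.
move=> /(order_path_min gt_trans) /allP /(_ i).
by rewrite mem_rcons mem_head /gt ltnn => /(_ isT).
Qed.

(** By induction on the exponent, as the arcs go to smaller exponents. *)
Lemma out_eval_node i : eval_node R out_delta i = 2 ^+ nth 0%N E i.
Proof.
have [m] := ubnP (nth 0%N E i); elim: m => // m IH in i *; rewrite ltnS => im.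
rewrite eval_nodeE; last exact: out_acyclic.
rewrite -powR_mulrn //; congr (_ `^ _); rewrite pmulrn -val_D // /value.
rewrite rmorph_sum; apply: eq_bigr => k _; rewrite out_deltaE rmorphM rmorphXn /=.
case: (eqVneq (D i k) 0) => [->|nz]; first by rewrite !mul0r.
by rewrite IH //; apply: leq_trans (out_delta_lt nz) im.
Qed.

Lemma out_eval (M : 'I_(size E) -> trit) : eval_marking R out_delta M =
  (\sum_(k < size E) int_of_trit (M k) * 2 ^+ nth 0%N E k)%:~R.
Proof.
rewrite rmorph_sum; apply: eq_bigr => k _.
by rewrite out_eval_node rmorphM rmorphXn.
Qed.

Lemma out_eval_int (M : 'I_(size E) -> trit) : eval_marking R out_delta M \is a Num.int.
Proof. by rewrite out_eval intr_int. Qed.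

Definition out_circuit : power_circuit R := PowerCircuit out_acyclic out_eval_int.

Lemma out_eps_node (i : out_circuit) : eps_node i = 2 ^+ nth 0%N E (i : 'I_(size E)).
Proof. exact: out_eval_node. Qed.

Lemma pow2_inj : injective (fun m => 2 ^+ m : R).
Proof.
by apply: ieexprIn; rewrite ?ltr0n // gt_eqF ?ltr1n.
Qed.

Definition out_nodes : seq 'I_(size E) := pmap insub L.

Lemma val_out_nodes : map val out_nodes = L.
Proof.
rewrite pmap_filter; last exact: insubK.
apply/all_filterP/allP => k; rewrite (sorting_mem srt).
by move=> kE; rewrite (insubT (fun k => k < size E)%N kE).
Qed.

Lemma size_out_nodes : size out_nodes = size E.
Proof. by rewrite -(size_map val) val_out_nodes (sorting_size srt). Qed.

Lemma index_out_nodes (i : 'I_(size E)) : index i out_nodes = index (val i) L.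
Proof. by rewrite -val_out_nodes index_map //; apply: val_inj. Qed.

Lemma nth_out_nodes x r : (r < size E)%N -> val (nth x out_nodes r) = nth 0%N L r.
Proof.
move=> rN; rewrite -val_out_nodes (nth_map x) ?size_out_nodes //.
Qed.

Lemma index_L (i : 'I_(size E)) : (index (val i) L < size E)%N /\ nth 0%N L (index (val i) L) = i.
Proof.
have iL : val i \in L by rewrite (sorting_mem srt) ltn_ord.
by split; [rewrite -[X in (_ < X)%N](sorting_size srt) index_mem|exact: nth_index].
Qed.

Definition out_bits : seq bool :=
  [seq 2 * eps_node PQ.1 == eps_node PQ.2 :> R
  | PQ : out_circuit * out_circuit <- zip out_nodes (behead out_nodes)].

Lemma nth_out_bits i : (i.+1 < size E)%N ->
  nth false out_bits i = ((nth_exp E L i).+1 \in E).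
Proof.
move=> iN; have x : 'I_(size E) by exists i; apply: ltn_trans iN.
have sz : size (behead out_nodes) = (size E).-1 by rewrite size_behead size_out_nodes.
rewrite (nth_map (x, x)); last by rewrite size_zip size_out_nodes sz; lia.
rewrite nth_zip_cond size_zip size_out_nodes sz (_ : (i < _)%N); last by lia.
rewrite /= !out_eps_node nth_behead !nth_out_nodes //; last by lia.
rewrite -exprS (inj_eq pow2_inj) -(adjacent_mem srt); last by lia.
by rewrite /adjacent iN eq_sym.
Qed.

Variables (A : seq (seq trit)).

Definition out_tree : tree_data out_circuit :=
  @TreeData out_circuit out_nodes out_bits (mem A) (level A).

Hypothesis A_root : [::] \in A.
Hypothesis A_parent : forall w t, rcons w t \in A -> w \in A.
Hypothesis A_uniq : uniq A.
Hypothesis A_size : forall w, w \in A -> (size w <= size E)%N.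
Hypothesis A_word : forall r, (r < size E)%N -> word D L r \in A.
Hypothesis A_cover : forall w, w \in A ->
    w = [::] \/ exists2 r, (r < size E)%N & w = take (size w) (word D L r).

Lemma size_word r : size (word D L r) = size E.
Proof. by rewrite size_map size_rev (sorting_size srt). Qed.

Lemma A_prefix u v : u ++ v \in A -> u \in A.
Proof.
elim/last_ind: v => [|v t IH]; first by rewrite cats0.
by rewrite -rcons_cat => /A_parent.
Qed.

Lemma leaf_cover w : w \in A -> size w = size E -> (0 < size E)%N ->
  exists2 r, (r < size E)%N & w = word D L r.
Proof.
move=> wA sw N0; case: (A_cover wA) => [w0|[r rN ew]].
  by rewrite w0 /= in sw; rewrite -sw in N0.
by exists r => //; rewrite ew sw take_oversize // size_word.
Qed.

Lemma leaf_word r (i : 'I_(size E)) : leaf_marking out_tree (word D L r) i =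
  trit_of_int (D (nth 0%N L r) i).
Proof.
have [iN iE] := index_L i.
rewrite /leaf_marking /= index_out_nodes /word map_rev revK.
by rewrite (nth_map 0%N) ?(sorting_size srt) // iE.
Qed.

Lemma out_Lambda (i : 'I_(size E)) :
  is_leaf out_tree (word D L (index (val i) L)) /\
  leaf_marking out_tree (word D L (index (val i) L)) =1 Lambda out_delta i.
Proof.
have [iN iE] := index_L i; split.
  by rewrite /is_leaf /= size_word size_out_nodes eqxx andbT; apply: A_word.
by move=> k; rewrite leaf_word iE.
Qed.

(** A proper prefix of a row has a child as the row goes on, so all leaves are
on the last level; there the words are rows, which are compact. *)
Lemma out_is_tree : is_tree_representation out_tree.
Proof.
split=> /=.
- by move=> i; rewrite -index_mem index_out_nodes size_out_nodes; case: (index_L i).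
- have := sorting_sorted srt; rewrite -val_out_nodes -map_comp sorted_map.
  apply: sub_sorted => i k; rewrite /= !out_eps_node.
  by rewrite ltr_eXn2l ?ltr1n.
- by [].
- rewrite size_out_nodes; split=> /=; [exact: A_root|by move=> w t; apply: A_parent|exact: A_size|].
  move=> w wA wN; have [r rN ew] : exists2 r, (r < size E)%N & w = take (size w) (word D L r).
    case: (A_cover wA) => // ->; exists 0%N; last by rewrite take0.
    by apply: leq_ltn_trans wN.
  exists (nth Zero (word D L r) (size w)).
  rewrite {1}ew -take_nth ?size_word //.
  by apply: (@A_prefix _ (drop (size w).+1 (word D L r))); rewrite cat_take_drop A_word.
- move=> w /andP[/= wA /eqP]; rewrite size_out_nodes => sw i k.
  have N0 : (0 < size E)%N by apply: leq_ltn_trans (ltn_ord i).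
  have [r rN ->] := leaf_cover wA sw N0.
  rewrite !inE !leaf_word !trit_of_int_eq0 => nzi nzk ne.
  rewrite !out_eval_node -exprS; split=> [/pow2_inj|/pow2_inj/eqP].
    by move=> /eqP; rewrite nth_uniq // => /eqP/val_inj.
  have [_ h] := cmp (sorting_nth srt rN).
  by apply/negP; apply: h.
- by move=> i; have [h1 h2] := out_Lambda i; exists (word D L (index (val i) L)).
- by move=> i; rewrite filter_uniq // rev_uniq.
- by move=> i w; rewrite mem_filter mem_rev andbC.
Qed.

End Output.

(** * Output, equivalence and conclusion *)

Lemma uniq_flatten_map (T U : eqType) (f : T -> seq U) (s : seq T) : uniq s ->
  (forall x, x \in s -> uniq (f x)) ->
  (forall x y z, x \in s -> y \in s -> z \in f x -> z \in f y -> x = y) ->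
  uniq (flatten [seq f x | x <- s]).
Proof.
elim: s => //= x s IH /andP[xs us] uf dis; rewrite cat_uniq uf ?mem_head //=.
apply/andP; split; last first.
  apply: IH => // [y ys|y y' z ys y's]; first by apply: uf; rewrite inE ys orbT.
  by apply: dis; rewrite inE ?ys ?y's orbT.
apply/hasPn => z /flatten_mapP[y ys zy]; apply/negP => zx.
have := dis x y z (mem_head _ _); rewrite inE ys orbT => /(_ isT zx zy) xy.
by rewrite xy ys in xs.
Qed.

Lemma card_supp (G : finType) (M : G -> trit) :
  #|supp M| = (\sum_(P : G) `|int_of_trit (M P)|)%N.
Proof.
rewrite -sum1_card big_mkcond; apply: eq_bigr => P _; rewrite inE.
by case: (M P).
Qed.

Section Output.
Variables (n B nn : nat) (e : nat -> nat) (s : store) (E L : seq nat).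
Variables (D : nat -> nat -> int) (S : nat -> bool) (A : seq (seq trit)) (c : config).
Hypothesis res : result n B nn e s E L D S A.
Hypothesis B_large : (nn + 9 * n < B)%N.
Hypothesis regs : forall r, (r < scratch)%N -> creg c r = rg s r.
Hypothesis mems : holds_arrays B s (cmem c).

Lemma mem_raw z : (z < B)%N -> cmem c z = ar s a_raw z%:Z.
Proof. by move=> zB; rewrite -(@mems a_raw) // /cell /= ltz_nat zB. Qed.

Lemma mem_record w j : (j < 32)%N -> j != a_raw ->
  cmem c (pointer B (record_of A w) + j)%N = ar s j (record_of A w)%:Z.
Proof. by move=> j32 ne; rewrite -(@mems j) // /cell (negbTE ne) muln1. Qed.

Definition output_of (R : realType) : power_circuit R :=
  out_circuit R (result_sorting res) (result_compact res) (result_value res).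

Definition output_tree (R : realType) : tree_data (output_of R) :=
  out_tree R (result_sorting res) (result_compact res) (result_value res) A.

Lemma output_is_tree (R : realType) : is_tree_representation (output_tree R).
Proof.
have tr := result_trie res; apply: out_is_tree.
- by case: (trie_root tr).
- exact: trie_parent tr.
- exact: trie_uniq tr.
- exact: trie_size tr.
- by move=> r rN; case: (result_word res rN).
- exact: result_cover res.
Qed.

Lemma chained_linked p l : chained (ar s a_link) B A p l ->
  linked_list (cmem c) (fun w => pointer B (record_of A w)) p l.
Proof.
elim: l p => //= w l IH p [-> h]; split=> //.
by rewrite mem_record //; apply: IH.
Qed.

(** The three arrays are at distance [3 * n] and end below [B]; records are 64
cells apart, starting above [B]. *)
Lemma output_ok (R : realType) : tree_output (output_tree R) c.
Proof.
have N3 := result_max res; have srt := result_sorting res; have tr := result_trie res.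
have szN : size (nodes (output_tree R)) = size E by exact: (size_out_nodes srt).
exists nn, (nn + 3 * n)%N, (nn + 6 * n)%N, (fun w => pointer B (record_of A w)).
rewrite szN; split.
- have [h0 h1 h2 h3 h4] := result_regs res; rewrite !regs //; split=> //.
  by rewrite h3 /record_of (proj1 (trie_root tr)).
- move=> i; exists (word D L (index (val i) L)).
  have [h1 h2] := out_Lambda R srt (result_compact res) (result_value res)
    (fun r rN => proj1 (result_word res rN)) i.
  split=> //; rewrite (index_out_nodes srt).
  have [iN _] := index_L srt i.
  by rewrite mem_raw ?(proj2 (result_word res iN)) //; lia.
- move=> i iN; have iN' : (i.+1 < size E)%N by lia.
  by rewrite mem_raw ?(nth_out_bits R srt (result_compact res) (result_value res)) ?(result_bits res) //; lia.
- split=> [w t /= wA|i iN]; last first.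
    by rewrite mem_raw; [exact: (chained_linked (trie_level tr iN))|lia].
  rewrite mem_record ?(proj2 (trie_child tr t wA)) //; by case: t.
remember (size E).+1 as K eqn:KE.
have lvl : uniq (flatten [seq level A i | i <- iota 0 K]).
  apply: uniq_flatten_map => [|i _|i j w _ _]; first exact: iota_uniq.
    by rewrite filter_uniq // rev_uniq (trie_uniq tr).
  by rewrite !mem_filter => /andP[/eqP <- _] /andP[/eqP <- _].
have inA w : w \in flatten [seq level A i | i <- iota 0 K] -> w \in A.
  by move=> /flatten_mapP[i _]; rewrite mem_filter mem_rev => /andP[].
rewrite !cat_uniq !iota_uniq !has_cat !negb_or.
have dis a k a' k' : (a + k <= a')%N -> ~~ has (mem (iota a k)) (iota a' k').
  by move=> h; apply/hasPn => z; rewrite /= !mem_iota; lia.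
have disF a k (W : seq (seq trit)) : (a + k <= B)%N -> ~~ has (mem (iota a k))
    (flatten [seq iota (pointer B (record_of A w)) 4 | w <- W]).
  move=> h; apply/hasPn => z /flatten_mapP[w _]; rewrite !mem_iota /pointer.
  rewrite -[mem _ z]/(z \in _) mem_iota; lia.
rewrite !dis ?disF ?andTb; [|lia|lia|lia|lia|lia|lia]. 
apply: uniq_flatten_map => // [w _|w w' z wW w'W]; first exact: iota_uniq.
rewrite !mem_iota /pointer => h1 h2.
apply: (record_inj (inA _ wW) (inA _ w'W)); lia.
Qed.

End Output.

Section Equivalence.
Variables (R : realType) (Pi : power_circuit R) (l : seq Pi).
Hypothesis lP : perm_eq l (enum Pi).
Variables (B nn : nat) (s : store) (E L : seq nat).
Variables (D : nat -> nat -> int) (S : nat -> bool) (A : seq (seq trit)).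
Hypothesis res : result (size l) B nn (expo_at l) s E L D S A.

(** The representations that [result_repr] provides are markings, since they use
parked exponents only and these are in [E]. *)
Lemma output_equivalent : equivalent Pi (output_of res R).
Proof.
have srt := result_sorting res; have uE := sorting_uniq srt; split=> [P|M].
  have Pl : P \in l by rewrite (perm_mem lP) mem_enum.
  have iP : (index P l < size l)%N by rewrite index_mem.
  have := result_mem res iP.
  have [Q EQ] := onth_lt iP.
  have QP : Q = P by rewrite -(onth_nth Q _ _ _ EQ) nth_index.
  rewrite /expo_at EQ QP => eE.
  have iE : (index (expo P) E < size E)%N by rewrite index_mem.
  exists (Ordinal iE : output_of res R); rewrite [RHS]eps_nodeE -[in RHS](nth_index 0%N eE).
  exact: out_eps_node.
pose c (q : nat) := if onth l q is Some P then int_of_trit (M P) else 0.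
have [|g [tg gS [T0 hT]]] := result_repr res (c := c).
  by move=> q; rewrite /c; case: (onth l q) => // P; apply: int_of_trit_is_trit.
have [T1 hE] := ltn_bound E.
pose T := maxn T0 T1; have [w1 w2] := hT T (leq_maxl _ _).
have ltT t : t \in E -> (t < T)%N.
  by move=> /hE tT; apply: leq_trans tT (leq_maxr _ _).
have g0 t : t \notin E -> g t = 0.
  by move=> tE; apply/eqP; apply: contraR tE => /gS; apply: (result_sub res).
exists (fun i : 'I_(size E) => trit_of_int (g (nth 0%N E i))); split.
  rewrite [LHS](out_eval R srt (result_compact res) (result_value res)).
  under eq_bigr => k _ do rewrite trit_of_intK //.
  rewrite -(@big_spread _ (fun t => g t * 2 ^+ t) E
    (fun k => g (nth 0%N E k) * 2 ^+ nth 0%N E k) T) //; last first.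
    by move=> t /g0 ->; rewrite mul0r.
  rewrite -/(weigh g T) w1.
  rewrite (big_onth lP (F' := fun q => c q * 2 ^+ expo_at l q)
    (F := fun P : Pi => int_of_trit (M P) * 2 ^+ expo P)); last first.
    by move=> q Q EQ; rewrite /c /expo_at EQ.
  rewrite rmorph_sum; apply: eq_bigr => P _.
  by rewrite rmorphM rmorphXn /= -eps_nodeE.
rewrite !card_supp.
under eq_bigr => k _ do rewrite trit_of_intK //.
have e1 : (\sum_(t < T) `|g t| = \sum_(k < size E) `|g (nth 0%N E k)|)%N.
  apply: (@big_spread nat (fun t => `|g t|%N) E (fun k => `|g (nth 0%N E k)|%N) T) => //.
  by move=> t /g0 ->.
have e2 : (\sum_(q < size l) `|c q| = \sum_(P : Pi) `|int_of_trit (M P)|)%N.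
  apply: (big_onth lP (A := nat) (F := fun P => `|int_of_trit (M P)|%N)
    (F' := fun q => `|c q|%N)) => q Q EQ.
  by rewrite /c EQ.
by rewrite -e2; apply: leq_trans w2; rewrite e1.
Qed.

End Equivalence.

Theorem corollary1 (R : realType) :
  exists (MakeTree : program) (C : nat),
  forall (Pi : power_circuit R) (s : seq Pi), perm_eq s (enum Pi) ->
  exists (t : nat) (c : config),
    [/\ halts_in MakeTree (graph_input s) t c,
        (t <= C * maxn 1 (#|Pi| ^ 2))%N &
        exists (Pi' : power_circuit R) (D : tree_data Pi'),
          [/\ is_tree_representation D,
              tree_output D c,
              equivalent Pi Pi' &
              (#|Pi'| <= 3 * #|Pi|)%N]].
Proof.
have [C run] := run_ok (erefl (compile 0 scratch make_tree)).
exists (compile 0 scratch make_tree), C => Pi s sP.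
have [t [c [st [halt tC [h1 h2 h3 h4 h5] [ar0 ar1] [regs mems]]]]] :=
  run _ _ (size_matrix s).
exists t, c; split=> //; first by rewrite -(size_nodes sP).
have inp : input_at (size s) (ent s) st.
  move=> p q pn qn; rewrite ar0; have [P EP] := onth_lt pn; have [Q EQ] := onth_lt qn.
  by rewrite /ent EP EQ; exact: nth_allpairs_onth.
have [E [L [D [S [A res]]]]] := main_ok (circuit_of sP) h1 h2 h3 h4 h5 inp (fun j k h => ar1 j k h).
exists (output_of res R), (output_tree res R); split.
- exact: output_is_tree.
- apply: (output_ok res _ regs mems R); rewrite /base_of; lia.
- exact: output_equivalent.
- by rewrite card_ord -(size_nodes sP) (result_max res).
Qed.
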